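(* Let $V$ be a vertex operator superalgebra, $k$ an even positive integer, $g=(1\;2\;\cdots\;k)$ acting on $V^{\otimes k}$, and $(M_g,Y_g)$ a weak $g$-twisted $V^{\otimes k}$-module. For $u\in V$ set $Y_\sigma(u,x)=Y_g((\Delta_k(x^k)^{-1}u)^1,x^k)$, taking $(x^k)^{1/2k}=x^{1/2}$. Then $U_g^k(M_g,Y_g)=(U_g^k(M_g),Y_\sigma)=(M_g,Y_\sigma)$ is a weak $\sigma$-twisted (parity-twisted) $V$-module.
   Context: Formal calculus: $\delta(x)=\sum_{n\in\mathbb Z}x^n$; $(x_1-x_2)^n$, $n\in\mathbb C$, is expanded in nonnegative integral powers of the second variable. Vertex (operator) superalgebras: A vertex superalgebra $(V,Y,\mathbf 1)$ is a $\mathbb Z_2$-graded space $V=V^{(0)}\oplus V^{(1)}$ ($|v|=j$ for $v\in V^{(j)}$) with a linear map $v\mapsto Y(v,x)=\sum_{n\in\mathbb Z}v_nx^{-n-1}$, $v_n\in(\mathrm{End}\,V)^{(|v|)}$, and $\mathbf 1\in V^{(0)}$ such that $u_nv=0$ for $n$ sufficiently large, $Y(\mathbf 1,x)=\mathrm{Id}_V$, $Y(v,x)\mathbf 1\in V[[x]]$ with $\lim_{x\to0}Y(v,x)\mathbf 1=v$, and for $u,v$ of homogeneous sign $x_0^{-1}\delta(\frac{x_1-x_2}{x_0})Y(u,x_1)Y(v,x_2)-(-1)^{|u||v|}x_0^{-1}\delta(\frac{x_2-x_1}{-x_0})Y(v,x_2)Y(u,x_1)=x_2^{-1}\delta(\frac{x_1-x_0}{x_2})Y(Y(u,x_0)v,x_2)$.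 A vertex operator superalgebra is a vertex superalgebra with $\omega\in V_2$, $Y(\omega,x)=\sum_nL(n)x^{-n-2}$, where the $L(n)$ satisfy the Virasoro relations with central charge $c\in\mathbb C$, $Y(L(-1)v,x)=\frac{d}{dx}Y(v,x)$, $V=\coprod_{n\in\frac12\mathbb Z}V_n$ with $L(0)=n=\mathrm{wt}$ on $V_n$, $\dim V_n<\infty$, $V_n=0$ for $n$ sufficiently negative, and $V^{(j)}=\coprod_{n\in\mathbb Z+j/2}V_n$. The parity map is the automorphism $\sigma(v)=(-1)^{|v|}v$. Twisted modules: Let $g$ be an automorphism of $V$ of period $k$ (so $g^k=1$) and $\eta$ a fixed primitive $k$-th root of unity. A weak $g$-twisted $V$-module is a $\mathbb Z_2$-graded space $M$ with a linear map $v\mapsto Y_g(v,x)=\sum_{n\in\frac1k\mathbb Z}v^g_nx^{-n-1}\in(\mathrm{End}\,M)[[x^{1/k},x^{-1/k}]]$, $v_n^g\in(\mathrm{End}\,M)^{(|v|)}$, such that $v^g_nw=0$ for $n$ sufficiently large, $Y_g(\mathbf 1,x)=\mathrm{Id}_M$, and for $u,v$ of homogeneous sign $x_0^{-1}\delta(\frac{x_1-x_2}{x_0})Y_g(u,x_1)Y_g(v,x_2)-(-1)^{|u||v|}x_0^{-1}\delta(\frac{x_2-x_1}{-x_0})Y_g(v,x_2)Y_g(u,x_1)=\frac{x_2^{-1}}{k}\sum_{j\in\mathbb Z/k\mathbb Z}\delta\big(\eta^j\frac{(x_1-x_0)^{1/k}}{x_2^{1/k}}\big)Y_g(Y(g^ju,x_0)v,x_2)$.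 A weak $\sigma$-twisted (parity-twisted) module is the case $g=\sigma$, of period 2. Tensor products: $V^{\otimes k}$ is a vertex operator superalgebra with $(Y\otimes Y')(u\otimes u',x)(v\otimes v')=(-1)^{|u'||v|}Y(u,x)v\otimes Y'(u',x)v'$ (iterated), vacuum $\mathbf 1^{\otimes k}$ and conformal vector $\sum_{j=1}^k\omega^j$, where for $v\in V$, $v^j\in V^{\otimes k}$ has $j$-th tensor factor $v$ and all others $\mathbf 1$. The automorphism $g=(1\;2\;\cdots\;k)$ acts by $g(v_1\otimes\cdots\otimes v_k)=(-1)^{|v_1|(|v_2|+\cdots+|v_k|)}v_2\otimes\cdots\otimes v_k\otimes v_1$, so $gv^j=v^{j-1}$ (with $0$ read as $k$). The operator $\Delta_k$: define $a_j\in\mathbb C$, $j\ge1$, by $\exp\big(-\sum_{j\ge1}a_jx^{j+1}\frac{\partial}{\partial x}\big)\cdot x=\frac1k(1+x)^k-\frac1k$, and $\Delta_k(z)=\exp\big(\sum_{j\ge1}a_jz^{-j/k}L(j)\big)(k^{1/2})^{-2L(0)}\big(z^{\frac{1}{2k}(k-1)}\big)^{-2L(0)}$, so $\Delta_k(x)^{-1}=(x^{1/2k})^{(k-1)2L(0)}(k^{1/2})^{2L(0)}\exp\big(-\sum_{j\ge1}a_jx^{-j/k}L(j)\big)$. $Y_\sigma(u,x)$ is the formal series in $(\mathrm{End}\,M_g)[[x^{1/2},x^{-1/2}]]$ obtained from $Y_g((\Delta_k(x)^{-1}u)^1,x)\in(\mathrm{End}\,M_g)[[x^{1/2k},x^{-1/2k}]]$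 by substituting $x\to x^k$ with $(x^k)^{1/2k}=x^{1/2}$. *)

(* Defs.v *)
From mathcomp Require Import all_boot all_order all_algebra.
From mathcomp Require Import boolp classical_sets functions cardinality fsbigop.
From mathcomp Require Export reals.
From mathcomp Require Export complex.

Set Implicit Arguments.
Unset Strict Implicit.
Unset Printing Implicit Defensive.

Import Order.TTheory GRing.Theory Num.Theory.

Local Open Scope classical_set_scope.
Local Open Scope ring_scope.

(** Sums written [\sum_(i \in A)] are the finitely supported sums of
    [fsbigop]; they are 0 on families with infinite support.  All those below
    have finite support under the truncation and grading axioms, as in the
    formal calculus. *)

Section Grading.
Variables (F : fieldType) (V : lmodType F).

Definition subspace (S : set V) : Prop :=
  S 0 /\ forall (a : F) u v, S u -> S v -> S (a *: u + v).

Definition finite_dim (S : set V) : Prop :=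
  exists s : seq V, forall v, S v ->
    exists c : nat -> F, v = \sum_(i < size s) c i *: s`_i.

Definition decomposition (I : choiceType) (S : I -> set V) (v : V)
    (c : I -> V) : Prop :=
  [/\ forall i, S i (c i), finite_set [set i | c i != 0]
    & v = \sum_(i \in [set: I]) c i].

Definition direct_sum (I : choiceType) (S : I -> set V) : Prop :=
  (forall i, subspace (S i)) /\
  forall v, exists! c : I -> V, decomposition S v c.

Definition partial_sum (I : choiceType) (S : I -> set V) (J : set I) : set V :=
  [set v | exists c : I -> V,
     decomposition S v c /\ forall i, ~ J i -> c i = 0].

(* meaningful only when S satisfies direct_sum *)
Definition component (I : choiceType) (S : I -> set V) (v : V) : I -> V :=
  xget (fun=> 0) [set c | decomposition S v c].

End Grading.

(** [f : series M] stands for the sum of the [f e * x^e], [e] rational; in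
    several variables a formal series is its coefficient function
    [e0 e1 e2 |-> coefficient of x_0^e0 x_1^e1 x_2^e2]. *)
Definition series (M : Type) := rat -> M.
Definition series3 (M : Type) := rat -> rat -> rat -> M.

Section FormalCalculus.
Variable F : numClosedFieldType.

(* M[[x^(1/k), x^(-1/k)]] *)
Definition in_root_series (k : nat) (M : lmodType F) (f : series M) : Prop :=
  forall e : rat, k%:R * e \isn't a Num.int -> f e = 0.

Definition deriv_series (M : lmodType F) (f : series M) : series M :=
  fun e => ratr (e + 1) *: f (e + 1).

Definition exp_series (M : lmodType F) (T : series M -> series M)
    (f : series M) : series M :=
  fun e => \sum_(n \in [set: nat]) (n`!%:R : F)^-1 *: iter n T f e.

(* f(x^k) *)
Definition subst_pow (k : nat) (M : lmodType F) (f : series M) : series M :=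
  fun e => f (e / k%:R).

Definition gbinom (n : F) (i : nat) : F := (\prod_(j < i) (n - j%:R)) / i`!%:R.

(* coefficient of y^a z^b in (y - z)^n, in nonnegative integral powers of z *)
Definition binomial_exp (n a b : rat) : F :=
  \sum_(i \in [set: nat])
    (-1) ^+ i * gbinom (ratr n) i * ((a == n - i%:R) && (b == i%:R))%:R.

(* x_0^-1 delta((x_1 - x_2)/x_0) = sum_n x_0^(-n-1) (x_1 - x_2)^n *)
Definition delta_12_0 : series3 F := fun e0 e1 e2 =>
  \sum_(n \in [set: int])
    (e0 == - n%:~R - 1)%:R * binomial_exp n%:~R e1 e2.

(* x_0^-1 delta((x_2 - x_1)/(- x_0)) *)
Definition delta_21_0 : series3 F := fun e0 e1 e2 =>
  \sum_(n \in [set: int])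
    (-1) ^ n * (e0 == - n%:~R - 1)%:R * binomial_exp n%:~R e2 e1.

(* x_2^-1 delta(eta^j (x_1 - x_0)^(1/k) / x_2^(1/k)) *)
Definition delta_10_2 (k : nat) (eta : F) (j : nat) : series3 F :=
  fun e0 e1 e2 => \sum_(n \in [set: int])
    eta ^ (j%:Z * n) * (e2 == - (n%:~R / k%:R) - 1)%:R
      * binomial_exp (n%:~R / k%:R) e1 e0.

Definition mul_series3 (M : lmodType F) (A : series3 F) (B : series3 M) :
    series3 M := fun e0 e1 e2 =>
  \sum_(d \in [set: rat * rat * rat])
    A d.1.1 d.1.2 d.2 *: B (e0 - d.1.1) (e1 - d.1.2) (e2 - d.2).

End FormalCalculus.

(** [Y v w e] is the coefficient of [x^e] in [Y(v,x)w], that is [v_(-e-1) w].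
    [parity false] and [parity true] are the even and odd subspaces. *)

Section Fields.
Variable F : numClosedFieldType.

(* In the two products Y(u,x_1)Y(v,x_2)w and Y(v,x_2)Y(u,x_1)w the exponent of
   x_0 is 0; in Y(Y(g^j u,x_0)v,x_2)w that of x_1 is 0. *)
Definition twisted_jacobi (V M : lmodType F) (parity : bool -> set V)
    (Y : V -> V -> series V) (YM : V -> M -> series M)
    (g : V -> V) (k : nat) (eta : F) : Prop :=
  forall (p q : bool) (u v : V) (w : M), parity p u -> parity q v ->
  forall e0 e1 e2 : rat,
    mul_series3 (delta_12_0 F)
      (fun a b c => (a == 0)%:R *: YM u (YM v w c) b) e0 e1 e2
    - (-1) ^+ (p && q) *:
      mul_series3 (delta_21_0 F)
        (fun a b c => (a == 0)%:R *: YM v (YM u w b) c) e0 e1 e2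
    = k%:R^-1 *: \sum_(j < k)
        mul_series3 (delta_10_2 k eta j)
          (fun a b c => (b == 0)%:R *: YM (Y (iter j g u) v a) w c) e0 e1 e2.

Record vertex_superalgebra := VertexSuperalgebra {
  carrier :> lmodType F;
  parity : bool -> set carrier;
  Y : carrier -> carrier -> series carrier;
  vac : carrier;
  parity_direct_sum : direct_sum parity;
  Y_linearl : forall w e, linear (fun v => Y v w e);
  Y_linearr : forall v e, linear (fun w => Y v w e);
  Y_integral : forall v w, in_root_series 1 (Y v w);
  Y_parity : forall p q v w e,
    parity p v -> parity q w -> parity (p (+) q) (Y v w e);
  vac_even : parity false vac;
  Y_truncation : forall u v,
    exists N : rat, forall n, N < n -> Y u v (- n - 1) = 0;
  Y_vac : forall w e, Y vac w e = (e == 0)%:R *: w;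
  Y_creation : forall v e, e < 0 -> Y v vac e = 0;
  Y_creation0 : forall v, Y v vac 0 = v;
  (* k = 1, g = 1 is the untwisted Jacobi identity *)
  Y_jacobi : twisted_jacobi parity Y Y id 1 1 }.

Definition virasoro_mode (V : vertex_superalgebra) (omega : V) (n : int) :
    V -> V := fun v => Y omega v (- n%:~R - 2).

(** [weight_space V m] is the space V_(m/2), so that 2L(0) = m on it. *)
Record vertex_operator_superalgebra := VertexOperatorSuperalgebra {
  vosa_superalgebra :> vertex_superalgebra;
  omega : vosa_superalgebra;
  central_charge : F;
  weight_space : int -> set vosa_superalgebra;
  omega_weight : weight_space 4 omega;
  virasoro : forall (m n : int) v,
    virasoro_mode omega m (virasoro_mode omega n v)
    - virasoro_mode omega n (virasoro_mode omega m v)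
    = (m - n)%:~R *: virasoro_mode omega (m + n) v
      + ((m ^+ 3 - m)%:~R / 12%:R * (m + n == 0)%:R * central_charge) *: v;
  L_minus1_derivative : forall v w,
    Y (virasoro_mode omega (- 1) v) w = deriv_series (Y v w);
  weight_direct_sum : direct_sum weight_space;
  L0_weight : forall (m : int) v, weight_space m v ->
    virasoro_mode omega 0 v = (m%:~R / 2%:R) *: v;
  weight_finite_dim : forall m, finite_dim (weight_space m);
  weight_lower_bound : exists N : int, forall m v,
    m < N -> weight_space m v -> v = 0;
  parity_weight : forall p,
    parity p = partial_sum weight_space [set m : int | odd `|m|%N = p] }.

Definition L (V : vertex_operator_superalgebra) : int -> V -> V :=
  virasoro_mode (omega V).

Record automorphism_of_period (V : vertex_superalgebra) (g : V -> V)
    (k : nat) : Prop := {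
  aut_linear : linear g;
  aut_period : forall v, iter k g v = v;
  aut_parity : forall p v, parity p v -> parity p (g v);
  aut_vac : g (vac V) = vac V;
  aut_Y : forall u v e, g (Y u v e) = Y (g u) (g v) e }.

Record weak_twisted_module (V : vertex_superalgebra) (g : V -> V) (k : nat)
    (eta : F) (M : lmodType F) (parityM : bool -> set M)
    (YM : V -> M -> series M) : Prop := {
  twist_automorphism : automorphism_of_period g k;
  twist_root : k.-primitive_root eta;
  mod_parity_direct_sum : direct_sum parityM;
  mod_Y_linearl : forall w e, linear (fun v => YM v w e);
  mod_Y_linearr : forall v e, linear (fun w => YM v w e);
  mod_Y_support : forall v w, in_root_series k (YM v w);
  mod_Y_parity : forall p q v w e,
    parity p v -> parityM q w -> parityM (p (+) q) (YM v w e);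
  mod_Y_truncation : forall v w,
    exists N : rat, forall n, N < n -> YM v w (- n - 1) = 0;
  mod_Y_vac : forall w e, YM (vac V) w e = (e == 0)%:R *: w;
  mod_Y_jacobi : twisted_jacobi (@parity V) (@Y V) YM g k eta }.

(* sigma(v) = (-1)^|v| v *)
Definition parity_map (V : vertex_superalgebra) (v : V) : V :=
  component (@parity V) v false - component (@parity V) v true.

(* -1 is the only primitive square root of unity *)
Definition weak_parity_twisted_module (V : vertex_superalgebra)
    (M : lmodType F) (parityM : bool -> set M) (YM : V -> M -> series M) :
    Prop :=
  weak_twisted_module (@parity_map V) 2 (-1) parityM YM.

Definition multilinear (k : nat) (V U : lmodType F)
    (f : {ffun 'I_k -> V} -> U) : Prop :=
  forall (i : 'I_k) (v : {ffun 'I_k -> V}),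
    linear (fun x => f [ffun j => if j == i then x else v j]).

Definition is_tensor_power (k : nat) (V W : lmodType F)
    (tens : {ffun 'I_k -> V} -> W) : Prop :=
  multilinear tens /\
  forall (U : lmodType F) (f : {ffun 'I_k -> V} -> U), multilinear f ->
    exists! h : W -> U, linear h /\ forall v, h (tens v) = f v.

(* v^(j+1): indices of tensor factors start at 0 here *)
Definition at_factor (k : nat) (V : vertex_superalgebra) (W : lmodType F)
    (tens : {ffun 'I_k -> V} -> W) (j : nat) (v : V) : W :=
  tens [ffun i : 'I_k => if i == j :> nat then v else vac V].

Definition homogeneous (k : nat) (V : vertex_superalgebra)
    (p : {ffun 'I_k -> bool}) (v : {ffun 'I_k -> V}) : Prop :=
  forall i, parity (p i) (v i).

(** [W], with [tens v] for the pure tensor [v_1 (x) ... (x) v_k], is the vertex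
    operator superalgebra V^{(x)k}.  Iterating the rule for two factors, the
    sign in Y(u_1 (x) ... (x) u_k, x)(v_1 (x) ... (x) v_k) comes from moving
    each [u_j] past the [v_i] with [i < j]. *)
Record is_tensor_power_vosa (k : nat) (V W : vertex_operator_superalgebra)
    (tens : {ffun 'I_k -> V} -> W) : Prop := {
  tensor_universal : is_tensor_power tens;
  tensor_parity : forall p v, homogeneous p v ->
    parity (\big[addb/false]_(i < k) p i) (tens v);
  tensor_vac : vac W = tens [ffun=> vac V];
  tensor_Y : forall p q u v e, homogeneous p u -> homogeneous q v ->
    Y (tens u) (tens v) e =
      (-1) ^+ (\sum_(j < k) \sum_(i < k | (i < j)%N) p j * q i)%N *:
      \sum_(d \in [set d : {ffun 'I_k -> rat} | \sum_(i < k) d i = e])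
        tens [ffun i => Y (u i) (v i) (d i)];
  tensor_omega : omega W = \sum_(j < k) at_factor tens j (omega V) }.

(** The action of (1 2 ... k) on pure tensors:
    v_1 (x) ... (x) v_k |-> +- v_2 (x) ... (x) v_k (x) v_1. *)
Definition is_cyclic_permutation (k : nat) (V : vertex_superalgebra)
    (W : lmodType F) (tens : {ffun 'I_k -> V} -> W) (g : W -> W) : Prop :=
  linear g /\
  forall p v, homogeneous p v ->
    g (tens v) =
      (-1) ^+ (\sum_(i < k | i == 0 :> nat) \sum_(j < k | j != 0 :> nat)
                 p i * p j)%N *:
      tens [ffun i => v (ordS i)].

(* exp(- sum_(j >= 1) a_j x^(j+1) d/dx) x = ((1 + x)^k - 1)/k;
   the value of a at 0 is not used *)
Definition is_change_of_variable (k : nat) (a : nat -> F) : Prop :=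
  let T (f : series F^o) : series F^o := fun e =>
    - \sum_(j \in [set j : nat | (0 < j)%N])
        a j *: deriv_series f (e - j.+1%:R) in
  let p : {poly F} := k%:R^-1 *: (1 + 'X) ^+ k - (k%:R^-1)%:P in
  exp_series T (fun e => (e == 1)%:R)
  = fun e => \sum_(m \in [set: nat]) (e == m%:R)%:R * p`_m.

Section Delta.
Variable V : vertex_operator_superalgebra.

(* s^(2L(0)), for s a nonzero scalar *)
Definition scalar_2L0 (s : F) (v : V) : V :=
  \sum_(m \in [set: int]) s ^ m *: component (@weight_space V) v m.

(* (x^r)^(2L(0)) f(x) *)
Definition power_2L0 (r : rat) (f : series V) : series V := fun e =>
  \sum_(m \in [set: int]) component (@weight_space V) (f (e - r * m%:~R)) m.

(* exp(- sum_(j >= 1) a_j x^(-j/k) L(j)) f(x) *)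
Definition exp_L (k : nat) (a : nat -> F) : series V -> series V :=
  exp_series (fun (f : series V) e =>
    - \sum_(j \in [set j : nat | (0 < j)%N])
        a j *: L j%:Z (f (e + j%:R / k%:R))).

(* Delta_k(x)^-1 u
   = (x^(1/2k))^((k-1)2L(0)) (k^(1/2))^(2L(0)) exp(- sum a_j x^(-j/k) L(j)) u *)
Definition Delta_inv (k : nat) (a : nat -> F) (u : V) : series V :=
  power_2L0 ((k%:R - 1) / (2 * k%:R))
    (fun e => scalar_2L0 (sqrtC k%:R)
       (exp_L k a (fun d => (d == 0)%:R *: u) e)).

(* Y_sigma(u,x) w = Y_g((Delta_k(x^k)^-1 u)^1, x^k) w *)
Definition Y_sigma (k : nat) (a : nat -> F) (W M : lmodType F)
    (tens : {ffun 'I_k -> V} -> W) (Yg : W -> M -> series M)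
    (u : V) (w : M) : series M :=
  subst_pow k (fun e =>
    \sum_(d \in [set: rat]) Yg (at_factor tens 0 (Delta_inv k a u d)) w (e - d)).

End Delta.
End Fields.

(* Main.v *)
Require Import Defs.
From mathcomp Require Import all_boot all_order all_algebra ring zify.
From mathcomp Require Import boolp classical_sets functions cardinality fsbigop.

(** The proof follows the classical idea: [u^1] and [v^1] interact in [M_g]
    through a single branch of [x^(1/k)], and [Delta_k] is the operator by which
    a vertex algebra responds to the change of variable [x -> x^k].

    All identities are reduced to one variable.  Fix the total degree and put
    [rho = x_1/x_2].  The two products and the iterate then become sequences
    [P], [R], [I] indexed by the integers, and the Jacobi identity becomes a
    family of relations [jacobi1].  When [P] and [R] agree after multiplication
    by [(rho - 1)^N], these relations say exactly that the common product [G],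
    a Laurent polynomial times [rho^alpha], has at [rho = 1 + t] the expansion
    [t^N I(t)].  This is [jacobi1P]; it is used in both directions.

    On the side of [M_g], the field [g^j u^1] occupies another tensor factor than
    [v^1] unless [j = 0 mod k], so that [Y(g^j u^1, x_0) v^1] is regular.  Hence
    [Y_g(u^1, x_1)] and [Y_g(v^1, x_2)] are local in [x_1^(1/k) - x_2^(1/k)]
    alone ([prod_local]); and, the average over the branches being undone by
    summing over the residues of the exponents modulo [k], the product expanded
    at [x_1^(1/k) = x_2^(1/k) (1 + t)] is the iterate of [u^1] and [v^1] taken at
    [x_0 = x_2 ((1 + t)^k - 1)] ([expand1_twisted]).

    On the side of [V], the iterate [Y(u, z) v] has to be conjugated by
    [exp(- sum a_j y^-j L(j))].  As [f = ((1 + x)^k - 1)/k] solves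
    [(1 + x) f' = 1 + k f], this exponential intertwines [L(-1) + L(0)] with
    [L(-1) + k L(0)] ([opE_intertwine]).  That determines the conjugate of a
    field on the vacuum ([E_translation]), and so everywhere, because a field is
    determined by what it creates from the vacuum ([is_field_eq]).  The outcome,
    [E_Y_cov], is that the operator turns [Y(u, z) v] into the product of the
    transformed vectors at [f(z)], up to the factors [(1 + z)^d] that the powers
    of [x] in [Delta_k] produce.

    Both computations involve the same change of variable [f], and their
    comparison ([expand1_sigma], [pmul_covW_iterate]) gives the Jacobi identity
    for weight vectors ([sigma_jacobi1]).

    The evenness of [k] enters only through the exponents.  For [u] of weight
    [h], those of [Y_sigma(u, x)] lie in [(k - 1) h + Z], which is [h + Z] as
    [k h] and [2 h] are integers: integral exponents for even [u] and half-integral ones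
    for odd [u], as a parity-twisted module requires. *)

Set Implicit Arguments.
Unset Strict Implicit.
Unset Printing Implicit Defensive.

Import Order.TTheory GRing.Theory Num.Theory.
Local Open Scope ring_scope.

(** * Finitely supported sums *)

Lemma fsum_seq (T : choiceType) (M : nmodType) (s : seq T) (f : T -> M) :
  uniq s -> (forall x, x \notin s -> f x = 0) ->
  \sum_(x \in [set: T]) f x = \sum_(x <- s) f x.
Proof.
move=> us f0; rewrite (fsbigE s) //; last by move=> x _; exact: f0.
by apply: eq_bigl => x; rewrite in_setT.
Qed.

Lemma fsum_one (T : choiceType) (M : nmodType) (x : T) (f : T -> M) :
  (forall y, y != x -> f y = 0) -> \sum_(y \in [set: T]) f y = f x.
Proof.
move=> f0; rewrite (@fsum_seq _ _ [:: x]) ?big_seq1 // => y.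
by rewrite inE; exact: f0.
Qed.

Lemma fsum_nat (M : nmodType) (B : nat) (f : nat -> M) :
  (forall i, (B <= i)%N -> f i = 0) ->
  \sum_(i \in [set: nat]) f i = \sum_(i < B) f i.
Proof.
move=> f0; rewrite (@fsum_seq _ _ (iota 0 B)) ?iota_uniq //; last first.
  by move=> x; rewrite mem_iota /= add0n -leqNgt; exact: f0.
by rewrite -{1}[B]subn0 big_mkord.
Qed.

Lemma fsum_nat_pos (M : nmodType) (B : nat) (f : nat -> M) :
  (forall i, (B <= i)%N -> f i = 0) ->
  \sum_(i \in [set j : nat | (0 < j)%N]) f i = \sum_(i < B | (0 < i)%N) f i.
Proof.
move=> f0; rewrite fsbig_mkcond (@fsum_nat _ B); last first.
  by move=> i /f0 fi; rewrite /patch fi if_same.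
rewrite [RHS]big_mkcond /=; apply: eq_bigr => i _; rewrite /patch.
by congr (if _ then _ else _); apply/idP/idP; rewrite inE.
Qed.

Lemma sum_widen (M : nmodType) (A B : nat) (f : nat -> M) : (A <= B)%N ->
  (forall i, (A <= i)%N -> f i = 0) -> \sum_(i < B) f i = \sum_(i < A) f i.
Proof. by move=> AB f0; rewrite -!(fsum_nat) // => i Bi; apply/f0/(leq_trans AB). Qed.

(** Both sides sum [G] over the triples of total [s]. *)
Lemma exchange_antidiag (M : nmodType) (G : nat -> nat -> nat -> M) (s : nat) :
  \sum_(i < s.+1) \sum_(j < i.+1) G j (i - j)%N (s - i)%N =
  \sum_(j < s.+1) \sum_(i < (s - j).+1) G j i (s - j - i)%N.
Proof.
transitivity (\sum_(i < s.+1) \sum_(j < s.+1 | (j <= i)%N) G j (i - j)%N (s - i)%N).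
  apply: eq_bigr => i _.
  by rewrite (big_ord_widen s.+1 (fun j => G j (i - j)%N (s - i)%N)).
rewrite (exchange_big_dep xpredT) //=; apply: eq_bigr => j _.
rewrite -(big_mkord (fun i => (j <= i)%N) (fun i => G j (i - j)%N (s - i)%N)).
have js : (j <= s)%N by rewrite -ltnS.
rewrite (big_cat_nat (n := j)) //=; last exact: leqW.
rewrite big_nat_cond big_pred0 ?add0r; last first.
  by move=> i; apply/negbTE/negP => /andP[] /andP[_]; rewrite ltnNge => /negbTE ->.
have -> : index_iota j s.+1 = index_iota (0 + j) ((s - j).+1 + j).
  by rewrite addSn subnK.
rewrite big_addn addnK big_mkord big_mkcond /=; apply: eq_bigr => i _.
by rewrite leq_addl addnK addnC subnDA.
Qed.

(** * Generalized binomial coefficients *)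

Section Binomial.
Variable F : numClosedFieldType.
Implicit Types (x y : F) (i n : nat).

Lemma natS_neq0 i : (i.+1%:R : F) != 0.
Proof. by rewrite pnatr_eq0. Qed.

Lemma gbinom0 x : gbinom x 0 = 1.
Proof. by rewrite /gbinom big_ord0 fact0 divr1. Qed.

Lemma gbinomS x i : i.+1%:R * gbinom x i.+1 = (x - i%:R) * gbinom x i.
Proof.
rewrite /gbinom big_ord_recr /= factS natrM.
have f0 : (i`!%:R : F) != 0 by rewrite pnatr_eq0 -lt0n fact_gt0.
move: (natS_neq0 i) f0 (\prod_(j < i) _).
by move: (i.+1%:R) (i`!%:R) => c d c0 d0 P; field; rewrite c0 d0.
Qed.

(** The recursion [gbinomS] and the initial value characterize the sequence. *)
Lemma gbinom_rec (f : nat -> F) x : f 0%N = 1 ->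
  (forall i, i.+1%:R * f i.+1 = (x - i%:R) * f i) -> f =1 gbinom x.
Proof.
move=> f0 fS; elim=> [|i IH]; first by rewrite gbinom0.
by apply: (mulfI (natS_neq0 i)); rewrite fS gbinomS IH.
Qed.

Lemma gbinom_nat n i : gbinom (n%:R : F) i = 'C(n, i)%:R.
Proof.
apply/esym; move: i; apply: gbinom_rec => [|i]; first by rewrite bin0.
rewrite -natrM mul_bin_left natrM; have [ni|ni] := leqP i n.
  by rewrite natrB.
by rewrite bin_small // !mulr0.
Qed.

Lemma gbinom_small n i : (n < i)%N -> gbinom (n%:R : F) i = 0.
Proof. by move=> ni; rewrite gbinom_nat bin_small. Qed.

Lemma gbinom_pascal x i : gbinom (x + 1) i.+1 = gbinom x i.+1 + gbinom x i.
Proof.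
elim: i => [|i IH].
  rewrite gbinom0; apply: (mulfI (natS_neq0 0)); rewrite gbinomS mulrDr gbinomS.
  by rewrite !gbinom0 !subr0 !mulr1.
apply: (mulfI (natS_neq0 i.+1)); rewrite gbinomS IH [RHS]mulrDr gbinomS.
have -> : x + 1 - i.+1%:R = x - i%:R by rewrite -addn1 natrD; ring.
rewrite mulrDr -gbinomS -[i.+2]addn1 -[i.+1 in LHS]addn1 -[i.+1 in RHS]addn1 !natrD.
ring.
Qed.

Lemma gbinom_deriv x i : i.+1%:R * gbinom x i.+1 = x * gbinom (x - 1) i.
Proof.
elim: i => [|i IH]; first by rewrite gbinomS !gbinom0 subr0.
apply: (mulfI (natS_neq0 i)); rewrite gbinomS [LHS]mulrCA IH.
rewrite [RHS]mulrCA gbinomS -[in LHS]addn1 natrD; ring.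
Qed.

Lemma gbinom_opp x i : (-1) ^+ i * gbinom x i = gbinom (i%:R - x - 1) i.
Proof.
rewrite /gbinom mulrA; congr (_ / _).
rewrite -[X in (-1) ^+ X](card_ord i) -prodr_const -big_split /=.
rewrite (reindex_inj rev_ord_inj) /=; apply: eq_bigr => j _.
by rewrite natrB // -addn1 natrD; ring.
Qed.

Lemma Vandermonde_gbinom x y n :
  \sum_(i < n.+1) gbinom x i * gbinom y (n - i)%N = gbinom (x + y) n.
Proof.
move: n; apply: gbinom_rec => [|n]; first by rewrite big_ord1 !gbinom0 mulr1.
transitivity (\sum_(i < n.+2) ((i%:R * gbinom x i) * gbinom y (n.+1 - i)%N
     + gbinom x i * ((n.+1 - i)%:R * gbinom y (n.+1 - i)%N))).
  rewrite mulr_sumr; apply: eq_bigr => i _.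
  have /subnK e : (i <= n.+1)%N by rewrite -ltnS.
  rewrite -{1}e natrD; ring.
rewrite big_split /= big_ord_recl /= !mul0r add0r.
rewrite [X in _ + X]big_ord_recr /= subnn mul0r mulr0 addr0 -big_split /= mulr_sumr.
apply: eq_bigr => i _; have ni : (i <= n)%N by rewrite -ltnS.
rewrite /bump /= add1n subSS gbinomS subSn // gbinomS natrB //; ring.
Qed.

(** Identities between generalized binomial coefficients are polynomial in the
    upper index, so that they follow from their instances at the natural
    numbers. *)
Definition binomp i : {poly F} := i`!%:R^-1 *: \prod_(j < i) ('X - j%:R%:P).

Lemma binompE i x : (binomp i).[x] = gbinom x i.
Proof.
rewrite /binomp hornerZ horner_prod mulrC; congr (_ / _).
by apply: eq_bigr => j _; rewrite hornerXsubC.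
Qed.

Lemma poly_eq_on_nat (p q : {poly F}) :
  (forall n : nat, p.[n%:R] = q.[n%:R]) -> p = q.
Proof.
move=> pq; apply/eqP; rewrite -subr_eq0; apply/eqP.
set r := p - q; apply: (@roots_geq_poly_eq0 _ _ [seq (i%:R : F) | i <- iota 0 (size r)]).
- by apply/allP => x /mapP[i _ ->]; rewrite rootE hornerD hornerN pq subrr.
- by rewrite map_inj_uniq ?iota_uniq // => i j /eqP; rewrite eqr_nat => /eqP.
- by rewrite size_map size_iota.
Qed.

End Binomial.

(** * Laurent series in one variable with coefficients in a module *)

Section Laurent.
Variables (F : numClosedFieldType) (M : lmodType F).
Implicit Types (f g P R I G : int -> M) (p q : {poly F}).

(** The product of a polynomial and a series unbounded in both directions. *)
Definition pmul p f (b : int) : M := \sum_(j < size p) p`_j *: f (b - j%:Z).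

Lemma pmulE n p f b : (size p <= n)%N ->
  pmul p f b = \sum_(j < n) p`_j *: f (b - j%:Z).
Proof.
move=> pn; apply/esym; apply: (sum_widen (f := fun j => p`_j *: f (b - j%:Z))) => // i pi.
by rewrite nth_default // scale0r.
Qed.

Lemma eq_pmul p f g : f =1 g -> pmul p f =1 pmul p g.
Proof. by move=> fg b; apply: eq_bigr => j _; rewrite fg. Qed.

Lemma pmulD p q f b : pmul (p + q) f b = pmul p f b + pmul q f b.
Proof.
have [pn qn] := (leq_maxl (size p) (size q), leq_maxr (size p) (size q)).
rewrite (pmulE _ _ (leq_trans (size_polyD _ _) (leqnn _))) (pmulE _ _ pn) (pmulE _ _ qn).
by rewrite -big_split; apply: eq_bigr => j _; rewrite coefD scalerDl.
Qed.

Lemma pmulC c f b : pmul c%:P f b = c *: f b.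
Proof. by rewrite (@pmulE 1) ?size_polyC_leq1 // big_ord1 coefC subr0. Qed.

Lemma pmul0 f b : pmul 0 f b = 0.
Proof. by rewrite /pmul size_poly0 big_ord0. Qed.

Lemma pmul1 f b : pmul 1 f b = f b.
Proof. by rewrite -polyC1 pmulC scale1r. Qed.

Lemma pmulMX p f b : pmul (p * 'X) f b = pmul p f (b - 1).
Proof.
have sp : (size (p * 'X)%R <= (size p).+1)%N.
  by apply: leq_trans (size_polyMleq _ _) _; rewrite size_polyX addn2.
rewrite (pmulE _ _ sp) big_ord_recl coefMX eqxx scale0r add0r.
by apply: eq_bigr => j _; rewrite coefMX lift0 /= -addn1 PoszD opprD addrA addrAC.
Qed.

Lemma pmulM p q f b : pmul (p * q) f b = pmul p (pmul q f) b.
Proof.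
elim/poly_ind: p b => [|p c IH] b; first by rewrite mul0r !pmul0.
rewrite mulrDl !pmulD pmulC pmulMX -IH mulrAC pmulMX; congr (_ + _).
rewrite mul_polyC /pmul scaler_sumr.
have sq : (size (c *: q)%R <= size q)%N by apply: size_scale_leq.
by rewrite -/(pmul _ _ _) (pmulE _ _ sq); apply: eq_bigr => j _; rewrite coefZ scalerA.
Qed.

Lemma pmulfD p f g b : pmul p (fun x => f x + g x) b = pmul p f b + pmul p g b.
Proof. by rewrite -big_split; apply: eq_bigr => j _; rewrite scalerDr. Qed.

Lemma pmulfZ p c f b : pmul p (fun x => c *: f x) b = c *: pmul p f b.
Proof. by rewrite scaler_sumr; apply: eq_bigr => j _; rewrite !scalerA mulrC. Qed.

Lemma pmulf_sum p T (r : seq T) (f : T -> int -> M) b :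
  pmul p (fun x => \sum_(i <- r) f i x) b = \sum_(i <- r) pmul p (f i) b.
Proof. by rewrite exchange_big /=; apply: eq_bigr => j _; rewrite scaler_sumr. Qed.

Lemma pmul_shift p f c b : pmul p (fun x => f (x + c)) b = pmul p f (b + c).
Proof. by apply: eq_bigr => j _; rewrite addrAC. Qed.

Lemma pmulX1 f b : pmul ('X - 1) f b = f (b - 1) - f b.
Proof. by rewrite pmulD -[X in pmul X]mul1r pmulMX pmul1 -polyC1 -polyCN pmulC scaleN1r. Qed.

Definition zbelow N f := forall b : int, b < - N%:Z -> f b = 0.
Definition zabove N f := forall b : int, N%:Z <= b -> f b = 0.
Definition zsupp B f := forall b : int, (B <= `|b|)%N -> f b = 0.

Lemma zsupp_widen N N' f : (N <= N')%N -> zsupp N f -> zsupp N' f.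
Proof. by move=> NN' fN b bN; apply/fN/(leq_trans NN'). Qed.

Lemma zbelow_pmul N p f : zbelow N f -> zbelow N (pmul p f).
Proof.
move=> fN b bN; rewrite /pmul big1 // => j _; rewrite fN ?scaler0 //.
by apply: le_lt_trans bN; rewrite lerBlDr lerDl.
Qed.

Lemma zabove_pmul N p f : zabove N f -> zabove (N + size p) (pmul p f).
Proof.
move=> fN b bN; rewrite /pmul big1 // => j _; rewrite fN ?scaler0 //.
rewrite lerBrDr; apply: le_trans bN; rewrite PoszD lerD2l lez_nat.
exact: ltnW.
Qed.

Lemma zsuppP N N' f : zbelow N f -> zabove N' f -> zsupp (maxn N.+1 N') f.
Proof.
move=> fN fN' b; rewrite geq_max; case: b => b /andP[b1 b2]; first exact: fN'.
by apply: fN; rewrite NegzE ltrN2 ltz_nat.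
Qed.

Lemma zsupp_below N f : zsupp N f -> zbelow N f.
Proof.
move=> fN b bN; apply: fN.
case: b bN => b; first by rewrite ltNge (le_trans (_ : _ <= 0)) ?oppr_le0.
by rewrite NegzE ltrN2 ltz_nat => /ltnW.
Qed.

Lemma zsupp_above N f : zsupp N f -> zabove N f.
Proof. by move=> fN [b|b] // bN; apply: fN. Qed.

Lemma zsupp_pmul N p f : zsupp N f -> exists N', zsupp N' (pmul p f).
Proof.
move=> fN; exists (maxn N.+1 (N + size p)).
by apply: zsuppP; [exact/zbelow_pmul/zsupp_below|exact/zabove_pmul/zsupp_above].
Qed.

(** A polynomial with a nonzero constant term is a unit among power series. *)
Lemma pmul_inj p N f g : p`_0 != 0 -> zbelow N f -> zbelow N g ->
  pmul p f =1 pmul p g -> f =1 g.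
Proof.
move=> p0 fN gN pfg.
suff fg n : f (n%:Z - N%:Z) = g (n%:Z - N%:Z).
  move=> b; have [bN|] := ltP b (- N%:Z); first by rewrite fN ?gN.
  rewrite -subr_ge0 opprK => bN.
  by have := fg (absz (b + N%:Z)); rewrite gez0_abs // addrK.
elim/ltn_ind: n => n IH.
have [s sp] : exists s, size p = s.+1.
  by case: (size p) (size_poly_leq0 p) p0 => [/esym/eqP ->|s _ _]; [rewrite coef0 eqxx|exists s].
have := pfg (n%:Z - N%:Z); rewrite /pmul sp !big_ord_recl !subr0.
rewrite [in X in _ = _ + X -> _](eq_bigr (fun j : 'I_s => p`_(lift ord0 j) *: f (n%:Z - N%:Z - (lift ord0 j)%:Z))).
  by move/addIr/(congr1 (fun x : M => (p`_0)^-1 *: x)); rewrite /= !scalerA mulVf // !scale1r.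
move=> j _; congr (_ *: _); have [jn|nj] := leqP (lift ord0 j) n.
  have -> : n%:Z - N%:Z - (lift ord0 j)%:Z = (n - lift ord0 j)%N%:Z - N%:Z.
    by rewrite -subzn //; ring.
  by rewrite IH // ltn_subrL (leq_trans _ jn).
by rewrite fN ?gN // addrAC -[X in _ < X]add0r ltrD2r subr_lt0 ltz_nat.
Qed.

Definition zsum f : M := \sum_(b \in [set: int]) f b.

Lemma eq_zsum f g : f =1 g -> zsum f = zsum g.
Proof. by move=> /funext ->. Qed.

Lemma zsumE B f : zsupp B f -> zsum f = \sum_(j < B.*2) f (j%:Z - B%:Z).
Proof.
move=> fB; rewrite /zsum (@fsum_seq _ _ [seq (j%:Z - B%:Z) | j <- iota 0 B.*2]).
- by rewrite big_map -{1}[B.*2]subn0 big_mkord.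
- by rewrite map_inj_uniq ?iota_uniq // => i j /addIr[].
move=> b bB; apply: fB; rewrite leqNgt; apply: contra bB => bB.
by apply/mapP; exists (absz (b + B%:Z)); rewrite ?mem_iota; lia.
Qed.

Lemma zsum0 f : (forall b, f b = 0) -> zsum f = 0.
Proof. by move=> f0; apply: fsbig1 => b _; rewrite f0. Qed.

Lemma zsumD N f g : zsupp N f -> zsupp N g ->
  zsum (fun b => f b + g b) = zsum f + zsum g.
Proof.
move=> fN gN; rewrite !(@zsumE N) -?big_split //.
by move=> b bN; rewrite fN ?gN ?addr0.
Qed.

Lemma zsumZ N c f : zsupp N f -> zsum (fun b => c *: f b) = c *: zsum f.
Proof.
move=> fN; rewrite !(@zsumE N) ?scaler_sumr //.
by move=> b bN; rewrite fN ?scaler0.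
Qed.

Lemma zsum_sum T N (r : seq T) (f : T -> int -> M) : (forall i, zsupp N (f i)) ->
  zsum (fun b => \sum_(i <- r) f i b) = \sum_(i <- r) zsum (f i).
Proof.
move=> fN; rewrite (@zsumE N); last by move=> b bN; rewrite big1 // => i _; rewrite fN.
by rewrite exchange_big; apply: eq_bigr => i _; rewrite -zsumE.
Qed.

Lemma zsum_shift c f : zsum (fun b => f (b + c)) = zsum f.
Proof.
apply/esym/(@reindex_fsbigT _ _ _ int int (fun b => b + c) f).
by exists (fun b => b - c) => b; rewrite ?addrK ?subrK.
Qed.

Lemma zsum_inj (h : nat -> int) f : injective h ->
  (forall b, f b != 0 -> exists i, b = h i) ->
  \sum_(i \in [set: nat]) f (h i) = zsum f.
Proof.
move=> hi fh; rewrite /zsum.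
rewrite -(@fsbig_image _ _ _ nat int [set: nat] h f); last by move=> x y _ _ /hi.
apply: fsbig_widen => // b [_ nb] /=; apply/eqP/negPn/negP => /fh[i bi].
by apply: nb; exists i.
Qed.

(** Substituting [1 + t] for [rho] in the sum of the [f b * rho^(alpha + b)]:
    the coefficient of [t^i]. *)
Definition expand1 (alpha : F) f (i : int) : M :=
  if i is Posz n then zsum (fun b => gbinom (alpha + b%:~R) n *: f b) else 0.

Lemma zsuppZ N (c : int -> F) f : zsupp N f -> zsupp N (fun b => c b *: f b).
Proof. by move=> fN b bN; rewrite fN ?scaler0. Qed.

Lemma expand1D alpha N f g i : zsupp N f -> zsupp N g ->
  expand1 alpha (fun b => f b + g b) i = expand1 alpha f i + expand1 alpha g i.
Proof.
case: i => i fN gN /=; last by rewrite addr0.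
rewrite -(zsumD (zsuppZ _ fN) (zsuppZ _ gN)).
by apply: eq_zsum => b; rewrite scalerDr.
Qed.

Lemma expand1Z alpha N c f i : zsupp N f ->
  expand1 alpha (fun b => c *: f b) i = c *: expand1 alpha f i.
Proof.
case: i => i fN /=; last by rewrite scaler0.
rewrite -(zsumZ _ (zsuppZ _ fN)).
by apply: eq_zsum => b; rewrite !scalerA mulrC.
Qed.

Lemma eq_expand1 alpha f g i : f =1 g -> expand1 alpha f i = expand1 alpha g i.
Proof. by move=> /funext ->. Qed.

Lemma expand1_sum alpha T N (r : seq T) (f : T -> int -> M) i :
  (forall j, zsupp N (f j)) ->
  expand1 alpha (fun b => \sum_(j <- r) f j b) i = \sum_(j <- r) expand1 alpha (f j) i.
Proof.
case: i => i fN /=; last by rewrite big1.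
rewrite -(@zsum_sum _ N); last by move=> j; apply: zsuppZ.
by apply: eq_zsum => b; rewrite scaler_sumr.
Qed.

Lemma expand1_mulX alpha N f i : zsupp N f ->
  expand1 alpha (fun b => f (b - 1)) i = expand1 alpha f i + expand1 alpha f (i - 1).
Proof.
move=> fN; case: i => i /=; last by case: i => [|i]; rewrite addr0.
rewrite -(zsum_shift 1) (eq_zsum (g := fun b => gbinom (alpha + b%:~R + 1) i *: f b)); last first.
  by move=> b; rewrite addrK rmorphD /= addrA.
case: i => [|i].
  rewrite sub0r /= addr0; apply: eq_zsum => b; by rewrite !gbinom0.
have -> : Posz i.+1 - 1 = Posz i by rewrite -addn1 PoszD addrK.
rewrite /= -(zsumD (zsuppZ _ fN) (zsuppZ _ fN)); apply: eq_zsum => b.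
by rewrite gbinom_pascal scalerDl.
Qed.

(** Substitution of [1 + t] for [rho] is multiplicative. *)
Lemma expand1_pmul alpha N p f i : zsupp N f ->
  expand1 alpha (pmul p f) i = pmul (p \Po (1 + 'X)) (expand1 alpha f) i.
Proof.
move=> fN; elim/poly_ind: p i => [|p c IH] i.
  rewrite comp_poly0 pmul0 -(scale0r (expand1 alpha f i)) -(expand1Z _ _ _ fN).
  by apply: eq_expand1 => b; rewrite pmul0 scale0r.
have [N' fN'] := zsupp_pmul p fN.
have pX : zsupp (maxn N N'.+1) (fun b => pmul p f (b - 1)).
  by move=> b; rewrite geq_max => /andP[_ bN]; apply: fN'; lia.
have fX : zsupp (maxn N N'.+1) (fun b => c *: f b).
  by apply: zsuppZ; apply: zsupp_widen fN; apply: leq_maxl.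
have -> : expand1 alpha (pmul (p * 'X + c%:P) f) i =
    expand1 alpha (fun b => pmul p f (b - 1) + c *: f b) i.
  by apply: eq_expand1 => b; rewrite pmulD pmulMX pmulC.
rewrite (expand1D _ _ pX fX) (expand1Z _ _ _ fN) (expand1_mulX _ _ fN').
rewrite comp_polyD comp_polyM comp_polyX comp_polyC pmulD pmulC; congr (_ + _).
rewrite mulrDr mulr1 pmulD pmulMX -!IH //.
Qed.

Lemma size_poly_diff p : (size (p \Po ('X - 1) - p)%R <= (size p).-1)%N.
Proof.
have sX : size ('X - 1 : {poly F}) = 2 by rewrite -polyC1 size_XsubC.
have lX : lead_coef ('X - 1 : {poly F}) = 1 by rewrite -polyC1 lead_coefXsubC.
have s1 : size (p \Po ('X - 1)) = size p by rewrite size_comp_poly2.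
apply/leq_sizeP => j; rewrite coefB leq_eqVlt => /orP[/eqP <-|jp]; last first.
  have pj : (size p <= j)%N by move: jp; case: (size p) => [|n].
  by rewrite [p`_j]nth_default // nth_default ?subrr ?s1.
have := @lead_coef_comp _ p ('X - 1); rewrite sX lX => /(_ isT).
by rewrite expr1n mulr1 !lead_coefE s1 => ->; rewrite subrr.
Qed.

(** Each of the [N] differences lowers the degree of [p]. *)
Lemma pmul_diff_poly N p (x : M) b : (size p <= N)%N ->
  pmul (('X - 1) ^+ N) (fun b => p.[b%:~R] *: x) b = 0.
Proof.
elim: N p b => [|N IH] p b pN.
  by move: pN; rewrite size_poly_leq0 => /eqP ->; rewrite pmul1 horner0 scale0r.
rewrite exprSr pmulM -[RHS](IH (p \Po ('X - 1) - p) b); last first.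
  by apply: leq_trans (size_poly_diff p) _; case: (size p) pN.
apply: eq_pmul => c; rewrite pmulX1 -scalerBl; congr (_ *: _).
by rewrite hornerD hornerN horner_comp hornerD hornerX hornerN hornerC rmorphB.
Qed.

End Laurent.

(** * The one-variable Jacobi identity *)

Section OneVariableJacobi.
Variables (F : numClosedFieldType) (M : lmodType F).
Implicit Types (f g P R I G : int -> M) (p q : {poly F}) (n m e d : int).

(** The coefficients of [rho^e] in [(rho - 1)^n P] and [(- 1 + rho)^n R], and
    that of [t^m] in [(1 + t)^x I]. *)
Definition mul_hi n P e : M :=
  \sum_(i \in [set: nat]) ((-1) ^+ i * gbinom n%:~R i) *: P (e - n + i%:Z).
Definition mul_lo n R e : M :=
  (-1) ^ n *: \sum_(i \in [set: nat]) ((-1) ^+ i * gbinom n%:~R i) *: R (e - i%:Z).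
Definition mul_bin (x : F) I m : M :=
  \sum_(i \in [set: nat]) gbinom x i *: I (m - i%:Z).

(** The coefficients of the Jacobi identity at a fixed total degree, for the
    exponents [- n - 1] of [x_0] and [alpha + e] of [x_1]. *)
Definition jacobi1 (alpha : F) P R I n e : Prop :=
  mul_hi n P e - mul_lo n R e = mul_bin (- (alpha + e%:~R) - 1) I (- n - 1).

Lemma mul_hiE B n P e : (forall i, (B <= i)%N -> P (e - n + i%:Z) = 0) ->
  mul_hi n P e = \sum_(i < B) ((-1) ^+ i * gbinom n%:~R i) *: P (e - n + i%:Z).
Proof. by move=> P0; rewrite /mul_hi (@fsum_nat _ B) // => i /P0 ->; rewrite scaler0. Qed.

Lemma mul_loE B n R e : (forall i, (B <= i)%N -> R (e - i%:Z) = 0) ->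
  mul_lo n R e = (-1) ^ n *: \sum_(i < B) ((-1) ^+ i * gbinom n%:~R i) *: R (e - i%:Z).
Proof. by move=> R0; rewrite /mul_lo (@fsum_nat _ B) // => i /R0 ->; rewrite scaler0. Qed.

Lemma mul_binE B x I m : (forall i, (B <= i)%N -> I (m - i%:Z) = 0) ->
  mul_bin x I m = \sum_(i < B) gbinom x i *: I (m - i%:Z).
Proof. by move=> I0; rewrite /mul_bin (@fsum_nat _ B) // => i /I0 ->; rewrite scaler0. Qed.

Lemma gbinom_sign_pascal n i : ((-1) ^+ i.+1 * gbinom (n + 1)%:~R i.+1 : F) =
  (-1) ^+ i.+1 * gbinom n%:~R i.+1 - (-1) ^+ i * gbinom n%:~R i.
Proof. by rewrite rmorphD /= gbinom_pascal exprS; ring. Qed.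

Lemma mul_hi_X1 N n P e : zabove N P -> mul_hi n (pmul ('X - 1) P) e = mul_hi (n + 1) P e.
Proof.
move=> PN; set B := (N + absz (e - n) + 1)%N.
have PB x i : (B <= i)%N -> x = e - n + i%:Z \/ x = e - n + i%:Z - 1 -> P x = 0.
  by rewrite /B => Bi [] ->; apply: PN; lia.
rewrite (@mul_hiE B); last first.
  move=> i Bi; rewrite pmulX1 !(PB _ i Bi) ?subrr //; [by left | by right].
rewrite (@mul_hiE B.+1); last by move=> i Bi; apply: (PB _ i (ltnW Bi)); right; ring.
set c := fun i => (-1) ^+ i * gbinom n%:~R i : F.
rewrite (eq_bigr (fun i : 'I_B => c i *: P (e - n + i%:Z - 1) - c i *: P (e - n + i%:Z)));
  last by move=> i _; rewrite pmulX1 scalerBr.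
rewrite big_split /= sumrN.
have E : \sum_(i < B) c i *: P (e - n + i%:Z - 1) = \sum_(i < B.+1) c i *: P (e - n + i%:Z - 1).
  by rewrite big_ord_recr /= [P _](PB _ B) ?scaler0 ?addr0 //; right.
rewrite E !big_ord_recl /= -addrA; congr (_ + _).
  by rewrite /c !gbinom0; congr (_ *: P _); lia.
rewrite -sumrB; apply: eq_bigr => i _.
rewrite gbinom_sign_pascal scalerBl /bump /= add1n; congr (_ *: P _ - _ *: P _); lia.
Qed.

Lemma mul_lo_X1 N n R e : zbelow N R -> mul_lo n (pmul ('X - 1) R) e = mul_lo (n + 1) R e.
Proof.
move=> RN; set B := (N + absz e + 1)%N.
have RB x i : (B <= i)%N -> x = e - i%:Z \/ x = e - i%:Z - 1 -> R x = 0.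
  by rewrite /B => Bi [] ->; apply: RN; lia.
rewrite (@mul_loE B); last first.
  by move=> i Bi; rewrite pmulX1 (RB _ _ Bi (or_introl erefl)) (RB _ _ Bi (or_intror erefl)) subrr.
rewrite (@mul_loE B.+1); last by move=> i Bi; apply: (RB _ i (ltnW Bi)); left.
have -> : (-1) ^ (n + 1) = - (-1) ^ n :> F by rewrite expfzDr ?oppr_eq0 ?oner_eq0 // mulrN1.
rewrite scaleNr -scalerN; congr (_ *: _).
set c := fun i => (-1) ^+ i * gbinom n%:~R i : F.
rewrite (eq_bigr (fun i : 'I_B => c i *: R (e - i%:Z - 1) - c i *: R (e - i%:Z)));
  last by move=> i _; rewrite pmulX1 scalerBr.
rewrite big_split /= sumrN.
have -> : \sum_(i < B) c i *: R (e - i%:Z) = \sum_(i < B.+1) c i *: R (e - i%:Z).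
  by rewrite big_ord_recr /= [R _](RB _ B) ?scaler0 ?addr0 //; left.
rewrite !big_ord_recl /= !opprD addrCA; congr (_ + _); first by rewrite /c !gbinom0.
rewrite -!sumrN -big_split /=; apply: eq_bigr => i _.
rewrite gbinom_sign_pascal scalerBl /bump /= add1n opprB; congr (_ *: R _ - _ *: R _); lia.
Qed.

Lemma mul_hi_Xn N K n P e : zabove N P ->
  mul_hi n (pmul (('X - 1) ^+ K) P) e = mul_hi (n + K%:Z) P e.
Proof.
elim: K N P n => [|K IH] N P n PN.
  by rewrite addr0; congr mul_hi; apply/funext => b; rewrite pmul1.
rewrite exprSr; have -> : pmul (('X - 1) ^+ K * ('X - 1) ) P =
    pmul (('X - 1) ^+ K) (pmul ('X - 1) P) by apply/funext => b; rewrite pmulM.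
rewrite (IH _ _ _ (@zabove_pmul _ _ _ ('X - 1) _ PN)).
by rewrite (mul_hi_X1 _ _ PN); congr mul_hi; lia.
Qed.

Lemma mul_lo_Xn N K n R e : zbelow N R ->
  mul_lo n (pmul (('X - 1) ^+ K) R) e = mul_lo (n + K%:Z) R e.
Proof.
elim: K R n => [|K IH] R n RN.
  by rewrite addr0; congr mul_lo; apply/funext => b; rewrite pmul1.
rewrite exprSr; have -> : pmul (('X - 1) ^+ K * ('X - 1) : {poly F}) R =
    pmul (('X - 1) ^+ K) (pmul ('X - 1) R) by apply/funext => b; rewrite pmulM.
rewrite IH; last exact: zbelow_pmul.
by rewrite (mul_lo_X1 _ _ RN); congr mul_lo; lia.
Qed.

(** The coefficient form of the fundamental identity
    [x_0^-1 delta((x_1-x_2)/x_0) - x_0^-1 delta((x_2-x_1)/(-x_0))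
     = x_2^-1 delta((x_1-x_0)/x_2)]. *)
Definition coef_hi m d : F := if m - d is Posz i then (-1) ^+ i * gbinom m%:~R i else 0.
Definition coef_lo m d : F :=
  (-1) ^ m * (if d is Posz i then (-1) ^+ i * gbinom m%:~R i else 0).

Lemma gbinom_sym a b : (gbinom (a + b)%:R a : F) = gbinom (a + b)%:R b.
Proof. by rewrite !gbinom_nat -(bin_sub (leq_addr b a)) addKn. Qed.

Lemma delta_coef m d : coef_hi m d - coef_lo m d =
  if - m - 1 is Posz r then gbinom (- d%:~R - 1) r else 0.
Proof.
rewrite /coef_hi /coef_lo; case: m => m.
  have -> : - m%:Z - 1 = Negz m by lia.
  case: d => d; last first.
    have -> : m%:Z - Negz d = Posz (m + d.+1) by lia.
    by rewrite gbinom_small ?mulr0 ?subr0 ?mulr0 //; lia.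
  have [dm|md] := leqP d m; last first.
    have [i ->] : exists i, m%:Z - d%:Z = Negz i by exists (d - m).-1; lia.
    by rewrite gbinom_small // !mulr0 subrr.
  have -> : m%:Z - d%:Z = Posz (m - d) by lia.
  have := gbinom_sym (m - d) d; rewrite subnK // => ->; rewrite [_ ^ _ * _]mulrA -exprnP.
  have -> : (-1) ^+ m * (-1) ^+ d = (-1) ^+ (m - d) :> F.
    by rewrite -{1}(subnK dm) exprD -mulrA -expr2 sqrr_sign mulr1.
  by rewrite subrr.
have -> : - Negz m - 1 = Posz m by lia.
have neg i : (-1) ^+ i * gbinom (Negz m)%:~R i = gbinom (i + m)%:R i :> F.
  rewrite gbinom_opp; congr gbinom; rewrite NegzE rmorphN /= natrD -addn1 rmorphD /=; ring.
case: d => d.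
  have [i ->] : exists i, Negz m - d%:Z = Negz i by exists (m + d)%N; lia.
  rewrite sub0r neg NegzE -exprnN -exprVn invrN1 gbinom_sym.
  have -> : gbinom (- d%:Z%:~R - 1) m = (-1) ^+ m * gbinom (d + m)%:R m :> F.
    have := gbinom_opp (- d%:Z%:~R - 1 : F) m.
    have -> : m%:R - (- d%:Z%:~R - 1) - 1 = (d + m)%:R :> F by rewrite natrD /=; ring.
    by move=> <-; rewrite mulrA -exprD addnn -mul2n exprM sqrrN expr1n expr1n mul1r.
  by rewrite exprS !mulN1r mulNr opprK.
have E : - (Negz d)%:~R - 1 = d%:R :> F by rewrite NegzE rmorphN /= opprK -addn1 PoszD rmorphD /= addrK.
rewrite E mulr0 subr0; have [md|dm] := leqP m d.
  have -> : Negz m - Negz d = Posz (d - m) by lia.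
  by rewrite neg gbinom_sym subnK.
have [i ->] : exists i, Negz m - Negz d = Negz i by exists (m - d).-1; lia.
by rewrite gbinom_small.
Qed.

Lemma mul_hi_zsum m G e : mul_hi m G e = zsum (fun b => coef_hi m (e - b) *: G b).
Proof.
rewrite /mul_hi -(@zsum_inj _ _ (fun i : nat => e - m + i%:Z)).
- apply: eq_fsbigr => i _; rewrite /coef_hi.
  by have -> : m - (e - (e - m + i%:Z)) = Posz i by lia.
- by move=> i j /addrI[].
move=> b; rewrite /coef_hi; case E: (m - (e - b)) => [i|i]; last by rewrite scale0r eqxx.
by move=> _; exists i; lia.
Qed.

Lemma mul_lo_zsum N m G e : zsupp N G ->
  mul_lo m G e = zsum (fun b => coef_lo m (e - b) *: G b).
Proof.
move=> GN; rewrite /mul_lo.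
set c := fun d => if d is Posz i then (-1) ^+ i * gbinom m%:~R i : F else 0.
have -> : \sum_(i \in [set: nat]) ((-1) ^+ i * gbinom m%:~R i) *: G (e - i%:Z) =
    zsum (fun b => c (e - b) *: G b).
  rewrite -(@zsum_inj _ _ (fun i : nat => e - i%:Z)).
  - apply: eq_fsbigr => i _; rewrite /c.
    by have -> : e - (e - i%:Z) = Posz i by lia.
  - by move=> i j; lia.
  move=> b; rewrite /c; case E: (e - b) => [i|i]; last by rewrite scale0r eqxx.
  by move=> _; exists i; lia.
rewrite -(zsumZ (N := N)); first by apply: eq_zsum => b; rewrite scalerA.
exact: zsuppZ.
Qed.

Lemma mul_bin_expand1 N x alpha G m : zsupp N G ->
  mul_bin x (expand1 alpha G) m =
  if m is Posz r then zsum (fun b => gbinom (x + (alpha + b%:~R)) r *: G b) else 0.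
Proof.
move=> GN; case: m => r; last first.
  rewrite (@mul_binE 0) ?big_ord0 // => i _.
  by have -> : Negz r - i%:Z = Negz (r + i) by lia.
rewrite (@mul_binE r.+1); last first.
  move=> i ri; have [j ->] // : exists j, Posz r - i%:Z = Negz j.
  by exists (i - r).-1; lia.
transitivity (\sum_(i < r.+1)
    zsum (fun b => (gbinom x i * gbinom (alpha + b%:~R) (r - i)%N) *: G b)).
  apply: eq_bigr => i _; have ri : (i <= r)%N by rewrite -ltnS.
  have -> : Posz r - i%:Z = Posz (r - i) by lia.
  rewrite /= -(zsumZ (N := N)); last exact: zsuppZ.
  by apply: eq_zsum => b; rewrite scalerA.
rewrite -(@zsum_sum _ _ _ N); last by move=> i; apply: zsuppZ.
by apply: eq_zsum => b; rewrite -scaler_suml Vandermonde_gbinom.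
Qed.

(** A Laurent polynomial is its own expansion at infinity and at 0: each monomial
    reduces to the delta function identity [delta_coef]. *)
Lemma jacobi1_expand1 N alpha G m e : zsupp N G ->
  jacobi1 alpha G G (expand1 alpha G) m e.
Proof.
move=> GN; rewrite /jacobi1 mul_hi_zsum (mul_lo_zsum _ _ GN) (mul_bin_expand1 _ _ _ GN).
rewrite -[- zsum _]scaleN1r -(zsumZ (N := N)); last exact: zsuppZ.
rewrite -(@zsumD _ _ N); [|exact: zsuppZ|by do 2!apply: zsuppZ].
have E b : coef_hi m (e - b) *: G b + -1 *: (coef_lo m (e - b) *: G b) =
    (if - m - 1 is Posz r then gbinom (- (e - b)%:~R - 1) r else 0) *: G b.
  by rewrite scaleN1r -scalerBl delta_coef.
rewrite (eq_zsum E); case: (- m - 1) => r; last by apply: zsum0 => b; rewrite scale0r.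
by apply: eq_zsum => b; congr (gbinom _ _ *: _); rewrite rmorphB /=; ring.
Qed.

(** [(1 + t)^x] is a unit among power series. *)
Lemma mul_bin_inj N x f g : zbelow N f -> zbelow N g ->
  (forall m, mul_bin x f m = mul_bin x g m) -> f =1 g.
Proof.
move=> fN gN fg.
suff H (n : nat) : f (n%:Z - N%:Z) = g (n%:Z - N%:Z).
  move=> b; have [bN|bN] := ltP b (- N%:Z); first by rewrite fN ?gN.
  by have := H (absz (b + N%:Z)); have -> : (absz (b + N%:Z))%:Z - N%:Z = b by lia.
elim/ltn_ind: n => n IH; have := fg (n%:Z - N%:Z).
have z (h : int -> M) : zbelow N h -> forall i, (n.+1 <= i)%N -> h (n%:Z - N%:Z - i%:Z) = 0.
  by move=> hN i ni; apply: hN; lia.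
rewrite (mul_binE _ (z f fN)) (mul_binE _ (z g gN)).
rewrite !big_ord_recl gbinom0 !scale1r !subr0.
rewrite [in X in _ = _ + X -> _](eq_bigr (fun j : 'I_n => gbinom x (lift ord0 j) *: f (n%:Z - N%:Z - (lift ord0 j)%:Z))).
  by move/addIr.
move=> j _; congr (_ *: _).
have -> : n%:Z - N%:Z - (lift ord0 j)%:Z = (n - lift ord0 j)%N%:Z - N%:Z.
  by rewrite lift0; have := ltn_ord j; lia.
by rewrite IH // lift0; have := ltn_ord j; lia.
Qed.

(** The Jacobi identity says that [P], [R] and [I] expand one and the same
    rational function, [rho^alpha (rho - 1)^-N G], at infinity, at 0 and at 1. *)
Theorem jacobi1P N B alpha P R I : zabove B P -> zbelow B R -> zbelow N I ->
  pmul (('X - 1) ^+ N) P =1 pmul (('X - 1) ^+ N) R ->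
  (forall n e, jacobi1 alpha P R I n e) <->
  (forall i, expand1 alpha (pmul (('X - 1) ^+ N) P) i = I (i - N%:Z)).
Proof.
move=> PB RB IN /funext PR; set G := pmul _ P.
have GS : exists K, zsupp K G.
  eexists; apply: zsuppP; last exact: zabove_pmul PB.
  by rewrite /G PR; apply: zbelow_pmul RB.
have [K GK] := GS.
pose I' i := I (i - N%:Z).
have J n e : jacobi1 alpha P R I n e <->
    mul_bin (- (alpha + e%:~R) - 1) (expand1 alpha G) (N%:Z - n - 1) =
    mul_bin (- (alpha + e%:~R) - 1) I' (N%:Z - n - 1).
  have -> : mul_bin (- (alpha + e%:~R) - 1) I' (N%:Z - n - 1) =
     mul_bin (- (alpha + e%:~R) - 1) I (- n - 1).
    by apply: eq_fsbigr => i _; rewrite /I'; congr (_ *: I _); ring.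
  have := jacobi1_expand1 alpha (n - N%:Z) e GK; rewrite /jacobi1 {1}/G.
  rewrite (mul_hi_Xn _ _ _ PB) /G PR (mul_lo_Xn _ _ _ RB) subrK.
  have -> : - (n - N%:Z) - 1 = N%:Z - n - 1 by ring.
  by move=> ->.
have I'N : zbelow 0 I' by move=> b b0; apply: IN; lia.
have EN : zbelow 0 (expand1 alpha G) by case.
split=> [H i|H n e].
  apply: (@mul_bin_inj 0 (- (alpha + 0%:~R) - 1) _ I' EN I'N) => m.
  by have /J := H (N%:Z - 1 - m) 0; have -> : N%:Z - (N%:Z - 1 - m) - 1 = m by ring.
by apply/J; apply: eq_fsbigr => i _; rewrite H.
Qed.

End OneVariableJacobi.

(** * Exponentials of operators that raise a grading *)

Section Linear.
Variables (F : numClosedFieldType) (U V : lmodType F) (h : U -> V).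
Hypothesis hl : linear h.

Lemma lin0 : h 0 = 0.
Proof. by have := hl (-1) 0 0; rewrite scaler0 addr0 scaleN1r addNr. Qed.

Lemma linD u v : h (u + v) = h u + h v.
Proof. by rewrite -[u]scale1r hl !scale1r. Qed.

Lemma linZ c u : h (c *: u) = c *: h u.
Proof. by rewrite -[c *: u]addr0 hl lin0 addr0. Qed.

Lemma linN u : h (- u) = - h u.
Proof. by rewrite -!scaleN1r linZ. Qed.

Lemma lin_sum T (r : seq T) (P : pred T) (f : T -> U) :
  h (\sum_(i <- r | P i) f i) = \sum_(i <- r | P i) h (f i).
Proof. exact: (big_morph h linD lin0). Qed.

End Linear.

Lemma sum_square_antidiag (M : nmodType) (c : nat -> nat -> M) (s : nat) :
  (forall i j, (s < i + j)%N -> c i j = 0) ->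
  \sum_(n < s.+1) \sum_(i < n.+1) c i (n - i)%N = \sum_(i < s.+1) \sum_(j < s.+1) c i j.
Proof.
move=> c0; rewrite (exchange_antidiag (fun i j _ => c i j)); apply: eq_bigr => i _.
apply/esym/(sum_widen (f := c i)); first by rewrite ltnS leq_subr.
by move=> j ij; apply: c0; lia.
Qed.

Section Graded.
Variable F : numClosedFieldType.

(** A sequence stands for the formal series of its terms times the powers of a
    grading parameter; [conv] is then the action of a series of operators. *)
Definition conv (X Y : lmodType F) (A : nat -> X -> Y) (f : nat -> X) (s : nat) : Y :=
  \sum_(j < s.+1) A j (f (s - j)%N).

Definition exps (X : lmodType F) (T : (nat -> X) -> (nat -> X)) (f : nat -> X) s : X :=
  \sum_(n < s.+1) (n`!%:R : F)^-1 *: iter n T f s.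

Definition delta0 (X : lmodType F) (x : X) (s : nat) : X := if s is 0 then x else 0.
Definition shift (X : lmodType F) (f : nat -> X) (s : nat) : X :=
  if s is r.+1 then f r else 0.

(** Raising operators make the exponential series finite in each degree. *)
Definition raising (X : lmodType F) (T : (nat -> X) -> (nat -> X)) :=
  forall f s, (forall r, (r < s)%N -> f r = 0) -> T f s = 0.

Lemma iter_raising (X : lmodType F) (T : (nat -> X) -> (nat -> X)) f n s :
  raising T -> (s < n)%N -> iter n T f s = 0.
Proof.
move=> Tr; elim: n s => // n IH s sn; apply: Tr => r rs.
by apply: IH; apply: leq_trans rs _.
Qed.

Lemma expsE (X : lmodType F) (T : (nat -> X) -> (nat -> X)) f s N :
  raising T -> (s < N)%N -> exps T f s = \sum_(n < N) (n`!%:R : F)^-1 *: iter n T f s.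
Proof.
move=> Tr sN; apply/esym; apply: (sum_widen (f := fun n => (n`!%:R : F)^-1 *: iter n T f s)) => // n sn.
by rewrite iter_raising ?scaler0.
Qed.

Section Conv.
Variables (X : lmodType F) (A : nat -> X -> X).
Hypotheses (Al : forall j, linear (A j)) (A0 : forall x, A 0%N x = 0).
Implicit Types f g : nat -> X.

Lemma conv_raising : raising (conv A).
Proof.
move=> f s f0; rewrite /conv big_ord_recl A0 add0r big1 // => j _.
by rewrite f0 ?lin0 // lift0 ltn_subrL /= (leq_trans _ (ltn_ord j)).
Qed.

Lemma conv_lin c f g s : conv A (fun r => c *: f r + g r) s = c *: conv A f s + conv A g s.
Proof. by rewrite scaler_sumr -big_split; apply: eq_bigr => j _; rewrite Al. Qed.

Lemma iter_conv_lin n c f g :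
  iter n (conv A) (fun r => c *: f r + g r) =
  fun s => c *: iter n (conv A) f s + iter n (conv A) g s.
Proof. by elim: n => //= n ->; apply/funext => s; rewrite conv_lin. Qed.

Lemma iter_conv_sum n (I : Type) (r : seq I) (f : I -> nat -> X) :
  iter n (conv A) (fun s => \sum_(i <- r) f i s) =
  fun s => \sum_(i <- r) iter n (conv A) (f i) s.
Proof.
elim: n => //= n ->; apply/funext => s; rewrite /conv exchange_big.
by apply: eq_bigr => j _; rewrite lin_sum.
Qed.

Lemma iter_convZ n c f : iter n (conv A) (fun r => c *: f r) =
  fun s => c *: iter n (conv A) f s.
Proof.
elim: n => //= n ->; apply/funext => s; rewrite /conv scaler_sumr.
by apply: eq_bigr => j _; rewrite linZ.
Qed.

Lemma eq_iter_conv n f g s : (forall r, (r <= s)%N -> f r = g r) ->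
  iter n (conv A) f s = iter n (conv A) g s.
Proof.
elim: n s => [|n IH] s fg /=; first exact: fg.
apply: eq_bigr => j _; congr (A j _); apply: IH => r rs; apply: fg.
by apply: leq_trans rs _; apply: leq_subr.
Qed.

Lemma exps_conv_lin c f g s : exps (conv A) (fun r => c *: f r + g r) s =
  c *: exps (conv A) f s + exps (conv A) g s.
Proof.
rewrite scaler_sumr -big_split; apply: eq_bigr => n _.
by rewrite iter_conv_lin scalerDr !scalerA mulrC.
Qed.

Lemma iter_conv_shift n f : iter n (conv A) (shift f) = shift (iter n (conv A) f).
Proof.
elim: n => //= n ->; apply/funext => -[|s]; first by rewrite /conv big_ord1 A0.
rewrite /conv big_ord_recr /= subnn /= (lin0 (Al _)) addr0.
by apply: eq_bigr => j _; rewrite subSn // -ltnS.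
Qed.

Lemma exps_conv_shift f s : exps (conv A) (shift f) s = shift (exps (conv A) f) s.
Proof.
rewrite (@expsE _ _ _ _ s.+1) //; last exact: conv_raising.
case: s => [|s] /=; first by rewrite big_ord1 /= scaler0.
rewrite (@expsE _ _ _ _ s.+2) //; last exact: conv_raising.
by apply: eq_bigr => n _; rewrite iter_conv_shift.
Qed.

Lemma iter_convN n f : iter n (conv (fun j x => - A j x)) f =
  fun s => (-1) ^+ n *: iter n (conv A) f s.
Proof.
elim: n => [|n IH]; first by apply/funext => s; rewrite scale1r.
rewrite !iterS IH; apply/funext => s; rewrite /conv scaler_sumr.
by apply: eq_bigr => j _; rewrite linZ // exprS mulN1r scaleNr.
Qed.

Lemma exps_convN f s : exps (conv A) (exps (conv (fun j x => - A j x)) f) s = f s.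
Proof.
have Nr : raising (conv (fun j x => - A j x)).
  by move=> g r g0; have := conv_raising g0; rewrite /conv sumrN => ->; rewrite oppr0.
rewrite /exps; set T := conv A.
pose c i j := ((-1) ^+ j / (i`!%:R * j`!%:R) : F) *: iter (i + j) T f s.
transitivity (\sum_(i < s.+1) \sum_(j < s.+1) c i j).
  apply: eq_bigr => i _.
  rewrite (@eq_iter_conv _ _ (fun r => \sum_(j < s.+1) ((-1) ^+ j / j`!%:R : F) *: iter j T f r)).
    rewrite iter_conv_sum scaler_sumr; apply: eq_bigr => j _.
    rewrite iter_convZ scalerA /c iterD; congr (_ *: _).
    by rewrite invfM mulrCA mulrA.
  move=> r rs; rewrite -/(exps _ _ _) (expsE _ Nr (N := s.+1)) //.
  by apply: eq_bigr => j _; rewrite iter_convN scalerA mulrC.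
rewrite -sum_square_antidiag; last first.
  move=> i j ij; rewrite /c iter_raising ?scaler0 //; exact: conv_raising.
rewrite big_ord_recl /= big_ord1 /c /= mulr1 invr1 mulr1 scale1r.
rewrite big1 ?addr0 // => n _; rewrite /bump /= add1n.
transitivity (((n.+1)`!%:R^-1 * (1 - 1) ^+ n.+1 : F) *: iter n.+1 T f s); last first.
  by rewrite subrr expr0n mulr0 scale0r.
rewrite [1 - 1]addrC exprDn mulr_sumr scaler_suml.
apply: eq_bigr => i _; have ni : (i <= n.+1)%N by rewrite -ltnS.
rewrite subnKC //; congr (_ *: _).
rewrite expr1n mulr1 -[in RHS](mulr_natr _ 'C(_, _)) mulrCA; congr (_ * _).
rewrite -(bin_fact ni) !natrM.
have c0 : ('C(n.+1, i)%:R : F) != 0 by rewrite pnatr_eq0 -lt0n bin_gt0.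
have f0 j : (j`!%:R : F) != 0 by rewrite pnatr_eq0 -lt0n fact_gt0.
move: c0 (f0 i) (f0 (n.+1 - i)%N); move: ('C(_, _)%:R) (i`!%:R) ((n.+1 - i)`!%:R) => x y z x0 y0 z0.
by field; rewrite x0 y0 z0.
Qed.

End Conv.

(** A derivation property of [conv] exponentiates: this is the formula
    [e^A' phi g = (e^(ad A) phi) (e^A g)]. *)
Section Adjoint.
Variables (X Z : lmodType F) (A : nat -> X -> X) (A' : nat -> Z -> Z).
Hypotheses (Al : forall j, linear (A j)) (A0 : forall x, A 0%N x = 0).
Hypotheses (Al' : forall j, linear (A' j)) (A0' : forall x, A' 0%N x = 0).
Implicit Types phi : nat -> X -> Z.

Definition adj phi (s : nat) (x : X) : Z :=
  \sum_(j < s.+1) (A' j (phi (s - j)%N x) - phi (s - j)%N (A j x)).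

Lemma adj_linear phi : (forall s, linear (phi s)) -> forall s, linear (adj phi s).
Proof.
move=> pl s c x y; rewrite scaler_sumr -big_split; apply: eq_bigr => j _ /=.
by rewrite pl Al' Al pl scalerBr addrACA opprD.
Qed.

Lemma iter_adj_linear phi n : (forall s, linear (phi s)) ->
  forall s, linear (iter n adj phi s).
Proof. by move=> pl; elim: n => //= n IH; apply: adj_linear. Qed.

Lemma iter_adj0 phi n s : (forall s, linear (phi s)) -> (s < n)%N ->
  iter n adj phi s = fun=> 0.
Proof.
move=> pl; elim: n s => // n IH s sn; apply/funext => x /=.
have L := iter_adj_linear n pl.
rewrite /adj big_ord_recl A0' A0 (lin0 (L _)) subrr add0r.
rewrite big1 // => j _; rewrite IH ?(lin0 (Al' _)) ?subrr //.
by rewrite lift0; have := ltn_ord j; lia.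
Qed.

Lemma conv_leibniz phi g : (forall s, linear (phi s)) ->
  conv A' (conv phi g) = fun s => conv (adj phi) g s + conv phi (conv A g) s.
Proof.
move=> pl; apply/funext => s.
have -> : conv A' (conv phi g) s =
    \sum_(i < s.+1) \sum_(j < i.+1) A' j (phi (i - j)%N (g (s - i)%N)).
  rewrite (exchange_antidiag (fun j i l => A' j (phi i (g l)))).
  by apply: eq_bigr => j _; rewrite lin_sum.
have -> : conv phi (conv A g) s =
    \sum_(i < s.+1) \sum_(j < i.+1) phi (i - j)%N (A j (g (s - i)%N)).
  transitivity (\sum_(i < s.+1) \sum_(j < i.+1) phi j (A (i - j)%N (g (s - i)%N))).
    rewrite (exchange_antidiag (fun j i l => phi j (A i (g l)))).
    by apply: eq_bigr => j _; rewrite lin_sum.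
  apply: eq_bigr => i _; rewrite (reindex_inj rev_ord_inj); apply: eq_bigr => j _ /=.
  by rewrite subSS subKn // -ltnS.
rewrite -big_split; apply: eq_bigr => i _ /=; rewrite -big_split.
by apply: eq_bigr => j _ /=; rewrite subrK.
Qed.

Lemma iter_leibniz phi g n s : (forall s, linear (phi s)) ->
  iter n (conv A') (conv phi g) s =
  \sum_(i < n.+1) 'C(n, i)%:R *: conv (iter i adj phi) (iter (n - i) (conv A) g) s.
Proof.
move=> pl; set b := fun i j => conv (iter i adj phi) (iter j (conv A) g).
suff -> : iter n (conv A') (conv phi g) =
    fun s => \sum_(i < n.+1) 'C(n, i)%:R *: b i (n - i)%N s by [].
elim: n {s} => [|n IH].
  by apply/funext => s; rewrite big_ord1 /= scale1r.
have bS i j s : conv A' (b i j) s = b i.+1 j s + b i j.+1 s.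
  by rewrite /b conv_leibniz //; apply: iter_adj_linear.
rewrite iterS IH; apply/funext => s.
transitivity (\sum_(i < n.+1) 'C(n, i)%:R *: conv A' (b i (n - i)%N) s).
  rewrite {1}/conv (eq_bigr (fun j : 'I_s.+1 =>
      \sum_(i < n.+1) 'C(n, i)%:R *: A' j (b i (n - i)%N (s - j)%N))); last first.
    by move=> j _; rewrite lin_sum //; apply: eq_bigr => i _; rewrite linZ.
  by rewrite exchange_big; apply: eq_bigr => i _; rewrite -scaler_sumr.
rewrite (eq_bigr (fun i : 'I_n.+1 => 'C(n, i)%:R *: b i.+1 (n - i)%N s +
    'C(n, i)%:R *: b i (n.+1 - i)%N s)); last first.
  by move=> i _; rewrite bS scalerDr subSn // -ltnS.
rewrite big_split /= addrC [RHS]big_ord_recl /= big_ord_recl -addrA !bin0; congr (_ + _).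
rewrite [in RHS](eq_bigr (fun i : 'I_n.+1 => 'C(n, i.+1)%:R *: b i.+1 (n - i)%N s +
    'C(n, i)%:R *: b i.+1 (n - i)%N s)); last first.
  by move=> i _; rewrite /bump /= add1n binS natrD scalerDl subSS.
rewrite big_split /=; congr (_ + _).
rewrite [RHS]big_ord_recr /= bin_small // scale0r addr0.
by apply: eq_bigr => i _; rewrite /bump /= add1n subSS.
Qed.

Theorem exps_conv_adj phi g s : (forall s, linear (phi s)) ->
  exps (conv A') (conv phi g) s =
  conv (exps (X := X -> Z) adj phi) (exps (conv A) g) s.
Proof.
move=> pl; pose c i j := ((i`!%:R)^-1 * (j`!%:R)^-1 : F) *:
  conv (iter i adj phi) (iter j (conv A) g) s.
transitivity (\sum_(i < s.+1) \sum_(j < s.+1) c i j); last first.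
  pose d i j l := ((i`!%:R)^-1 * (j`!%:R)^-1 : F) *: iter i adj phi l (iter j (conv A) g (s - l)%N).
  rewrite (eq_bigr (fun i : 'I_s.+1 => \sum_(l < s.+1) \sum_(j < s.+1) d i j l)); last first.
    by move=> i _; rewrite exchange_big; apply: eq_bigr => j _; rewrite /c scaler_sumr.
  rewrite exchange_big; apply: eq_bigr => l _; have ls : (l <= s)%N by rewrite -ltnS.
  have -> : exps (X := X -> Z) adj phi l = fun x => \sum_(i < s.+1) (i`!%:R : F)^-1 *: iter i adj phi l x.
    rewrite /exps; apply/funext => x.
    rewrite (sum_widen (A := l.+1) (f := fun i => (i`!%:R : F)^-1 *: iter i adj phi l x)) //; last first.
      by move=> i li; rewrite iter_adj0 ?scaler0.
    by rewrite fct_sumE.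
  apply: eq_bigr => i _.
  rewrite (@expsE _ _ _ _ s.+1); [|exact: conv_raising|by rewrite ltnS leq_subr].
  rewrite lin_sum ?scaler_sumr; last exact: iter_adj_linear.
  by apply: eq_bigr => j _; rewrite linZ ?scalerA //; apply: iter_adj_linear.
rewrite -sum_square_antidiag; last first.
  move=> i j ij; rewrite /c [conv _ _ _]big1 ?scaler0 // => l _.
  have [li|il] := ltnP l i; first by rewrite iter_adj0.
  rewrite (_ : iter j _ _ _ = 0) ?(lin0 (iter_adj_linear i pl l)) //.
  by apply: iter_raising; [exact: conv_raising|have := ltn_ord l; lia].
apply: eq_bigr => n _; rewrite iter_leibniz // scaler_sumr; apply: eq_bigr => i _.
have ni : (i <= n)%N by rewrite -ltnS.
rewrite /c scalerA; congr (_ *: _); rewrite -(bin_fact ni) !natrM.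
have c0 : ('C(n, i)%:R : F) != 0 by rewrite pnatr_eq0 -lt0n bin_gt0.
have f0 j : (j`!%:R : F) != 0 by rewrite pnatr_eq0 -lt0n fact_gt0.
by rewrite !invfM mulrAC mulrA mulVf // mul1r.
Qed.

End Adjoint.
End Graded.

(** * The change of variable and representations of the Witt algebra *)

Section Witt.
Variables (F : numClosedFieldType) (a : nat -> F).

Definition coef_a (j : nat) : F := if j is 0 then 0 else a j.

(** [l n] plays the part of [L(n - 1)], that is of [- x^n d/dx]. *)
Definition witt_rep (X : lmodType F) (l : nat -> X -> X) : Prop :=
  (forall n, linear (l n)) /\
  forall m n x, (0 < m + n)%N ->
    l m (l n x) - l n (l m x) = (m%:R - n%:R) *: l (m + n).-1 x.

Section Representation.
Variables (X : lmodType F) (l : nat -> X -> X).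
Hypothesis hl : witt_rep l.

(** The graded pieces of [- sum_(j >= 1) a_j L(j)]. *)
Definition opA (j : nat) (x : X) : X := - (coef_a j *: l j.+1 x).

Definition opE (s : nat) (x : X) : X := exps (conv opA) (delta0 x) s.

Lemma opA_linear j : linear (opA j).
Proof.
move=> c x y; rewrite /opA (hl.1 j.+1) scalerDr opprD scalerN; congr (- _ - _).
by rewrite !scalerA mulrC.
Qed.

Lemma opA0 x : opA 0 x = 0.
Proof. by rewrite /opA scale0r oppr0. Qed.

Lemma opE_linear s : linear (opE s).
Proof.
move=> c x y; rewrite /opE -(exps_conv_lin opA_linear); congr exps.
by apply/funext => -[|r] //=; rewrite scaler0 addr0.
Qed.

Lemma opE0 x : opE 0 x = x.
Proof. by rewrite /opE /exps big_ord1 /= invr1 scale1r. Qed.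

Lemma opE_fix x s : (forall j, (1 < j)%N -> l j x = 0) -> opE s x = delta0 x s.
Proof.
move=> lx; rewrite /opE /exps big_ord_recl big1 ?addr0 => [|n _].
  by rewrite /= invr1 scale1r.
rewrite lift0; have -> : iter n.+1 (conv opA) (delta0 x) = fun=> 0; last by rewrite scaler0.
move: (nat_of_ord n) => m0; elim: m0 => [|m IH].
  apply/funext => r /=; rewrite /conv big1 // => j _.
  case: (r - j)%N => [|q] /=; last by rewrite (lin0 (@opA_linear j)).
  by case: (nat_of_ord j) => [|i]; [exact: opA0|rewrite /opA lx // scaler0 oppr0].
rewrite iterS IH; apply/funext => r; rewrite /conv big1 // => j _.
by rewrite (lin0 (@opA_linear j)).
Qed.

(** The vector field [P d/dx] acting on [X], and the adjoint action on it. *)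
Definition vfield (P : nat -> F^o) (s : nat) (x : X) : X := P s *: l s x.

Definition ad_field (P : nat -> F^o) (s : nat) : F^o :=
  - \sum_(j < s.+1) coef_a j * (j.+1%:R - (s - j)%:R) * P (s - j)%N.

Lemma vfield_linear P s : linear (vfield P s).
Proof. by move=> c x y; rewrite /vfield (hl.1 s) scalerDr !scalerA mulrC. Qed.

(** In the Witt algebra, bracketing with [L(j)] acts on vector fields
    independently of the representation. *)
Lemma adj_vfield P : adj opA opA (vfield P) = vfield (ad_field P).
Proof.
apply/funext => s; apply/funext => x.
rewrite /adj /vfield /ad_field -sumrN scaler_suml; apply: eq_bigr => j _.
have js : (j <= s)%N by rewrite -ltnS.
have -> : l s x = l (j.+1 + (s - j)).-1 x by rewrite addSn subnKC.
have := hl.2 j.+1 (s - j)%N x isT; set y := l _.-1 x.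
rewrite /opA (linZ (hl.1 j.+1)) (linN (hl.1 (s - j)%N)) (linZ (hl.1 (s - j)%N)).
set u := l j.+1 (l _ x); set v := l (s - j)%N _; set c := _%:R - _%:R => E.
rewrite scalerN opprK !scalerA [P _ * _]mulrC addrC -scalerBr -opprB scalerN E.
by rewrite scaleNr scalerA; congr (- (_ *: _)); ring.
Qed.

Lemma exps_adj_vfield P s :
  exps (X := X -> X) (adj opA opA) (vfield P) s = vfield (exps ad_field P) s.
Proof.
have it n : iter n (adj opA opA) (vfield P) = vfield (iter n ad_field P).
  by elim: n => //= n ->; rewrite adj_vfield.
apply/funext => x; rewrite /exps fct_sumE /vfield scaler_suml; apply: eq_bigr => n _.
by rewrite it /= -scalerA.
Qed.

Lemma exps_vfield P g s : exps (conv opA) (conv (vfield P) g) s =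
  conv (vfield (exps ad_field P)) (exps (conv opA) g) s.
Proof.
rewrite (exps_conv_adj opA_linear opA0 opA_linear opA0 _ _ (vfield_linear P)).
by apply: eq_bigr => j _; rewrite exps_adj_vfield.
Qed.

End Representation.

(** The vector field [(1 + c x) d/dx]. *)
Definition linear_field (c : F) (s : nat) : F^o := if s is 0 then 1 else if s is 1 then c else 0.

Lemma conv_linear_field (X : lmodType F) (l : nat -> X -> X) (hl : witt_rep l) c g s :
  conv (vfield l (linear_field c)) g s = l 0%N (g s) + shift (fun r => c *: l 1%N (g r)) s.
Proof.
rewrite /conv big_ord_recl /vfield /= scale1r subn0; congr (_ + _).
case: s => [|s]; first by rewrite big_ord0.
rewrite big_ord_recl /= subn1 big1 ?addr0 // => j _.
by rewrite /bump /= !add1n scale0r.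
Qed.

Definition poly_field (n : nat) (p : {poly F}) : {poly F} := - ('X^n * p^`()).

Lemma witt_poly : witt_rep poly_field.
Proof.
rewrite /poly_field.
split=> [n c p q|m n p mn].
  by rewrite derivD derivZ mulrDr opprD -scalerAr scalerN.
rewrite /= !derivN !derivM !derivXn !mulrN !opprK !mulrDr.
have E (i j : nat) (r : {poly F}) : (0 < i + j)%N ->
    'X^i * ('X^(j.-1) *+ j * r) = j%:R *: ('X^((i + j).-1) * r) :> {poly F}.
  case: j => [|j] _; first by rewrite mulr0n mul0r mulr0 scale0r.
  by rewrite addnS /= -scaler_nat -scalerAl -scalerAr mulrA -exprD.
rewrite E // E 1?addnC // ['X^m * ('X^n * _)]mulrCA opprD addrACA subrr addr0.
by rewrite -scalerBl scalerN -scaleNr opprB.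
Qed.

(** [f = ((1 + x)^k - 1)/k] satisfies [(1 + x) f' = 1 + k f]: the exponential
    of [- sum a_j x^(j+1) d/dx] carries [x] to [f], hence conjugates
    [(1 + k x) d/dx] to [(1 + x) d/dx]. *)
Lemma exps_ad_field (k : nat) (f : {poly F}) : f`_0 = 0 ->
  (1 + 'X) * f^`() = 1 + k%:R *: f ->
  (forall s, exps (conv (fun j x => - opA poly_field j x)) (delta0 'X) s =
     f`_(s.+1) *: 'X^(s.+1)) ->
  exps ad_field (linear_field 1) =1 linear_field k%:R.
Proof.
move=> f0 f_ode; set g := exps _ _ => gE s.
have hl := witt_poly; have Al := opA_linear hl; have A0 := @opA0 _ poly_field.
have E1 r : exps (conv (opA poly_field)) g r = delta0 'X r by apply: (exps_convN Al A0).
pose one := delta0 (1 : {poly F}).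
have ode i : i.+1%:R * f`_i.+1 + i%:R * f`_i = (i == 0%N)%:R + k%:R * f`_i.
  have := congr1 (fun p : {poly F} => p`_i) f_ode.
  rewrite mulrDl mul1r !coefD coefZ coef1 coefXM !coef_deriv !mulr_natl => <-.
  by congr (_ + _); case: i => [|i]; rewrite ?mulr0n //= coef_deriv.
have fieldX (c : F) i : poly_field 0 (c *: 'X^(i.+1)) = - ((i.+1%:R * c) *: 'X^i).
  by rewrite /poly_field mul1r derivZ derivXn /= -scaler_nat scalerA mulrC.
have field1X (c : F) i : poly_field 1 (c *: 'X^i) = - ((i%:R * c) *: 'X^i).
  rewrite /poly_field derivZ derivXn -scaler_nat -!scalerAr scalerA mulrC.
  by case: i => [|i]; rewrite ?mul0r ?scale0r // -exprD add1n.
(* [g] stands for [f]: apply the exponential to the equation satisfied by [f] *)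
have := exps_vfield hl (linear_field 1) g s.
have -> : conv (vfield poly_field (linear_field 1)) g =
    fun r => -1 *: one r + shift (fun q => - k%:R *: g q) r.
  apply/funext => r; rewrite conv_linear_field // gE fieldX.
  case: r => [|r] /=.
    by have := ode 0%N; rewrite f0 !mulr0 !addr0 => ->; rewrite scaleN1r scale1r.
  rewrite scaler0 add0r !gE scale1r field1X -opprD -scalerDl ode add0r.
  by rewrite scaleNr scalerA.
rewrite (exps_conv_lin Al) (exps_conv_shift Al A0).
have -> : exps (conv (opA poly_field)) one s = one s.
  by apply: opE_fix => // j _; rewrite /poly_field derivC mulr0 oppr0.
have -> : shift (exps (conv (opA poly_field)) (fun q => - k%:R *: g q)) s =
    shift (fun q => - k%:R *: delta0 'X q) s.
  case: s => //= s; rewrite -E1 /exps scaler_sumr; apply: eq_bigr => n _.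
  by rewrite (iter_convZ Al) scalerA mulrC -scalerA.
rewrite {1}/conv big_ord_recr /= subnn E1 /= big1 ?add0r => [|j _]; last first.
  rewrite E1; have js := ltn_ord j; have -> : (s - j)%N = (s - j.+1).+1 by lia.
  by rewrite (lin0 (vfield_linear hl _ _)).
rewrite /vfield /poly_field derivX mulr1 => /(congr1 (fun p : {poly F} => - p`_s)).
rewrite coefZ coefN coefXn eqxx mulrN1 opprK => <-.
case: s => [|[|s]] /=.
- by rewrite coefD coefZ coef1 coef0 addr0 mulr1 opprK.
- by rewrite coefD !coefZ coef0 coefX mulr0 add0r mulr1 opprK.
by rewrite coefD !coefZ !coef0 !mulr0 addr0 oppr0.
Qed.

(** Consequently [E (L(-1) + L(0)) = (L(-1) + k L(0)) E] in every
    representation. *)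
Lemma opE_intertwine (k : nat) (X : lmodType F) (l : nat -> X -> X) s x :
  witt_rep l -> exps ad_field (linear_field 1) =1 linear_field k%:R ->
  opE l s.+1 (l 0%N x) + opE l s (l 1%N x) =
  l 0%N (opE l s.+1 x) + k%:R *: l 1%N (opE l s x).
Proof.
move=> hl expk; have Al := opA_linear hl; have A0 := @opA0 _ l.
have := exps_vfield hl (linear_field 1) (delta0 x) s.+1.
have -> : conv (vfield l (linear_field 1)) (delta0 x) =
    fun r => 1 *: delta0 (l 0%N x) r + shift (delta0 (l 1%N x)) r.
  apply/funext => r; rewrite conv_linear_field // scale1r.
  case: r => [|[|r]] //=; rewrite ?scale1r ?addr0 ?add0r //.
  - by rewrite (lin0 (hl.1 _)) add0r.
  - by rewrite !(lin0 (hl.1 _)) addr0.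
rewrite (exps_conv_lin Al) scale1r (exps_conv_shift Al A0) /= -!/(opE l _ _) => ->.
have -> : exps ad_field (linear_field 1) = linear_field k%:R by apply/funext.
by rewrite conv_linear_field.
Qed.

End Witt.

(** * The two exponentials of the definitions as graded exponentials *)

Section Embedding.
Variables (F : numClosedFieldType) (X X' : lmodType F).
Variables (pos : nat -> rat) (h : nat -> X' -> X).
Hypotheses (pos_inj : injective pos) (h_linear : forall s, linear (h s)).
Hypothesis h_inj : forall s x, h s x = 0 -> x = 0.

(** The series [fh] is supported on the exponents [pos s], where it has the
    coefficients [f s]. *)
Definition embeds (f : nat -> X) (fh : series X') : Prop :=
  (forall s, h s (fh (pos s)) = f s) /\
  (forall e, (forall s, e <> pos s) -> fh e = 0).

Lemma exp_series_embeds (A : nat -> X -> X) (T : series X' -> series X') f fh :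
  (forall j, linear (A j)) -> (forall x, A 0%N x = 0) ->
  (forall f fh, embeds f fh -> embeds (conv A f) (T fh)) ->
  embeds f fh -> embeds (exps (conv A) f) (exp_series T fh).
Proof.
move=> Al A0 step emb.
have it n : embeds (iter n (conv A) f) (iter n T fh) by elim: n => //= n; exact: step.
split=> [s|e ne]; last by apply: fsbig1 => n _; rewrite (it n).2 ?scaler0.
rewrite /exp_series (@fsum_nat _ s.+1).
  by rewrite (lin_sum (h_linear s)); apply: eq_bigr => n _; rewrite (linZ (h_linear s)) (it n).1.
move=> n sn; rewrite (h_inj (s := s) (x := iter n T fh (pos s))) ?scaler0 //.
by rewrite (it n).1; apply: iter_raising => //; exact: conv_raising.
Qed.

End Embedding.

Section ChangeOfVariable.
Variables (F : numClosedFieldType) (k : nat) (a : nat -> F).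
Hypothesis k_gt0 : (0 < k)%N.

(** The polynomial [((1 + x)^k - 1)/k]. *)
Definition cov : {poly F} := k%:R^-1 *: (1 + 'X) ^+ k - (k%:R^-1)%:P.

Lemma k_neq0 : (k%:R : F) != 0.
Proof. by rewrite pnatr_eq0 -lt0n. Qed.

Lemma cov_coef0 : cov`_0 = 0.
Proof.
by rewrite -horner_coef0 /cov !hornerE /= ?addr0 expr1n mulr1 subrr.
Qed.

Lemma deriv_cov : cov^`() = (1 + 'X) ^+ k.-1.
Proof.
rewrite /cov derivB derivC subr0 derivZ deriv_exp derivD derivX -polyC1 derivC add0r.
by rewrite mul1r -scaler_nat scalerA mulVf ?k_neq0 // scale1r.
Qed.

Lemma cov_ode : (1 + 'X) * cov^`() = 1 + k%:R *: cov.
Proof.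
rewrite deriv_cov -exprS prednK // /cov scalerBr scalerA divff ?k_neq0 // scale1r.
by rewrite scale_polyC divff ?k_neq0 // polyC1 [RHS]addrC subrK.
Qed.

(** The exponents of the series starting with [x] on which the exponential of
    [is_change_of_variable] acts. *)
Definition posS (s : nat) : rat := s%:R + 1.

Lemma posS_natE s : posS s = s.+1%:R.
Proof. by rewrite /posS -natr1. Qed.

Lemma cov_exps : is_change_of_variable k a ->
  forall s, exps (conv (fun j x => - opA a (@poly_field F) j x)) (delta0 'X) s =
    cov`_(s.+1) *: 'X^(s.+1).
Proof.
rewrite /is_change_of_variable => /=.
set T := fun f : series F^o => _; rewrite -/cov => a_def s.
pose h (s : nat) (c : F^o) : {poly F} := c *: 'X^(s.+1).
have hl r : linear (h r) by move=> c x y; rewrite /h scalerDl scalerA.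
have h_inj r x : h r x = 0 -> x = 0.
  by move/(congr1 (fun p : {poly F} => p`_(r.+1))); rewrite coefZ coefXn eqxx mulr1 coef0.
have posI : injective posS by move=> i j; rewrite !posS_natE => /eqP; rewrite eqr_nat => /eqP[].
have Al := opA_linear a (witt_poly F); have A0 := @opA0 _ a _ (@poly_field F).
have Al' j : linear (fun x => - opA a (@poly_field F) j x).
  by move=> c x y; rewrite Al opprD scalerN.
have A0' x : - opA a (@poly_field F) 0 x = 0 by rewrite A0 oppr0.
have step f fh : embeds posS h f fh ->
    embeds posS h (conv (fun j x => - opA a (@poly_field F) j x) f) (T fh).
  move=> [E1 E2]; split=> [r|e ne].
    rewrite /T (@fsum_nat_pos _ r.+1); last first.
      move=> j rj; rewrite /deriv_series E2 ?scaler0 // => i; rewrite !posS_natE.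
      have -> : (r.+1%:R - j.+1%:R + 1 : rat) = (r.+1%:R - j%:R) by rewrite -natr1; ring.
      move/eqP; rewrite subr_eq -natrD eqr_nat => /eqP; lia.
    rewrite (linN (hl r)) (lin_sum (hl r)) big_mkcond -sumrN; apply: eq_bigr => j _.
    case: (nat_of_ord j) (ltn_ord j) => [|i] ir; first by rewrite A0.
    rewrite /= /opA -E1 /deriv_series.
    have -> : posS r - i.+2%:R + 1 = posS (r - i.+1).
      by rewrite /posS natrB // -[i.+2]addn1 natrD; ring.
    move: (fh _) => c; rewrite posS_natE ratr_nat /h /poly_field derivZ derivXn /=.
    rewrite -scaler_nat -!scalerAr -exprD scalerN opprK.
    have -> : (i.+2 + (r - i.+1) = r.+1)%N by lia.
    rewrite -scaleNr !scalerA -[LHS]scaleNr; congr (_ *: _).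
    by rewrite -[_ *: c]/(_ * c) mulNr [c * _]mulrC mulrA.
  rewrite /T fsbig1 ?oppr0 // => j /= j0; rewrite /deriv_series E2 ?scaler0 // => i ei.
  apply: (ne (i + j)%N); move: ei; rewrite !posS_natE => ei.
  by rewrite -addSn natrD -ei -natr1; ring.
have emb0 : embeds posS h (delta0 'X) (fun e => (e == 1)%:R).
  split=> [r|e ne]; last first.
    by case: eqP => // e1; case: (ne 0%N); rewrite e1 posS_natE.
  by rewrite /h posS_natE (eqr_nat _ _ 1); case: r => [|r] /=; rewrite ?scale1r ?scale0r ?expr1.
have [E _] := exp_series_embeds hl h_inj Al' A0' step emb0.
rewrite -E a_def; congr (_ *: _).
rewrite (@fsum_one _ _ s.+1) ?posS_natE ?eqxx ?mul1r // => m ms.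
by rewrite eqr_nat eq_sym (negbTE ms) mul0r.
Qed.

Lemma cov_exps_ad_field : is_change_of_variable k a ->
  exps (ad_field a) (linear_field 1) =1 linear_field (k%:R : F).
Proof. by move=> a_def; apply: (exps_ad_field cov_coef0 cov_ode); apply: cov_exps. Qed.

End ChangeOfVariable.

Section VirasoroAction.
Variables (F : numClosedFieldType) (V : vertex_operator_superalgebra F).

Definition Lop (n : nat) (v : V) : V := L (n%:Z - 1) v.

Lemma L_linear n : linear (@L F V n).
Proof. by move=> c u v; rewrite /L /virasoro_mode Y_linearr. Qed.

Lemma witt_Lop : witt_rep Lop.
Proof.
split=> [n|m n v mn]; first exact: L_linear.
rewrite /Lop /L virasoro.
have -> : (m%:Z - 1) + (n%:Z - 1) = (m + n).-1%:Z - 1 by lia.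
have -> : (m%:Z - 1 - (n%:Z - 1))%:~R = m%:R - n%:R :> F.
  by rewrite !rmorphB /=; ring.
rewrite -[RHS]addr0; congr (_ + _).
have [/eqP mn2|_] := eqVneq ((m + n).-1%:Z - 1) 0; last by rewrite mulr0 mul0r scale0r.
suff -> : (m%:Z - 1) ^+ 3 - (m%:Z - 1) = 0 by rewrite mul0r !mul0r scale0r.
have : (m <= 2)%N by lia.
by case: m mn mn2 => [|[|[|]]].
Qed.

Variables (k : nat) (a : nat -> F).
Hypothesis k_gt0 : (0 < k)%N.

(** [E s] is the coefficient of [y^-s] in [exp(- sum_(j >= 1) a_j y^-j L(j))]. *)
Definition E (s : nat) (v : V) : V := opE a Lop s v.

Lemma E_linear s : linear (E s).
Proof. exact: opE_linear witt_Lop _. Qed.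

Definition posL (s : nat) : rat := - (s%:R / k%:R).

Lemma exp_L_embeds (u : V) : embeds posL (fun=> id)
  (fun s => E s u) (exp_L k a (fun d => (d == 0)%:R *: u)).
Proof.
have k0 : (k%:R : rat) != 0 by rewrite pnatr_eq0 -lt0n.
have posI : injective posL.
  by move=> i j /oppr_inj /(mulIf (invr_neq0 k0)) /eqP; rewrite eqr_nat => /eqP.
have Al := opA_linear a witt_Lop; have A0 := @opA0 _ a _ Lop.
apply: (@exp_series_embeds F V V posL (fun=> id) _ _ (opA a Lop)) => //; last first.
  split=> [s|e ne].
    rewrite /posL oppr_eq0 mulf_eq0 invr_eq0 (negbTE k0) orbF pnatr_eq0.
    by case: s => [|s]; rewrite ?scale1r ?scale0r.
  case: eqP => [e0|_]; last by rewrite scale0r.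
  by case: (ne 0%N); rewrite /posL mul0r oppr0.
move=> f fh [E1 E2]; split=> [r|e ne].
  rewrite (@fsum_nat_pos _ r.+1); last first.
    move=> j rj; rewrite E2 ?(lin0 (@L_linear _)) ?scaler0 // => i.
    rewrite /posL -mulNr -mulrDl -mulNr => /(mulIf (invr_neq0 k0)) /eqP.
    by rewrite addrC -subr_eq0 opprK -addrA [- _ + _]addrC addrA -natrD subr_eq0 eqr_nat => /eqP; lia.
  rewrite big_mkcond -sumrN; apply: eq_bigr => j _.
  case: (nat_of_ord j) (ltn_ord j) => [|i] ir; first by rewrite A0 oppr0.
  rewrite /= /opA /= -E1; congr (- (_ *: _)); rewrite /Lop.
  have -> : i.+2%:Z - 1 = i.+1%:Z by lia.
  congr (L _ (fh _)); rewrite /posL natrB //; ring.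
rewrite fsbig1 ?oppr0 // => j /= j0; rewrite E2 ?(lin0 (@L_linear _)) ?scaler0 // => i ei.
by apply: (ne (i + j)%N); move: ei; rewrite /posL natrD mulrDl opprD => <-; ring.
Qed.

Lemma exp_L_E (u : V) s : exp_L k a (fun d => (d == 0)%:R *: u) (posL s) = E s u.
Proof. exact: (exp_L_embeds u).1. Qed.

Lemma exp_L_0 (u : V) e : (forall s, e <> posL s) ->
  exp_L k a (fun d => (d == 0)%:R *: u) e = 0.
Proof. exact: (exp_L_embeds u).2. Qed.

End VirasoroAction.

(** * Coefficients of the products with delta functions *)

Section DeltaProducts.
Variables (F : numClosedFieldType) (M : lmodType F).
Implicit Types (X : rat -> rat -> M) (n : int) (i : nat).

Lemma fsum_inj (T : choiceType) (h : nat -> T) (f : T -> M) : injective h ->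
  (forall x, f x != 0 -> exists i, x = h i) ->
  \sum_(x \in [set: T]) f x = \sum_(i \in [set: nat]) f (h i).
Proof.
move=> hi fh; rewrite -(@fsbig_image _ _ _ nat T [set: nat] h f); last by move=> x y _ _ /hi.
apply/esym/fsbig_widen => // x [_ nx] /=; apply/eqP/negPn/negP => /fh[i xi].
by apply: nx; exists i.
Qed.

Lemma binomial_expE (q : rat) i :
  binomial_exp F q (q - i%:R) i%:R = (-1) ^+ i * gbinom (ratr q) i.
Proof.
rewrite /binomial_exp (@fsum_one _ _ i) ?eqxx ?mulr1 // => j ji.
by rewrite eqr_nat [i == j]eq_sym (negbTE ji) andbF mulr0.
Qed.

Lemma binomial_exp_neq0 (q x y : rat) : binomial_exp F q x y != 0 ->
  exists i, x = q - i%:R /\ y = i%:R.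
Proof.
move=> nz; apply: contrapT => H; move/eqP: nz; apply.
apply: fsbig1 => i _; case: (x =P _) => [xi|]; last by rewrite mulr0.
by case: (y =P _) => [yi|]; [case: H; exists i|rewrite mulr0].
Qed.

Lemma ratr_intZ n : ratr n%:~R = n%:~R :> F.
Proof. exact: ratr_int. Qed.

Lemma intrat_inj : injective (fun n : int => n%:~R : rat).
Proof. by move=> m n /eqP; rewrite eqr_int => /eqP. Qed.

Lemma delta_exponent n n' : (- n%:~R - 1 : rat) = - n'%:~R - 1 -> n = n'.
Proof. by move/addIr/oppr_inj/intrat_inj. Qed.

Lemma delta_12_0E n i :
  delta_12_0 F (- n%:~R - 1) (n%:~R - i%:R) i%:R = (-1) ^+ i * gbinom n%:~R i.
Proof.
rewrite /delta_12_0 (@fsum_one _ _ n) ?eqxx ?mul1r ?binomial_expE ?ratr_intZ //.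
by move=> m mn; case: eqP => [/delta_exponent nm|_]; [rewrite nm eqxx in mn|rewrite mul0r].
Qed.

Lemma delta_12_0_neq0 (x y z : rat) : delta_12_0 F x y z != 0 ->
  exists n i, [/\ x = - n%:~R - 1, y = n%:~R - i%:R & z = i%:R].
Proof.
move=> nz; apply: contrapT => H; move/eqP: nz; apply; apply: fsbig1 => n _.
case: (x =P _) => [xn|]; last by rewrite mul0r.
apply/eqP/negPn/negP; rewrite mul1r => /binomial_exp_neq0[i [yi zi]].
by apply: H; exists n, i.
Qed.

Lemma delta_21_0E n i :
  delta_21_0 F (- n%:~R - 1) i%:R (n%:~R - i%:R) =
  (-1) ^ n * ((-1) ^+ i * gbinom n%:~R i).
Proof.
rewrite /delta_21_0 (@fsum_one _ _ n) ?eqxx ?mulr1 ?binomial_expE ?ratr_intZ //.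
by move=> m mn; case: eqP => [/delta_exponent nm|_]; [rewrite nm eqxx in mn|rewrite mulr0 mul0r].
Qed.

Lemma delta_21_0_neq0 (x y z : rat) : delta_21_0 F x y z != 0 ->
  exists n i, [/\ x = - n%:~R - 1, z = n%:~R - i%:R & y = i%:R].
Proof.
move=> nz; apply: contrapT => H; move/eqP: nz; apply; apply: fsbig1 => n _.
case: (x =P _) => [xn|]; last by rewrite mulr0 mul0r.
apply/eqP/negPn/negP; rewrite mulr1 mulf_eq0 negb_or => /andP[_].
by case/binomial_exp_neq0 => i [yi zi]; apply: H; exists n, i.
Qed.

Lemma mul_delta_12 X n (e1 e2 : rat) :
  mul_series3 (delta_12_0 F) (fun b c d => (b == 0)%:R *: X c d) (- n%:~R - 1) e1 e2 =
  \sum_(i \in [set: nat]) ((-1) ^+ i * gbinom n%:~R i) *: X (e1 - n%:~R + i%:R) (e2 - i%:R).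
Proof.
pose h i := (- n%:~R - 1 : rat, n%:~R - i%:R : rat, i%:R : rat).
rewrite /mul_series3 (@fsum_inj _ h) => [|i j /(congr1 snd)/eqP|[[x y] z] /=].
- by apply: eq_fsbigr => i _; rewrite /h /= delta_12_0E subrr eqxx scale1r opprB addrA addrAC.
- by rewrite eqr_nat => /eqP.
case: (- n%:~R - 1 - x =P 0) => [/eqP|_]; last by rewrite scale0r scaler0 eqxx.
rewrite subr_eq0 scale1r => /eqP <-; rewrite scaler_eq0 negb_or => /andP[/delta_12_0_neq0 + _].
by case=> m [i [/delta_exponent nm -> ->]]; exists i; rewrite /h nm.
Qed.

Lemma mul_delta_21 X n (e1 e2 : rat) :
  mul_series3 (delta_21_0 F) (fun b c d => (b == 0)%:R *: X c d) (- n%:~R - 1) e1 e2 =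
  \sum_(i \in [set: nat])
    ((-1) ^ n * ((-1) ^+ i * gbinom n%:~R i)) *: X (e1 - i%:R) (e2 - n%:~R + i%:R).
Proof.
pose h i := (- n%:~R - 1 : rat, i%:R : rat, n%:~R - i%:R : rat).
rewrite /mul_series3 (@fsum_inj _ h) => [|i j /(congr1 (fun t => t.1.2))/eqP|[[x y] z] /=].
- by apply: eq_fsbigr => i _; rewrite /h /= delta_21_0E subrr eqxx scale1r opprB addrA addrAC.
- by rewrite eqr_nat => /eqP.
case: (- n%:~R - 1 - x =P 0) => [/eqP|_]; last by rewrite scale0r scaler0 eqxx.
rewrite subr_eq0 scale1r => /eqP <-; rewrite scaler_eq0 negb_or => /andP[/delta_21_0_neq0 + _].
by case=> m [i [/delta_exponent nm -> ->]]; exists i; rewrite /h nm.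
Qed.

Lemma mul_delta_12_nonint X (e0 e1 e2 : rat) : (forall n, e0 <> - n%:~R - 1) ->
  mul_series3 (delta_12_0 F) (fun b c d => (b == 0)%:R *: X c d) e0 e1 e2 = 0.
Proof.
move=> e0n; apply: fsbig1 => -[[x y] z] _ /=.
case: (e0 - x =P 0) => [/eqP|_]; last by rewrite scale0r scaler0.
rewrite subr_eq0 => /eqP <-; have [->|/delta_12_0_neq0] := eqVneq (delta_12_0 F e0 y z) 0.
  by rewrite scale0r.
by case=> n [i [/e0n]].
Qed.

Lemma mul_delta_21_nonint X (e0 e1 e2 : rat) : (forall n, e0 <> - n%:~R - 1) ->
  mul_series3 (delta_21_0 F) (fun b c d => (b == 0)%:R *: X c d) e0 e1 e2 = 0.
Proof.
move=> e0n; apply: fsbig1 => -[[x y] z] _ /=.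
case: (e0 - x =P 0) => [/eqP|_]; last by rewrite scale0r scaler0.
rewrite subr_eq0 => /eqP <-; have [->|/delta_21_0_neq0] := eqVneq (delta_21_0 F e0 y z) 0.
  by rewrite scale0r.
by case=> n [i [/e0n]].
Qed.

Section IterateSide.
Variables (k : nat) (eta : F) (j : nat).
Hypotheses (k_gt0 : (0 < k)%N) (eta1 : eta ^+ k = 1).

Let k0 : (k%:R : rat) != 0. Proof. by rewrite pnatr_eq0 -lt0n. Qed.

Lemma eta_neq0 : eta != 0.
Proof. by apply/eqP => e0; move/eqP: eta1; rewrite e0 expr0n gtn_eqF // eq_sym oner_eq0. Qed.

Lemma delta_10_2_exponent n n' : (- (n%:~R / k%:R) - 1 : rat) = - (n'%:~R / k%:R) - 1 -> n = n'.
Proof. by move/addIr/oppr_inj/(mulIf (invr_neq0 k0))/intrat_inj. Qed.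

Lemma delta_10_2E n i :
  delta_10_2 k eta j i%:R (n%:~R / k%:R - i%:R) (- (n%:~R / k%:R) - 1) =
  eta ^ (j%:Z * n) * ((-1) ^+ i * gbinom (ratr (n%:~R / k%:R)) i).
Proof.
rewrite /delta_10_2 (@fsum_one _ _ n) ?eqxx ?mulr1 ?binomial_expE //.
by move=> m mn; case: eqP => [/delta_10_2_exponent nm|_]; [rewrite nm eqxx in mn|rewrite mulr0 mul0r].
Qed.

Lemma delta_10_2_neq0 (x y z : rat) : delta_10_2 k eta j x y z != 0 ->
  exists n i, [/\ z = - (n%:~R / k%:R) - 1, y = n%:~R / k%:R - i%:R & x = i%:R].
Proof.
move=> nz; apply: contrapT => H; move/eqP: nz; apply; apply: fsbig1 => n _.
case: (z =P _) => [zn|]; last by rewrite mulr0 mul0r.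
apply/eqP/negPn/negP; rewrite mulr1 mulf_eq0 negb_or => /andP[_].
by case/binomial_exp_neq0 => i [yi xi]; apply: H; exists n, i.
Qed.

Lemma mul_delta_10 X n (e0 e2 : rat) :
  mul_series3 (delta_10_2 k eta j) (fun b c d => (c == 0)%:R *: X b d) e0 (n%:~R / k%:R) e2 =
  \sum_(i \in [set: nat]) (eta ^ (j%:Z * n) * gbinom (- ratr (n%:~R / k%:R) - 1) i) *:
    X (e0 - i%:R) (n%:~R / k%:R + e2 + i%:R + 1).
Proof.
have ki i : (n + k%:Z * i%:Z)%:~R / k%:R = n%:~R / k%:R + i%:R :> rat.
  by rewrite rmorphD rmorphM /= mulrDl mulrAC divff // mul1r.
have etaki i : eta ^ (j%:Z * (n + k%:Z * i%:Z)) = eta ^ (j%:Z * n).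
  rewrite mulrDr expfzDr ?eta_neq0 //.
  have -> : j%:Z * (k%:Z * i%:Z) = (k * (j * i))%N%:Z by rewrite !PoszM; ring.
  by rewrite -exprnP exprM eta1 expr1n mulr1.
pose h i := (i%:R : rat, n%:~R / k%:R : rat, - (n%:~R / k%:R + i%:R) - 1 : rat).
have dE i : delta_10_2 k eta j (h i).1.1 (h i).1.2 (h i).2 =
    eta ^ (j%:Z * n) * gbinom (- ratr (n%:~R / k%:R) - 1) i.
  rewrite /h /= -{1}[n%:~R / k%:R](addrK (i%:R)) -ki delta_10_2E etaki ki; congr (_ * _).
  by rewrite gbinom_opp rmorphD /= ratr_nat; congr gbinom; ring.
rewrite /mul_series3 (@fsum_inj _ h) => [|i i' /(congr1 (fun t => t.1.1))/eqP|[[x y] z] /=].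
- apply: eq_fsbigr => i _; rewrite dE /h /= subrr eqxx scale1r; congr (_ *: X _ _); ring.
- by rewrite eqr_nat => /eqP.
case: (n%:~R / k%:R - y =P 0) => [/eqP|_]; last by rewrite scale0r scaler0 eqxx.
rewrite subr_eq0 scale1r => /eqP <-; rewrite scaler_eq0 negb_or => /andP[/delta_10_2_neq0 + _].
case=> m [i [-> nm ->]]; exists i; rewrite /h; congr (_, _, _).
by rewrite nm subrK.
Qed.

Lemma mul_delta_10_nonint X (e0 e1 e2 : rat) : (forall n, e1 <> n%:~R / k%:R) ->
  mul_series3 (delta_10_2 k eta j) (fun b c d => (c == 0)%:R *: X b d) e0 e1 e2 = 0.
Proof.
move=> e1n; apply: fsbig1 => -[[x y] z] _ /=.
case: (e1 - y =P 0) => [/eqP|_]; last by rewrite scale0r scaler0.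
rewrite subr_eq0 => /eqP <-; have [->|/delta_10_2_neq0] := eqVneq (delta_10_2 k eta j x e1 z) 0.
  by rewrite scale0r.
case=> n [i [_ e1i _]]; case: (e1n (n - k%:Z * i%:Z)).
by rewrite e1i rmorphB rmorphM /= mulrBl mulrAC divff // mul1r.
Qed.

End IterateSide.
End DeltaProducts.

(** * Powers of the change of variable *)

Section PowerSeries.
Variable F : numClosedFieldType.
Implicit Types (d x : F) (r : int) (p : {poly F}).

(** The power series [(1 + t)^d]. *)
Definition binf d (r : int) : F^o := if r is Posz i then gbinom d i else 0.

Lemma binf_below d : zbelow 0 (binf d).
Proof. by move=> [r|r]. Qed.

Lemma pmul_1X d r : pmul (1 + 'X) (binf d) r = binf (d + 1) r.
Proof.
rewrite pmulD pmul1 -[X in pmul X]mul1r pmulMX pmul1; case: r => [[|r]|r].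
- by have -> : Posz 0 - 1 = Negz 0 by []; rewrite /= !gbinom0 addr0.
- by rewrite -addn1 PoszD addrK -PoszD addn1 /= gbinom_pascal.
by rewrite /= addr0; case: r.
Qed.

Lemma pmul_1Xn d n r : pmul ((1 + 'X) ^+ n) (binf d) r = binf (d + n%:R) r.
Proof.
elim: n r => [|n IH] r; first by rewrite pmul1 addr0.
rewrite exprS pmulM (eq_pmul _ IH) pmul_1X; congr binf.
by rewrite -addn1 natrD addrA.
Qed.

End PowerSeries.

Section Derivative.
Variables (F : numClosedFieldType) (M : lmodType F).
Implicit Types (g : int -> M) (p : {poly F}).

Definition dseries g (i : int) : M := (i%:~R + 1) *: g (i + 1).

Lemma dseries_pmul p g i : dseries (pmul p g) i = pmul p^`() g i + pmul p (dseries g) i.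
Proof.
elim/poly_ind: p i => [|p c IH] i; first by rewrite deriv0 /dseries !pmul0 scaler0 addr0.
rewrite derivD derivM derivX derivC addr0 mulr1 !pmulD !pmulMX !pmulC /dseries.
rewrite pmulD pmulMX addrK scalerDr pmulC.
have := IH (i - 1); rewrite {1}/dseries subrK rmorphB /= subrK => Ei.
rewrite scalerDl Ei scale1r !scalerA [c * _]mulrC.
by rewrite -!addrA; congr (_ + _); rewrite addrCA.
Qed.
End Derivative.

Section CovPowers.
Variables (F : numClosedFieldType) (k : nat).
Hypothesis k_gt0 : (0 < k)%N.
Implicit Types (d x : F) (r : int).

Definition covq : {poly F} := \poly_(i < k) (cov F k)`_i.+1 - 1.

Lemma covE : cov F k = 'X * (1 + covq).
Proof.
apply/polyP => i; rewrite /covq addrC subrK coefXM coef_poly.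
case: i => [|i]; first exact: cov_coef0.
case: ltnP => //= ki; rewrite /cov coefB coefZ coefC subr0.
have -> : ((1 + 'X) ^+ k : {poly F})`_i.+1 = 0; last by rewrite mulr0.
have -> : 1 + 'X = 'X - (-1)%:P :> {poly F} by rewrite polyCN opprK addrC.
by rewrite nth_default // size_exp_XsubC.
Qed.

Lemma covq_coef0 : covq`_0 = 0.
Proof.
have : (cov F k)^`()`_0 = 1.
  rewrite (deriv_cov _ k_gt0) -horner_coef0 horner_exp !hornerE expr1n //.
by rewrite covE derivM derivX mul1r coefD coefXM addr0 coefD coef1 => /(canRL (addKr _)); rewrite addNr.
Qed.

Lemma pmul_Xn (M : lmodType F) n (g : int -> M) r : pmul 'X^n g r = g (r - n%:Z).
Proof.
elim: n r => [|n IH] r; first by rewrite pmul1 subr0.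
by rewrite exprSr pmulMX IH -addn1 PoszD opprD addrA addrAC.
Qed.

Lemma pmul_covq_below (M : lmodType F) n l (g : int -> M) :
  (forall r, r < n%:Z -> g r = 0) -> forall r, r < (n + l)%:Z -> pmul (covq ^+ l) g r = 0.
Proof.
move=> g0; elim: l => [|l IH] r rl; first by rewrite pmul1 g0 // -[n]addn0.
rewrite exprS pmulM /pmul big1 // => -[[|j] jl] _ /=; first by rewrite covq_coef0 scale0r.
by rewrite [X in _ *: X]IH ?scaler0 //; lia.
Qed.

Lemma pmul_covq_binf l d r : r < l%:Z -> pmul (covq ^+ l) (binf d) r = 0.
Proof. by move=> rl; apply: (@pmul_covq_below _ 0) => // -[]. Qed.

(** [nu d x] is the power series [(1 + t)^d (1 + covq)^x]: it makes sense for all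
    [x], its coefficients being polynomials in [x]. *)
Definition nu d x (r : int) : F^o :=
  if r is Posz s then \sum_(l < s.+1) gbinom x l *: pmul (covq ^+ l) (binf d) s else 0.

Lemma nuE L d x r : r < L%:Z -> nu d x r = \sum_(l < L) gbinom x l *: pmul (covq ^+ l) (binf d) r.
Proof.
case: r => r rL; last by rewrite /= big1 // => l _; rewrite pmul_covq_binf ?scaler0.
rewrite /nu; apply/esym/(sum_widen (f := fun l => gbinom x l *: pmul (covq ^+ l) (binf d) r)) => // l rl.
by rewrite pmul_covq_binf ?scaler0.
Qed.

Lemma nu_below d x : zbelow 0 (nu d x).
Proof. by case. Qed.

Lemma nu_r0 d x : nu d x 0 = 1.
Proof. by rewrite /nu /= big_ord1 gbinom0 scale1r pmul1 /= gbinom0. Qed.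

Lemma nu_0 d r : nu d 0 r = binf d r.
Proof.
rewrite (@nuE (absz r).+1); last by lia.
rewrite big_ord_recl gbinom0 scale1r pmul1 big1 ?addr0 // => l _.
by rewrite lift0 -[0]/(0%:R) gbinom_small // scale0r.
Qed.

Lemma nu_succ d x r : pmul (1 + covq) (nu d x) r = nu d (x + 1) r.
Proof.
set L := (absz r).+1; have rL : r < L%:Z by rewrite /L; lia.
pose T l s := pmul (covq ^+ l) (binf d) s.
have E s : s <= r -> nu d x s = \sum_(l < L) gbinom x l *: T l s.
  by move=> sr; apply: nuE; apply: le_lt_trans rL.
have -> : pmul (1 + covq) (nu d x) r =
    pmul (1 + covq) (fun s => \sum_(l < L) gbinom x l *: T l s) r.
  by apply: eq_bigr => j _; rewrite E // lerBlDr lerDl.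
have rL1 : r < L.+1%:Z by apply: lt_trans rL _; rewrite ltz_nat.
rewrite pmulf_sum (nuE _ _ rL1).
rewrite (eq_bigr (fun l : 'I_L => gbinom x l *: T l r + gbinom x l *: T l.+1 r)); last first.
  by move=> l _; rewrite pmulfZ pmulD pmul1 -pmulM -exprS scalerDr.
rewrite big_split /=.
have -> : \sum_(l < L) gbinom x l *: T l r = \sum_(l < L.+1) gbinom x l *: T l r.
  by rewrite [RHS]big_ord_recr /= [T _ r in RHS](pmul_covq_binf _ rL) scaler0 addr0.
rewrite [RHS]big_ord_recl big_ord_recl -addrA -big_split !gbinom0; congr (_ + _).
by apply: eq_bigr => l _; rewrite lift0 gbinom_pascal scalerDl.
Qed.

Lemma nu_shift N d x r : pmul ((1 + covq) ^+ N) (nu d x) r = nu d (x + N%:R) r.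
Proof.
elim: N r => [|N IH] r; first by rewrite pmul1 addr0.
by rewrite exprS pmulM (eq_pmul _ IH) nu_succ -addrA natr1.
Qed.

Lemma nu_nat d N r : nu d N%:R r = pmul (cov F k ^+ N) (binf d) (r + N%:Z).
Proof.
rewrite covE exprMn pmulM pmul_Xn addrK -[N%:R]add0r -nu_shift.
by apply: eq_pmul => s; rewrite nu_0.
Qed.

(** The coefficients of [d/dt ((1 + t)^d f^N)] where [f' = (1 + t)^(k - 1)]. *)
Lemma nu_deriv d N r : (N%:R + r%:~R) *: nu d N%:R r =
  N%:R *: nu (d + k.-1%:R) (N%:R - 1) r + d *: nu (d - 1) N%:R (r - 1).
Proof.
have dbinf (s : int) : dseries (binf d) s = d *: binf (d - 1) s.
  rewrite /dseries; case: s => [s|[|s]] /=.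
  - by rewrite addn1; have := gbinom_deriv d s; rewrite -natr1.
  - by rewrite rmorphN1 addNr scale0r scaler0.
  by rewrite !scaler0.
have := dseries_pmul (cov F k ^+ N) (binf d) (r + N%:Z - 1).
rewrite {1}/dseries subrK -nu_nat (eq_pmul _ dbinf) pmulfZ.
have -> : r + N%:Z - 1 = (r - 1) + N%:Z by ring.
rewrite -nu_nat => H.
have -> : N%:R + r%:~R = (r - 1 + N%:Z)%:~R + 1 :> F by rewrite !rmorphD rmorphN /=; ring.
rewrite H; congr (_ + _); rewrite deriv_exp (deriv_cov _ k_gt0).
case: N {H} => [|N]; first by rewrite mulr0n pmul0 scale0r.
have -> : N.+1%:R - 1 = N%:R :> F by rewrite -natr1 addrK.
rewrite nu_nat -mulr_natl -polyC_natr pmulM pmulC; congr (_ *: _).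
rewrite /= mulrC pmulM (eq_pmul _ (pmul_1Xn _ _)); congr pmul.
by rewrite -addn1 PoszD; ring.
Qed.

End CovPowers.

Arguments nu : simpl never.

(** * Graded decompositions *)

Section Decompositions.
Variables (F : numClosedFieldType) (V : lmodType F).

Lemma subspace_sum (A : set V) (T : Type) (r : seq T) (f : T -> V) : subspace A ->
  (forall i, A (f i)) -> A (\sum_(i <- r) f i).
Proof.
move=> [A0 Al] Af; elim/big_rec: _ => // i x _ Ax.
by rewrite -[f i]scale1r; apply: Al.
Qed.

Lemma subspaceZ (A : set V) c x : subspace A -> A x -> A (c *: x).
Proof. by move=> [A0 Al] Ax; rewrite -[_ *: _]addr0; apply: Al. Qed.

Lemma subspaceD (A : set V) x y : subspace A -> A x -> A y -> A (x + y).
Proof. by move=> [A0 Al] Ax Ay; rewrite -[x]scale1r; apply: Al. Qed.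

Variables (I : choiceType) (S : I -> set V).
Hypothesis S_sum : direct_sum S.

Lemma decomposition_seq v c : decomposition S v c ->
  exists s : seq I, [/\ uniq s, forall i, i \notin s -> c i = 0 & v = \sum_(i <- s) c i].
Proof.
case=> _ /finite_seqP[s sE] vE.
have c0 i : i \notin undup s -> c i = 0.
  rewrite mem_undup => ni; apply/eqP/negPn/negP => ci.
  have : [set` s]%classic i by rewrite -sE.
  by rewrite /= (negbTE ni).
exists (undup s); split=> //; first exact: undup_uniq.
by rewrite vE; apply: fsum_seq => //; apply: undup_uniq.
Qed.

Lemma decompositionI v c (s : seq I) : (forall i, S i (c i)) -> uniq s ->
  (forall i, i \notin s -> c i = 0) -> v = \sum_(i <- s) c i -> decomposition S v c.
Proof.
move=> Sc us c0 vE; split=> //; last by rewrite (fsum_seq us c0).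
apply: (sub_finite_set _ (finite_seq s)) => i /= ci.
by apply: contraNT ci => /c0 ->.
Qed.

Lemma decomposition_uniq v c c' : decomposition S v c -> decomposition S v c' -> c = c'.
Proof. by move=> d d'; case: (S_sum.2 v) => x [_ U]; rewrite -(U _ d) -(U _ d'). Qed.

Lemma decomposition_lin a u v c c' : decomposition S u c -> decomposition S v c' ->
  decomposition S (a *: u + v) (fun i => a *: c i + c' i).
Proof.
move=> d d'; have [s [us c0 uE]] := decomposition_seq d.
have [s' [us' c0' vE]] := decomposition_seq d'.
have uU : uniq (undup (s ++ s')) by apply: undup_uniq.
have cU i : i \notin undup (s ++ s') -> c i = 0 /\ c' i = 0.
  by rewrite mem_undup mem_cat negb_or => /andP[/c0 -> /c0' ->].
apply: (decompositionI (s := undup (s ++ s'))) => //.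
- move=> i; case: d => Sc _ _; case: d' => Sc' _ _; case: (S_sum.1 i) => _; exact.
- by move=> i /cU[-> ->]; rewrite scaler0 addr0.
rewrite big_split -scaler_sumr; congr (_ *: _ + _).
  by case: d => _ _ ->; apply: fsum_seq => // i /cU[].
by case: d' => _ _ ->; apply: fsum_seq => // i /cU[].
Qed.

Lemma componentP v : decomposition S v (component S v).
Proof. by rewrite /component; apply: xgetPex; case: (S_sum.2 v) => c [cP _]; exists c. Qed.

Lemma componentE v c : decomposition S v c -> component S v = c.
Proof. exact/decomposition_uniq/componentP. Qed.

Lemma component_in v i : S i (component S v i).
Proof. by case: (componentP v). Qed.

Lemma component_linear i : linear (fun v => component S v i).
Proof.
move=> a u v.
by rewrite (componentE (decomposition_lin a (componentP u) (componentP v))).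
Qed.

Lemma component_single v i j : S i v -> component S v j = if j == i then v else 0.
Proof.
move=> Sv; rewrite (@componentE v (fun j => if j == i then v else 0)) //.
apply: (decompositionI (s := [:: i])) => //.
- by move=> l; case: eqP => [->|_] //; case: (S_sum.1 l).
- by move=> l; rewrite inE => /negbTE ->.
by rewrite big_seq1 eqxx.
Qed.

End Decompositions.

(** * Vertex operator superalgebras *)

Section VertexSuperalgebra.
Variables (F : numClosedFieldType) (V : vertex_superalgebra F).

Lemma parity_dec (u : V) : exists u0 u1 : V,
  [/\ parity false u0, parity true u1 & u = u0 + u1].
Proof.
have [s [us c0 uE]] := decomposition_seq (componentP (@parity_direct_sum F V) u).
exists (component (@parity F V) u false), (component (@parity F V) u true).
split; try exact: (component_in (@parity_direct_sum F V)).
have [_ _ {1}->] := componentP (@parity_direct_sum F V) u.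
rewrite (@fsum_seq _ _ [:: false; true]) //; last by case.
by rewrite big_cons big_seq1.
Qed.

Lemma Y0l (v : V) e : Y (0 : V) v e = 0.
Proof. exact: (lin0 (Y_linearl v e)). Qed.

Lemma Y0r (v : V) e : Y v (0 : V) e = 0.
Proof. exact: (lin0 (Y_linearr v e)). Qed.

End VertexSuperalgebra.

Section Voa.
Variables (F : numClosedFieldType) (V : vertex_operator_superalgebra F).
Local Notation Lop := (@Lop F V).

Lemma Lop_linear n : linear (Lop n).
Proof. exact: L_linear. Qed.

Lemma parity_omega : parity false (omega V).
Proof.
rewrite parity_weight; exists (component (@weight_space F V) (omega V)).
split; first exact: (componentP (@weight_direct_sum F V)).
move=> m nm; rewrite (component_single (@weight_direct_sum F V) _ (omega_weight V)).
by case: eqP => // m4; case: nm; rewrite m4.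
Qed.

(** The residue in [x_0] of the Jacobi identity of [omega] and [v]; [omega] being
    even, there is no sign. *)
Lemma Lop_comm n (v w : V) e : Lop n (Y v w e) - Y v (Lop n w) e =
  \sum_(i < n.+1) 'C(n, i)%:R *: Y (Lop i v) w (e - n%:R + i%:R).
Proof.
have [v0 [v1 [pv0 pv1 ->]]] := parity_dec v.
suff H q x : parity q x -> Lop n (Y x w e) - Y x (Lop n w) e =
    \sum_(i < n.+1) 'C(n, i)%:R *: Y (Lop i x) w (e - n%:R + i%:R).
  rewrite (linD (Y_linearl w e)) (linD (Lop_linear _)) (linD (Y_linearl _ e)).
  rewrite opprD addrACA (H _ _ pv0) (H _ _ pv1) -big_split; apply: eq_bigr => i _.
  by rewrite /= (linD (Lop_linear _)) (linD (Y_linearl _ _)) scalerDr.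
move=> qx; have := Y_jacobi w parity_omega qx (- 0%:~R - 1) ((- n.+1%:Z)%:~R / 1%:R) e.
rewrite mul_delta_12 mul_delta_21 big_ord1 (@mul_delta_10 _ _ 1 1 0) ?expr1n //=.
have z0 i : i != 0%N -> gbinom (0%:~R : F) i = 0.
  by case: i => // i _; rewrite -[0%:~R]/(0%:R) gbinom_small.
rewrite (@fsum_one _ _ 0%N) => [|i /z0 ->]; last by rewrite mulr0 scale0r.
rewrite (@fsum_one _ _ 0%N) => [|i /z0 ->]; last by rewrite !mulr0 scale0r.
rewrite gbinom0 expr0 expr0z !mulr1 !scale1r !subr0 invr1 scale1r.
have -> : (- n.+1%:Z)%:~R = - (n%:Z - 1)%:~R - 2 :> rat.
  by rewrite rmorphB rmorphN /= -natr1; ring.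
rewrite /Lop /L /virasoro_mode => ->.
have ratn : - ratr (- (n%:Z - 1)%:~R - 2) - 1 = n%:R :> F.
  by rewrite rmorphB rmorphN /= !ratr_int rmorphB /= ratr_nat; ring.
rewrite ratn (@fsum_nat _ n.+1); last first.
  by move=> i ni; rewrite gbinom_small // mulr0 scale0r.
apply: eq_bigr => i _; rewrite exp1rz mul1r gbinom_nat.
congr (_ *: Y (Y _ _ _) _ _); rewrite rmorphB /=; ring.
Qed.

Lemma Lop_vac n : Lop n (vac V) = 0.
Proof.
rewrite /Lop /L /virasoro_mode Y_creation // rmorphB /=.
have -> : - (n%:~R - 1) - 2 = - (n%:R + 1) :> rat by ring.
by rewrite oppr_lt0 ltr_wpDl.
Qed.

Lemma Y_Lop0 (u v : V) e : Y (Lop 0 u) v e = ratr (e + 1) *: Y u v (e + 1).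
Proof. by rewrite /Lop /L sub0r L_minus1_derivative. Qed.

Lemma Lop_1 v : Lop 1 v = virasoro_mode (omega V) 0 v.
Proof. by rewrite /Lop /L subrr. Qed.

Lemma weight_eigen (mu : int) (v : V) : weight_space mu v -> Lop 1 v = (mu%:~R / 2%:R) *: v.
Proof. by rewrite Lop_1; apply: L0_weight. Qed.

Let two0 : (2%:R : F) != 0. Proof. by rewrite pnatr_eq0. Qed.

(** The eigenvalues of [L(0)] on distinct weight spaces are distinct. *)
Lemma eigen_weight (mu : int) (v : V) : Lop 1 v = (mu%:~R / 2%:R) *: v -> weight_space mu v.
Proof.
move=> vE; have W := @weight_direct_sum F V; have d := componentP W v.
set c := component (@weight_space F V) v in d *.
have [s [us c0 vs]] := decomposition_seq d; have [Sc _ _] := d.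
have d1 : decomposition (@weight_space F V) (Lop 1 v) (fun i => (i%:~R / 2%:R) *: c i).
  apply: (decompositionI (s := s)) => //.
  - by move=> i; apply: subspaceZ (Sc i); case: W.
  - by move=> i /c0 ->; rewrite scaler0.
  by rewrite {1}vs (lin_sum (Lop_linear 1)); apply: eq_bigr => i _; apply: weight_eigen.
have d2 : decomposition (@weight_space F V) (Lop 1 v) (fun i => (mu%:~R / 2%:R) *: c i).
  apply: (decompositionI (s := s)) => //.
  - by move=> i; apply: subspaceZ (Sc i); case: W.
  - by move=> i /c0 ->; rewrite scaler0.
  by rewrite vE {1}vs scaler_sumr.
have ci i : i != mu -> c i = 0.
  move=> imu; have := congr1 (fun f => f i) (decomposition_uniq W d1 d2) => /eqP.
  rewrite /= -subr_eq0 -scalerBl scaler_eq0 -mulrBl mulf_eq0 invr_eq0 (negbTE two0) orbF.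
  by rewrite -rmorphB intr_eq0 subr_eq0 (negbTE imu) => /eqP.
have -> : v = c mu; last exact: Sc.
by case: d => _ _ {1}->; rewrite (@fsum_one _ _ mu).
Qed.

Lemma weight_Lop n (mu : int) (v : V) : weight_space mu v ->
  weight_space (mu + 2 - n%:Z *+ 2) (Lop n v).
Proof.
move=> wv; apply: eigen_weight.
have := (@witt_Lop F V).2 1%N n v isT; rewrite add1n /= (weight_eigen wv).
rewrite (linZ (Lop_linear n)) => /eqP; rewrite subr_eq => /eqP ->.
rewrite -scalerDl; congr (_ *: _); rewrite rmorphB rmorphD rmorphMn /=.
by field.
Qed.

Lemma weight_Y (m1 m2 : int) (u v : V) (e : int) : weight_space m1 u -> weight_space m2 v ->
  weight_space (m1 + m2 + e *+ 2) (Y u v e%:~R).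
Proof.
move=> wu wv; apply: eigen_weight.
have := Lop_comm 1 u v e%:~R; rewrite (weight_eigen wv) (linZ (Y_linearr u _)).
rewrite !big_ord_recl big_ord0 addr0 /= bin0 bin1 !scale1r addr0 subrK Y_Lop0 subrK.
rewrite (weight_eigen wu) (linZ (Y_linearl v _)) ratr_int => /eqP; rewrite subr_eq => /eqP ->.
rewrite -!scalerDl; congr (_ *: _); rewrite !rmorphD /=.
by field.
Qed.

Lemma weight_parity (m : int) (v : V) : weight_space m v -> parity (odd `|m|%N) v.
Proof.
move=> wv; rewrite parity_weight; exists (component (@weight_space F V) v).
split; first exact: (componentP (@weight_direct_sum F V)).
move=> i ni; rewrite (component_single (@weight_direct_sum F V) _ wv).
by case: eqP => // im; case: ni; rewrite im.
Qed.

Lemma parity_weight_sum p (v : V) : parity p v -> exists (s : seq int) (c : int -> V),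
  [/\ forall m, weight_space m (c m), forall m, odd `|m|%N <> p -> c m = 0
    & v = \sum_(m <- s) c m].
Proof.
rewrite parity_weight => -[c [d cp]]; have [s [_ _ vE]] := decomposition_seq d.
by exists s, c; split=> //; case: d.
Qed.

End Voa.

(** * Fields and the conjugation formula *)

Section Fields.
Variables (F : numClosedFieldType) (V : vertex_operator_superalgebra F).
Local Notation Lop := (@Lop F V).
Implicit Types (phi psi : V -> int -> V) (u v : V).

(** Finite sums of the [x^j Y(c_j, x)]: a class of fields closed under the
    commutators with the [L(n)] and under [x d/dx], and whose members are
    nevertheless determined by their action on the vacuum. *)
Definition is_field phi : Prop := exists J (c : nat -> V),
  (forall j, (J <= j)%N -> c j = 0) /\
  forall v n, phi v n = \sum_(j < J) Y (c j) v (n - j%:Z)%:~R.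

Lemma is_field_ext phi psi : (forall v n, phi v n = psi v n) -> is_field psi -> is_field phi.
Proof. by move=> e [J [c [c0 pE]]]; exists J, c; split=> // v n; rewrite e. Qed.

Lemma is_field_Y u j : is_field (fun v n => Y u v (n - j%:Z)%:~R).
Proof.
exists j.+1, (fun i => if i == j then u else 0); split=> [i ji|v n].
  by rewrite gtn_eqF.
rewrite big_ord_recr /= eqxx big1 ?add0r // => i _.
by rewrite ltn_eqF // Y0l.
Qed.

Lemma is_field0 : is_field (fun _ _ => 0).
Proof. by exists 0%N, (fun=> 0); split=> // v n; rewrite big_ord0. Qed.

Lemma is_field_lin b phi psi : is_field phi -> is_field psi ->
  is_field (fun v n => b *: phi v n + psi v n).
Proof.
move=> [J [c [c0 pE]]] [J' [c' [c0' pE']]].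
exists (maxn J J'), (fun j => b *: c j + c' j); split=> [j|v n].
  by rewrite geq_max => /andP[/c0 -> /c0' ->]; rewrite scaler0 addr0.
have -> : phi v n = \sum_(j < maxn J J') Y (c j) v (n - j%:Z)%:~R.
  rewrite pE; apply/esym/(sum_widen (f := fun j => Y (c j) v (n - j%:Z)%:~R)) => [|j Jj].
    exact: leq_maxl.
  by rewrite c0 // Y0l.
have -> : psi v n = \sum_(j < maxn J J') Y (c' j) v (n - j%:Z)%:~R.
  rewrite pE'; apply/esym/(sum_widen (f := fun j => Y (c' j) v (n - j%:Z)%:~R)) => [|j Jj].
    exact: leq_maxr.
  by rewrite c0' // Y0l.
by rewrite scaler_sumr -big_split; apply: eq_bigr => j _; rewrite Y_linearl.
Qed.

Lemma is_fieldZ b phi : is_field phi -> is_field (fun v n => b *: phi v n).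
Proof.
move=> h; apply: is_field_ext (is_field_lin b h is_field0) => v n; by rewrite addr0.
Qed.

Lemma is_field_sum (T : Type) (r : seq T) (f : T -> V -> int -> V) :
  (forall i, is_field (f i)) -> is_field (fun v n => \sum_(i <- r) f i v n).
Proof.
move=> fi; elim: r => [|i r IH].
  by apply: is_field_ext is_field0 => v n; rewrite big_nil.
apply: is_field_ext (is_field_lin 1 (fi i) IH) => v n.
by rewrite big_cons scale1r.
Qed.

(** The fields [x^j Y(u, x)] span all fields. *)
Lemma is_field_map (H : (V -> int -> V) -> V -> int -> V) phi :
  (forall J (f : 'I_J -> V -> int -> V) v n,
     H (fun v n => \sum_(j < J) f j v n) v n = \sum_(j < J) H (f j) v n) ->
  (forall phi psi, (forall v n, phi v n = psi v n) -> forall v n, H phi v n = H psi v n) ->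
  (forall u j, is_field (H (fun v n => Y u v (n - j%:Z)%:~R))) ->
  is_field phi -> is_field (H phi).
Proof.
move=> HS He HY [J [c [_ pE]]].
apply: is_field_ext (fun v n => \sum_(j < J) H (fun v n => Y (c j) v (n - j%:Z)%:~R) v n) _ _.
  by move=> v n; rewrite -HS; apply: He => {}v {}n; exact: pE.
by apply: is_field_sum => j; apply: HY.
Qed.

Lemma is_field_mulX phi : is_field phi -> is_field (fun v n => (n%:~R : F) *: phi v n).
Proof.
apply: (is_field_map (H := fun phi v n => (n%:~R : F) *: phi v n)).
- by move=> J f v n; rewrite scaler_sumr.
- by move=> f g fg v n; rewrite fg.
move=> u j.
apply: is_field_ext (is_field_lin j%:R (is_field_Y u j) (is_field_Y (Lop 0%N u) j.+1)) => v n.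
rewrite Y_Lop0; have -> : (n - j.+1%:Z)%:~R + 1 = (n - j%:Z)%:~R :> rat.
  by rewrite -addn1 PoszD !rmorphB rmorphD /=; ring.
by rewrite ratr_int -scalerDl; congr (_ *: _); rewrite rmorphB /= addrC subrK.
Qed.

Lemma is_field_mulp (p : {poly F}) phi : is_field phi ->
  is_field (fun v n => p.[n%:~R] *: phi v n).
Proof.
elim/poly_ind: p phi => [|p c IH] phi h.
  by apply: is_field_ext is_field0 => v n; rewrite horner0 scale0r.
apply: is_field_ext (is_field_lin c h (IH _ (is_field_mulX h))) => v n.
by rewrite hornerMXaddC scalerDl scalerA addrC.
Qed.

Lemma is_field_ad m phi : is_field phi ->
  is_field (fun v n => Lop m (phi v n) - phi (Lop m v) n).
Proof.
apply: (is_field_map (H := fun phi v n => Lop m (phi v n) - phi (Lop m v) n)).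
- by move=> J f v n; rewrite (lin_sum (Lop_linear _)) -sumrB.
- by move=> f g fg v n; rewrite !fg.
move=> u j.
pose f (i : 'I_m.+1) v n := 'C(m, i)%:R *: Y (Lop i u) v (n - (j + m - i)%N%:Z)%:~R.
apply: is_field_ext (@is_field_sum _ (index_enum _) f _) => [v n|i]; last first.
  by apply: is_fieldZ; apply: is_field_Y.
rewrite Lop_comm; apply: eq_bigr => i _; congr (_ *: Y _ _ _).
have im : (i <= j + m)%N by have := ltn_ord i; lia.
by rewrite -subzn // PoszD !rmorphB !rmorphD /=; ring.
Qed.

(** By the creation property, the coefficients of [sum_j x^j Y(c_j, x) 1]
    successively give [c_0], [c_1], and so on. *)
Lemma is_field_eq0 phi : is_field phi -> (forall n, phi (vac V) n = 0) ->
  forall v n, phi v n = 0.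
Proof.
case=> J [c [_ pE]] p0.
have c0 j : (j < J)%N -> c j = 0.
  elim/ltn_ind: j => j IH jJ; have := p0 j%:Z.
  rewrite pE (bigD1 (Ordinal jJ)) //= subrr Y_creation0 big1 ?addr0 // => i ij.
  have [lt|gt|eq] := ltngtP i j; first by rewrite IH ?Y0l.
    rewrite Y_creation // rmorphB /= subr_lt0 ltr_nat //.
  by case/eqP: ij; apply: val_inj.
by move=> v n; rewrite pE big1 // => j _; rewrite c0 // Y0l.
Qed.

Lemma is_field_eq phi psi : is_field phi -> is_field psi ->
  (forall n, phi (vac V) n = psi (vac V) n) -> forall v n, phi v n = psi v n.
Proof.
move=> h h' e v n; apply/eqP; rewrite -subr_eq0 addrC -scaleN1r; apply/eqP.
apply: (is_field_eq0 (is_field_lin (-1) h' h)) => m.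
by rewrite e scaleN1r addNr.
Qed.

End Fields.

Section ExponentialWeights.
Variables (F : numClosedFieldType) (V : vertex_operator_superalgebra F) (a : nat -> F).
Local Notation Lop := (@Lop F V).
Local Notation E := (@E F V a).
Local Notation A := (opA a Lop).
Implicit Types (u v : V) (s : nat) (mu : int).

Let Wl : witt_rep Lop := @witt_Lop F V.

Lemma E_0 u : E 0 u = u. Proof. exact: opE0. Qed.

Lemma E_vac s : E s (vac V) = delta0 (vac V) s.
Proof. by apply: (opE_fix _ Wl) => j _; apply: Lop_vac. Qed.

Lemma weight_subspace mu : subspace (@weight_space F V mu).
Proof. exact: (@weight_direct_sum F V).1. Qed.

Lemma weight_E mu u s : weight_space mu u -> weight_space (mu - s%:Z *+ 2) (E s u).
Proof.
move=> wu.
have it n r : weight_space (mu - r%:Z *+ 2) (iter n (conv A) (delta0 u) r).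
  elim: n r => [|n IH] r.
    case: r => [|r] /=; first by rewrite mul0rn subr0.
    by case: (weight_subspace (mu - r.+1%:Z *+ 2)).
  rewrite iterS {1}/conv; apply: (subspace_sum _ (weight_subspace _)) => j.
  rewrite /opA -scaleN1r scalerA; apply: (subspaceZ _ (weight_subspace _)).
  have := weight_Lop j.+1 (IH (r - j)%N).
  have e (i : nat) : (i <= r)%N ->
      mu - (r - i)%N%:Z *+ 2 + 2 - i.+1%:Z *+ 2 = mu - r%:Z *+ 2.
    by move=> ir; rewrite !mulr2n; lia.
  by rewrite e // -ltnS.
by rewrite /E /opE /exps; apply: (subspace_sum _ (weight_subspace _)) => n; apply: (subspaceZ _ (weight_subspace _)).
Qed.

(** [E s] lowers weights by [s], and weights are bounded below. *)
Lemma E_vanish mu u : weight_space mu u -> exists S, forall s, (S <= s)%N -> E s u = 0.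
Proof.
move=> wu; have [N wN] := weight_lower_bound V.
exists (absz (mu - N)).+1 => s Ss; apply: (wN _ _ _ (weight_E s wu)).
rewrite mulr2n; lia.
Qed.

End ExponentialWeights.

Section Conjugation.
Variables (F : numClosedFieldType) (V : vertex_operator_superalgebra F).
Variables (k : nat) (a : nat -> F).
Hypothesis k_gt0 : (0 < k)%N.
Hypothesis exp_linear_field : exps (ad_field a) (linear_field 1) =1 linear_field (k%:R : F).
Local Notation Lop := (@Lop F V).
Local Notation E := (@E F V a).
Local Notation A := (opA a Lop).
Implicit Types (u v : V) (s : nat) (mu : int).

Let Wl : witt_rep Lop := @witt_Lop F V.
Let A_linear := opA_linear a Wl.
Let A_0 x : A 0%N x = 0. Proof. exact: opA0. Qed.

(** [D(y) u = sum_s y^(d_s) E_s u], up to constants, for [u] of weight [mu/2]. *)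
Definition dexp mu s : F := (k%:R - 1) * (mu%:~R / 2%:R) - k%:R * s%:R.

(** [opE_intertwine] on weight vectors, where [L(0)] acts by scalars. *)
Lemma E_Lop0 mu u s : weight_space mu u -> E s (Lop 0 u) =
  Lop 0 (E s u) + (if s is r.+1 then dexp mu r *: E r u else 0).
Proof.
move=> wu; case: s => [|s]; first by rewrite !E_0 addr0.
have := opE_intertwine s u Wl exp_linear_field.
rewrite -!/(E _ _) (weight_eigen wu) (linZ (E_linear a s)) (weight_eigen (weight_E a s wu)).
move/(canRL (addrK _)) => ->; rewrite -addrA; congr (_ + _).
rewrite scalerA -scalerBl; congr (_ *: _); rewrite /dexp mulr2n !rmorphD rmorphN rmorphD /=.
have two0 : (2%:R : F) != 0 by rewrite pnatr_eq0.
by field.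
Qed.

Let T u (n : int) : V := Y u (vac V) n%:~R.

Lemma T_Lop0 u n : T (Lop 0 u) n = (n%:~R + 1) *: T u (n + 1).
Proof.
rewrite /T Y_Lop0; have -> : n%:~R + 1 = (n + 1)%:~R :> rat by rewrite rmorphD.
by rewrite ratr_int; congr (_ *: _); rewrite rmorphD.
Qed.

Lemma T_neg u n : n < 0 -> T u n = 0.
Proof. by move=> n0; rewrite /T Y_creation // ltrz0. Qed.

Local Notation nu := (@nu F k).

(** The formula [E(y) e^(z L(-1)) = e^(phi L(-1)) Theta(y, z)], on coefficients,
    by induction on the power of [z]. *)
Lemma E_translation (n : nat) mu u s : weight_space mu u ->
  E s (T u n) = \sum_(r < s.+1)
    (nu (dexp mu r) (n%:Z - (s - r)%N%:Z)%:~R (s - r)%N : F) *: T (E r u) (n%:Z - (s - r)%N%:Z).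
Proof.
elim: n mu u s => [|n IH] mu u s wu.
  rewrite big_ord_recr /= subnn subr0 [nu _ _ _]nu_r0 scale1r /T !Y_creation0 big1 ?add0r // => r _.
  by rewrite -/(T _ _) T_neg ?scaler0 //; have := ltn_ord r; lia.
apply: (@scalerI _ _ (n.+1%:R : F)); first by rewrite pnatr_eq0.
rewrite -(linZ (E_linear a s)).
(* [T u (n + 1)] is [T (L(-1) u) n / (n + 1)], to which the induction hypothesis applies *)
have -> : n.+1%:R *: T u n.+1 = T (Lop 0 u) n by rewrite T_Lop0 -natr1 -PoszD addn1.
rewrite (IH (mu + 2)); last by have := weight_Lop 0 wu; rewrite mul0rn subr0.
pose m (r : nat) : int := n%:Z - (s - r)%N%:Z; pose c r : F := (m r)%:~R + 1.
have two0 : (2%:R : F) != 0 by rewrite pnatr_eq0.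
have dS r : dexp (mu + 2) r = dexp mu r + k.-1%:R.
  by rewrite /dexp rmorphD /= -subn1 natrB //; field.
have dS' r : dexp mu r.+1 + k.-1%:R = dexp mu r - 1.
  by rewrite /dexp -subn1 natrB // -natr1; field.
pose f r : V := ((nu (dexp mu r + k.-1%:R) (m r)%:~R (s - r)%N : F) * c r) *: T (E r u) (m r + 1).
pose g r : V := ((nu (dexp mu r - 1) (c r) ((s - r)%N%:Z - 1) : F) * dexp mu r) *: T (E r u) (m r + 1).
pose g' r : V := if r is q.+1 then g q else 0.
transitivity (\sum_(r < s.+1) (f r + g' r)).
  apply: eq_bigr => r _; rewrite dS (E_Lop0 _ wu) -/(m r).
  rewrite {1}/T (linD (Y_linearl _ _)) -!/(T _ _) T_Lop0 scalerDr /f scalerA; congr (_ + _).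
  case: r => [[|r] rs] /=; first by rewrite /T Y0l scaler0.
  rewrite {1}/T (linZ (Y_linearl _ _)) -/(T _ _) scalerA dS' /g /c.
  have -> : m r.+1 = m r + 1 by rewrite /m; lia.
  have -> : (s - r.+1)%N%:Z = (s - r)%N%:Z - 1 by lia.
  by rewrite rmorphD.
have -> : \sum_(r < s.+1) (f r + g' r) = \sum_(r < s.+1) (f r + g r).
  rewrite !big_split /=; congr (_ + _); rewrite big_ord_recl /= add0r [RHS]big_ord_recr /=.
  by rewrite [g s]/g subnn nu_below // mul0r scale0r addr0.
rewrite scaler_sumr; apply: eq_bigr => r _.
have -> : n.+1%:Z - (s - r)%N%:Z = m r + 1 by rewrite /m -addn1 PoszD; ring.
have [mN|/T_neg T0] := leP 0 (m r + 1); last by rewrite /f /g T0 !scaler0 addr0.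
have [N mE] : exists N : nat, m r + 1 = N%:Z by exists (absz (m r + 1)); rewrite gez0_abs.
have cN : c r = N%:R by rewrite /c -[1]/(1%:~R) -rmorphD mE.
have mN1 : (m r)%:~R = N%:R - 1 :> F by rewrite -cN /c addrK.
have nN : n.+1%:R = N%:R + ((s - r)%N%:Z)%:~R :> F.
  by rewrite -cN /c /m rmorphB /= -natr1; ring.
rewrite /f /g -scalerDl scalerA; congr (_ *: _).
rewrite nN mE cN mN1 [_ * N%:R]mulrC [_ * dexp mu r]mulrC.
exact: (esym (nu_deriv k_gt0 (dexp mu r) N (s - r)%N%:Z)).
Qed.

(** [E(y) Y(u, z) E(y)^-1], as a field. *)
Definition conj_field mu u s (v : V) (n : int) : V := \sum_(r < s.+1)
  (nu (dexp mu r) (n - (s - r)%N%:Z)%:~R (s - r)%N : F) *: Y (E r u) v (n - (s - r)%N%:Z)%:~R.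

Lemma is_field_conj mu u s : is_field (conj_field mu u s).
Proof.
pose p d q : {poly F} :=
  \sum_(l < q.+1) (pmul (covq F k ^+ l) (binf d) q : F) *: (binomp F l \Po ('X - q%:R%:P)).
have pE d q (n : int) : (p d q).[n%:~R] = nu d (n - q%:Z)%:~R q.
  rewrite /p horner_sum; apply: eq_bigr => l _.
  by rewrite hornerZ horner_comp hornerXsubC binompE rmorphB mulrC.
pose f r v n := (p (dexp mu r) (s - r)%N).[n%:~R] *: Y (E r u) v (n - (s - r)%N%:Z)%:~R.
apply: is_field_ext (@is_field_sum _ _ _ (index_enum _) (fun r : 'I_s.+1 => f r) _) => [v n|r].
  by apply: eq_bigr => r _; rewrite /f pE.
by apply: is_field_mulp; apply: is_field_Y.
Qed.

Let A' (j : nat) (zeta : int -> V) : int -> V := fun n => A j (zeta n).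

Let A'_linear j : linear (A' j).
Proof. by move=> c f g; apply/funext => n; rewrite /A' A_linear. Qed.

Let A'_0 zeta : A' 0%N zeta = 0.
Proof. by apply/funext => n; rewrite /A' A_0. Qed.

Let Yf u : nat -> V -> (int -> V) := delta0 (fun v n => Y u v n%:~R).

Let Yf_linear u s : linear (Yf u s).
Proof.
case: s => [|s] c v w; last by rewrite /= scaler0 addr0.
by apply/funext => n; rewrite /= Y_linearr.
Qed.

Let exp_ad u s : V -> (int -> V) := exps (X := V -> int -> V) (adj A A') (Yf u) s.

Lemma is_field_exp_ad u s : is_field (exp_ad u s).
Proof.
have it n r : is_field (iter n (adj A A') (Yf u) r).
  elim: n r => [|n IH] r.
    case: r => [|r]; last exact: is_field0.
    by apply: is_field_ext (is_field_Y u 0) => v m; rewrite /= subr0.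
  pose f (j : 'I_r.+1) v m := - coef_a a j *:
     (Lop j.+1 (iter n (adj A A') (Yf u) (r - j)%N v m) - iter n (adj A A') (Yf u) (r - j)%N (Lop j.+1 v) m).
  apply: is_field_ext (@is_field_sum _ _ _ (index_enum _) f _) => [v m|j]; last first.
    by apply: is_fieldZ; apply: is_field_ad.
  have L := iter_adj_linear A_linear A'_linear n (Yf_linear u).
  rewrite iterS /f; move: (iter n (adj A A') (Yf u)) L => X L.
  rewrite /adj fct_sumE; apply: eq_bigr => j _.
  transitivity (A j (X (r - j)%N v m) - X (r - j)%N (A j v) m) => //.
  rewrite /opA (linN (L _)) (linZ (L _)) scalerBr !scaleNr.
  by [].
rewrite /exp_ad /exps.
pose f (n : 'I_s.+1) v m := (n`!%:R : F)^-1 *: iter n (adj A A') (Yf u) s v m.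
apply: is_field_ext (@is_field_sum _ _ _ (index_enum _) f _) => [v m|j]; last first.
  by apply: is_fieldZ.
by rewrite !fct_sumE.
Qed.

Lemma exp_ad_Y u v s n : E s (Y u v n%:~R) = \sum_(j < s.+1) exp_ad u j (E (s - j)%N v) n.
Proof.
have := exps_conv_adj A_linear A_0 A'_linear A'_0 (delta0 v) s (Yf_linear u).
have -> : conv (Yf u) (delta0 v) = delta0 (fun n => Y u v n%:~R).
  apply/funext => r; rewrite /conv big_ord_recl big1 ?addr0 => [|j _]; last by rewrite lift0.
  case: r => [|r] //=; apply/funext => m; exact: Y0r.
move/(congr1 (fun f : int -> V => f n)); rewrite /conv fct_sumE => <-.
rewrite /exps fct_sumE /E /opE /exps; apply: eq_bigr => i _.
have it : iter i (conv A') (delta0 (fun n => Y u v n%:~R)) =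
    fun r n => iter i (conv A) (delta0 (Y u v n%:~R)) r.
  elim: (nat_of_ord i) => [|m IH]; first by apply/funext => -[|r].
  by rewrite iterS IH; apply/funext => r; apply/funext => q; rewrite /conv fct_sumE.
by rewrite it.
Qed.

(** Both sides are fields, so that it suffices to compare them on the vacuum,
    where [E_translation] applies. *)
Lemma exp_ad_conj mu u s v n : weight_space mu u -> exp_ad u s v n = conj_field mu u s v n.
Proof.
move=> wu; apply: is_field_eq (is_field_exp_ad u s) (is_field_conj mu u s) _ v n => n.
have -> : exp_ad u s (vac V) n = E s (T u n).
  rewrite /T exp_ad_Y big_ord_recr /= subnn E_0 big1 ?add0r // => j _.
  rewrite E_vac; have -> : (s - j)%N = (s - j).-1.+1 by have := ltn_ord j; lia.
  by case: (is_field_exp_ad u j) => J [c [_ ->]]; rewrite big1 // => i _; rewrite Y0r.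
case: n => n; first exact: E_translation.
rewrite T_neg // (lin0 (E_linear a s)) /conj_field big1 // => r _.
by rewrite -/(T _ _) T_neg ?scaler0 //; lia.
Qed.

Lemma E_Y mu u v s n : weight_space mu u ->
  E s (Y u v n%:~R) = \sum_(j < s.+1) conj_field mu u j (E (s - j)%N v) n.
Proof. by move=> wu; rewrite exp_ad_Y; apply: eq_bigr => j _; rewrite (exp_ad_conj _ _ _ wu). Qed.

End Conjugation.

Section ConjugationPowers.
Variables (F : numClosedFieldType) (V : vertex_operator_superalgebra F).
Variables (k : nat) (a : nat -> F).
Hypothesis k_gt0 : (0 < k)%N.
Hypothesis exp_linear_field : exps (ad_field a) (linear_field 1) =1 linear_field (k%:R : F).
Local Notation E := (@E F V a).
Local Notation nu := (@nu F k).
Local Notation cov := (cov F k).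
Local Notation dexp := (@dexp F k).
Implicit Types (u v : V).

(** [E] with exponents in [Z], for sums over all integers. *)
Definition Ez (t : int) (u : V) : V := if t is Posz s then E s u else 0.

Variables (mu : int) (u v : V) (S N : nat) (tau : int).
Hypothesis wu : weight_space mu u.
Hypotheses (Su : forall s, (S <= s)%N -> E s u = 0) (Sv : forall s, (S <= s)%N -> E s v = 0).
Hypothesis YN : forall r l (m : int), m < - N%:Z -> Y (E r u) (E l v) m%:~R = 0.

Let m (r l : nat) : int := tau + r%:Z + l%:Z.

Lemma Ez_Y n : Ez (n - tau) (Y u v n%:~R) = \sum_(r < S) \sum_(l < S)
  (nu (dexp mu r) (m r l)%:~R (n - m r l) : F) *: Y (E r u) (E l v) (m r l)%:~R.
Proof.
pose K r l := (nu (dexp mu r) (m r l)%:~R (n - m r l) : F) *: Y (E r u) (E l v) (m r l)%:~R.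
rewrite -[RHS]/(\sum_(r < S) \sum_(l < S) K r l).
case nt: (n - tau) => [s|s] /=; last first.
  by rewrite !big1 // => r _; rewrite big1 // => l _; rewrite /K nu_below ?scale0r // /m; lia.
have Ks r l : (s < r + l)%N -> K r l = 0.
  by move=> srl; rewrite /K nu_below ?scale0r // /m; lia.
have KS1 r l : (S <= r)%N -> K r l = 0 by move=> Sr; rewrite /K Su // Y0l scaler0.
have KS2 r l : (S <= l)%N -> K r l = 0 by move=> Sl; rewrite /K Sv // Y0r scaler0.
pose B := maxn s.+1 S.
transitivity (\sum_(r < B) \sum_(l < B) K r l); last first.
  rewrite (sum_widen (A := S) (f := fun r => \sum_(l < B) K r l)) ?leq_maxr //; last first.
    by move=> r Sr; rewrite big1 // => l _; rewrite KS1.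
  by apply: eq_bigr => r _; rewrite (sum_widen (A := S) (f := K r)) ?leq_maxr // => l; apply: KS2.
rewrite (sum_widen (A := s.+1) (f := fun r => \sum_(l < B) K r l)) ?leq_maxl //; last first.
  by move=> r sr; rewrite big1 // => l _; rewrite Ks //; lia.
rewrite (E_Y k_gt0 exp_linear_field _ _ _ wu) /conj_field.
pose G r i l := (nu (dexp mu r) (n - i%:Z)%:~R i%:Z : F) *: Y (E r u) (E l v) (n - i%:Z)%:~R.
rewrite -[LHS]/(\sum_(j < s.+1) \sum_(r < j.+1) G r (j - r)%N (s - j)%N) exchange_antidiag.
apply: eq_bigr => r _; have rs : (r <= s)%N by rewrite -ltnS.
rewrite (sum_widen (A := (s - r).+1) (f := K r)); last 2 first.
- by rewrite (leq_trans _ (leq_maxl _ _)) // ltnS leq_subr.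
- by move=> l sl; rewrite Ks //; lia.
rewrite (reindex_inj rev_ord_inj); apply: eq_bigr => l _ /=.
have ls : (l <= s - r)%N by rewrite -ltnS.
rewrite subSS subKn // /G /K.
have -> : n - (s - r - l)%N%:Z = m r l by rewrite /m; lia.
by have -> : n - m r l = (s - r - l)%N%:Z by rewrite /m; lia.
Qed.

Lemma pmul_cov_nu d (x i : int) (K : nat) : x + N%:Z = K%:Z ->
  pmul (cov ^+ N) (fun n => nu d x%:~R (n - x)) i = pmul (cov ^+ K) (binf d) i.
Proof.
move=> xK; rewrite {1}covE exprMn pmulM pmul_Xn.
rewrite (pmul_shift _ (nu d x%:~R) (- x)) nu_shift //.
have -> : x%:~R + N%:R = K%:R :> F by have := congr1 (fun z : int => z%:~R : F) xK; rewrite rmorphD.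
by rewrite nu_nat //; congr (pmul _ _ _); rewrite -xK; ring.
Qed.

(** The coefficients in
    [phi^N D(y) Y(u, z) v = phi^N Y(D(y + z) u, phi) D(y) v]. *)
Lemma E_Y_cov i :
  pmul (cov ^+ N) (fun n => Ez (n - tau) (Y u v n%:~R)) i = \sum_(r < S) \sum_(l < S)
    (pmul (cov ^+ absz (N%:Z + m r l)) (binf (dexp mu r)) i : F) *:
       Y (E r u) (E l v) (m r l)%:~R.
Proof.
rewrite (eq_pmul _ Ez_Y) pmulf_sum; apply: eq_bigr => r _.
rewrite pmulf_sum; apply: eq_bigr => l _.
have [mN|mN] := ltP (m r l) (- N%:Z).
  rewrite YN // scaler0 /pmul big1 // => j _; by rewrite !scaler0.
have mK : m r l + N%:Z = (absz (N%:Z + m r l))%:Z by lia.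
rewrite -(pmul_cov_nu _ _ mK) /pmul scaler_suml.
by apply: eq_bigr => j _; rewrite -scalerA.
Qed.

End ConjugationPowers.

(** * The tensor power and the cyclic permutation *)

Section TensorPower.
Variables (F : numClosedFieldType) (k : nat).
Variables (V W : vertex_operator_superalgebra F) (tens : {ffun 'I_k -> V} -> W).
Hypotheses (k_gt0 : (0 < k)%N) (W_tensor : is_tensor_power_vosa tens).
Variable g : W -> W.
Hypothesis g_cyclic : is_cyclic_permutation tens g.
Implicit Types (u v : V) (l : nat) (p q : bool).

Local Notation fac := (at_factor tens).

Lemma tens_multilinear : multilinear tens.
Proof. exact: (tensor_universal W_tensor).1. Qed.

Lemma tens_eq0 (v : {ffun 'I_k -> V}) i : v i = 0 -> tens v = 0.
Proof.
move=> vi; rewrite -(lin0 (tens_multilinear i v)); congr tens.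
by apply/ffunP => j; rewrite ffunE; case: eqP => // ->.
Qed.

Lemma fac_linear l : (l < k)%N -> linear (fac l).
Proof.
move=> lk; have E x : fac l x = tens [ffun j => if j == Ordinal lk then x else [ffun=> vac V] j].
  by rewrite /at_factor; congr tens; apply/ffunP => j; rewrite !ffunE.
by move=> c x y; rewrite !E tens_multilinear.
Qed.

Let pfac l p : {ffun 'I_k -> bool} := [ffun i : 'I_k => (i == l :> nat) && p].

Lemma fac_homogeneous l p u : parity p u ->
  homogeneous (pfac l p) [ffun i : 'I_k => if i == l :> nat then u else vac V].
Proof. by move=> pu i; rewrite !ffunE; case: eqP => //= _; apply: vac_even. Qed.

Lemma fac_parity p u : parity p u -> parity p (fac 0 u).
Proof.
move=> pu; have := tensor_parity W_tensor (fac_homogeneous 0 pu).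
rewrite (bigD1 (Ordinal k_gt0)) //= ffunE eqxx /= big1 ?addbF // => i i0.
by rewrite ffunE (_ : (i == 0%N :> nat) = false) //; apply/negbTE.
Qed.

Lemma fac_vac l : fac l (vac V) = vac W.
Proof.
rewrite (tensor_vac W_tensor) /at_factor; congr tens.
by apply/ffunP => i; rewrite !ffunE if_same.
Qed.

Lemma g_fac l l' p u : (l' < k)%N ->
  (forall i, (i < k)%N -> ((i.+1 %% k)%N == l) = (i == l')) ->
  parity p u -> g (fac l u) = fac l' u.
Proof.
move=> lk il pu; rewrite (g_cyclic.2 _ _ (fac_homogeneous l pu)).
rewrite big1 ?expr0 ?scale1r => [|i /eqP i0]; last first.
  apply: big1 => j j0; rewrite !ffunE i0.
  by case: eqP => // l0; rewrite -l0 (negbTE j0) muln0.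
by congr tens; apply/ffunP => i; rewrite !ffunE /= il.
Qed.

Lemma iter_g_fac j p u : (0 < j < k)%N -> parity p u -> iter j g (fac 0 u) = fac (k - j) u.
Proof.
move=> + pu; elim: j => // -[_|j IH] /andP[_ jk].
  apply: (g_fac (p := p)) => //; first lia.
  move=> i ik; have [e|ne] := eqVneq i.+1 k.
    by rewrite e modnn eqxx; apply/esym/eqP; lia.
  by rewrite modn_small; [apply/eqP/eqP; lia|lia].
rewrite iterS IH; last by lia.
apply: (g_fac (p := p)) => //; first lia.
move=> i ik; have [e|ne] := eqVneq i.+1 k.
  by rewrite e modnn; apply/eqP/eqP; lia.
by rewrite modn_small; [apply/eqP/eqP; lia|lia].
Qed.

Lemma Y_fac0 p q u v e : parity p u -> parity q v ->
  Y (fac 0 u) (fac 0 v) e = fac 0 (Y u v e).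
Proof.
move=> pu qv; rewrite (tensor_Y W_tensor e (fac_homogeneous 0 pu) (fac_homogeneous 0 qv)).
rewrite big1 ?expr0 ?scale1r => [|j _]; last first.
  by apply: big1 => i ij; rewrite !ffunE; case: eqP => // j0; rewrite j0 in ij.
pose d0 : {ffun 'I_k -> rat} := [ffun i : 'I_k => if i == 0%N :> nat then e else 0].
pose i0 := Ordinal k_gt0.
have d0e : \sum_(i < k) d0 i = e.
  rewrite (bigD1 i0) //= ffunE eqxx big1 ?addr0 // => i ii.
  by rewrite ffunE (_ : (i == 0%N :> nat) = false) //; apply/negbTE.
rewrite (fsbigE [:: d0]) // => [|d /=|d /= de]; last 2 first.
- by rewrite inE => /eqP ->.
- rewrite inE => dd0; have [i ii di] : exists2 i : 'I_k, i != i0 & d i != 0.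
    apply: contrapT => H; move/eqP: dd0; apply; apply/ffunP => i; rewrite ffunE.
    have H' j : j != i0 -> d j = 0.
      by move=> ji; apply/eqP/negPn/negP => dj; apply: H; exists j.
    have [i00|] := eqVneq i i0; last by move=> ii; rewrite H' // (_ : (i == 0%N :> nat) = false) //; apply/negbTE.
    by rewrite i00 /= -de (bigD1 i0) //= big1 ?addr0 // => j /H'.
  apply: (@tens_eq0 _ i); rewrite !ffunE (_ : (i == 0%N :> nat) = false); last exact/negbTE.
  by rewrite Y_vac (negbTE di) scale0r.
rewrite big_mkcond big_seq1 mem_set //; congr tens; apply/ffunP => i; rewrite !ffunE.
by case: eqP => // _; rewrite Y_vac eqxx scale1r.
Qed.

(** In different tensor factors, the product formula leaves only
    [Y(u, x) 1] and [Y(1, x) v], which have no negative powers. *)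
Lemma Y_fac_regular l p q u v e : (0 < l < k)%N -> parity p u -> parity q v ->
  e < 0 -> Y (fac l u) (fac 0 v) e = 0.
Proof.
move=> /andP[l0 lk] pu qv e0.
rewrite (tensor_Y W_tensor e (fac_homogeneous l pu) (fac_homogeneous 0 qv)).
rewrite fsbig1 ?scaler0 // => d /= de.
have [i di] : exists i, d i < 0.
  apply: contrapT => H; move: e0; rewrite -de ltNge => /negP; apply.
  by apply: sumr_ge0 => i _; rewrite leNgt; apply/negP => di; apply: H; exists i.
apply: (@tens_eq0 _ i); rewrite !ffunE.
have [il|il] := eqVneq (i : nat) l; last by rewrite Y_vac lt_eqF // scale0r.
by rewrite il gtn_eqF // Y_creation.
Qed.

End TensorPower.

(** * Components of the twisted Jacobi identity *)

Section ClassesModulo.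
Variables (F : numClosedFieldType) (M : lmodType F) (k : nat).
Hypothesis k_gt0 : (0 < k)%N.
Implicit Types (f : int -> M) (p : {poly F}).

Definition subseq_mod f (s : nat) (x : int) : M := f (s%:Z + k%:Z * x).

Lemma pmul_subseq_mod p f s x :
  pmul (p \Po 'X^k) f (s%:Z + k%:Z * x) = pmul p (subseq_mod f s) x.
Proof.
elim/poly_ind: p x => [|p c IH] x; first by rewrite comp_poly0 !pmul0.
rewrite comp_polyD comp_polyM comp_polyX comp_polyC !pmulD !pmulC pmulMX; congr (_ + _).
rewrite mulrC pmulM pmul_Xn -IH; congr pmul; ring.
Qed.

Lemma sum_mod (G : nat -> M) n :
  \sum_(j < n * k) G j = \sum_(s < k) \sum_(b < n) G (s + k * b)%N.
Proof.
rewrite exchange_big; elim: n => [|n IH]; first by rewrite mul0n !big_ord0.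
rewrite big_ord_recr /= -IH -!(big_mkord xpredT) mulSn (big_cat_nat (n := n * k)) ?leq_addl //=.
congr (_ + _); have -> : index_iota (n * k) (k + n * k) = index_iota (0 + n * k) (k + n * k) by [].
by rewrite big_addn addnK big_mkord; apply: eq_bigr => s _; rewrite mulnC.
Qed.

Lemma zsum_subseq_mod K f : zsupp K f -> zsum f = \sum_(s < k) zsum (subseq_mod f s).
Proof.
move=> fK.
have fK' : zsupp (K.+1 * k) f by apply: zsupp_widen fK; rewrite (leq_trans (leqnSn K)) // leq_pmulr.
have sK (s : 'I_k) : zsupp K.+1 (subseq_mod f s).
  move=> b bK; apply: fK; have := ltn_ord s; nia.
rewrite (zsumE fK') doubleMl (sum_mod (fun j => f (j%:Z - (K.+1 * k)%N%:Z))).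
apply: eq_bigr => s _; rewrite (zsumE (sK s)); apply: eq_bigr => b _.
rewrite /subseq_mod; congr f; rewrite PoszD !PoszM; ring.
Qed.

End ClassesModulo.

Section Roots.
Variables (F : numClosedFieldType) (k : nat) (eta : F).
Hypothesis eta_prim : k.-primitive_root eta.

Lemma sum_root_powers (j : 'I_k) :
  \sum_(s < k) eta ^+ (j * s) = (if j == 0%N :> nat then k%:R else 0).
Proof.
case: eqP => [->|/eqP j0].
  by rewrite (eq_bigr (fun=> 1)) ?sumr_const ?card_ord // => s _; rewrite mul0n.
have ej : eta ^+ j != 1.
  rewrite -(prim_order_dvd eta_prim); apply/negP => /dvdn_leq.
  by rewrite lt0n j0 leqNgt ltn_ord => /(_ isT).
apply: (mulfI (x := 1 - eta ^+ j)); first by rewrite subr_eq0 eq_sym.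
have := subrXX 1 (eta ^+ j) k; rewrite expr1n -exprM mulnC exprM (prim_expr_order eta_prim).
rewrite expr1n subrr mulr0 => {2}->; congr (_ * _).
by apply: eq_bigr => s _; rewrite expr1n mul1r exprM.
Qed.

End Roots.

Section BinomialSubstitution.
Variables (F : numClosedFieldType) (k : nat).
Hypothesis k_gt0 : (0 < k)%N.

(** [W = (1 + t)^k - 1] *)
Definition covW : {poly F} := (1 + 'X) ^+ k - 1.

Lemma covWE : covW = k%:R *: cov F k.
Proof. by rewrite /cov scalerBr scalerA divff ?k_neq0 // scale1r scale_polyC divff ?k_neq0. Qed.

Lemma pmul_covW_small (M : lmodType F) m (g : int -> M) (r : int) : zbelow 0 g ->
  r < m%:Z -> pmul (covW ^+ m) g r = 0.
Proof.
move=> g0 rm; rewrite covWE covE exprZn exprMn scalerAr pmulM pmul_Xn.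
by apply: (zbelow_pmul _ g0); lia.
Qed.

(** The coefficients of [(1 + t)^(d + k x) = (1 + t)^d (1 + W)^x]. *)
Lemma gbinom_subst (d x : F) (i L : nat) : (i < L)%N ->
  gbinom (d + k%:R * x) i = \sum_(m < L) gbinom x m * pmul (covW ^+ m) (binf d) i.
Proof.
move=> iL.
pose c m : F := pmul (covW ^+ m) (binf d) i.
have c0 m : (i < m)%N -> c m = 0.
  by move=> im; exact: (@pmul_covW_small F^o m _ i%:Z (binf_below d)).
pose P : {poly F} := binomp F i \Po (d%:P + k%:R *: 'X).
pose Q : {poly F} := \sum_(m < L) c m *: binomp F m.
have PE y : P.[y] = gbinom (d + k%:R * y) i.
  by rewrite horner_comp binompE hornerD hornerC hornerZ hornerX.
have QE y : Q.[y] = \sum_(m < L) gbinom y m * c m.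
  by rewrite horner_sum; apply: eq_bigr => m _; rewrite hornerZ binompE mulrC.
rewrite -PE -QE; congr horner; apply: poly_eq_on_nat => n; rewrite PE QE.
have -> : gbinom (d + k%:R * n%:R) i = pmul ((1 + 'X) ^+ k ^+ n) (binf d) i.
  by rewrite -exprM pmul_1Xn natrM.
have -> : (1 + 'X) ^+ k = 1 + covW by rewrite /covW [RHS]addrC subrK.
have pmul_comb n' (f : nat -> F) (P' : nat -> {poly F}) :
    (pmul (\sum_(m < n') f m *: P' m) (binf d) i : F) = \sum_(m < n') f m * pmul (P' m) (binf d) i.
  elim: n' => [|n' IH]; first by rewrite !big_ord0 pmul0.
  by rewrite !big_ord_recr /= pmulD IH -mul_polyC pmulM pmulC.
have -> : (1 + covW) ^+ n = \sum_(m < n.+1) gbinom (n%:R : F) m *: covW ^+ m.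
  rewrite addrC exprDn (reindex_inj rev_ord_inj); apply: eq_bigr => m _ /=.
  have mn : (m <= n)%N by rewrite -ltnS.
  by rewrite subSS expr1n mulr1 subKn // bin_sub // gbinom_nat scaler_nat.
rewrite pmul_comb -[RHS]/(\sum_(m < L) gbinom n%:R m * c m).
have e : \sum_(m < L) gbinom n%:R m * c m = \sum_(m < maxn L n.+1) gbinom n%:R m * c m.
  apply/esym/(sum_widen (f := fun m => gbinom n%:R m * c m)); first exact: leq_maxl.
  by move=> m Lm; rewrite c0 ?mulr0 // (leq_trans iL).
rewrite e; apply/esym/(sum_widen (f := fun m => gbinom n%:R m * c m)); first exact: leq_maxr.
by move=> m nm; rewrite gbinom_small // mul0r.
Qed.

End BinomialSubstitution.

(** * The twisted module on the fields [u^1] *)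

Lemma truncation_nat (F : numClosedFieldType) (M : lmodType F) (f : rat -> M) :
  (exists N : rat, forall n, N < n -> f (- n - 1) = 0) ->
  exists N : nat, forall e, e < - N%:R -> f e = 0.
Proof.
case=> N fN; exists (Num.bound (`|N| + 1)) => e eN.
have -> : e = - (- e - 1) - 1 by ring.
apply: fN; have b : `|N| + 1 < (Num.bound (`|N| + 1))%:R.
  by apply: archi_boundP; apply: addr_ge0.
apply: (le_lt_trans (ler_norm N)); rewrite ltrBrDr.
by apply: (lt_trans b); rewrite ltrNr.
Qed.

Section TwistedComponents.
Variables (F : numClosedFieldType) (k : nat) (eta : F).
Variables (V W : vertex_operator_superalgebra F) (tens : {ffun 'I_k -> V} -> W) (g : W -> W).
Variables (M : lmodType F) (parityM : bool -> set M) (Yg : W -> M -> series M).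
Hypotheses (k_gt0 : (0 < k)%N) (W_tensor : is_tensor_power_vosa tens).
Hypothesis g_cyclic : is_cyclic_permutation tens g.
Hypothesis M_twisted : weak_twisted_module g k eta parityM Yg.
Variables (p q : bool) (u v : V) (w : M) (C : rat).
Hypotheses (pu : parity p u) (qv : parity q v).

Local Notation fac0 := (at_factor tens 0).

(** The products and the iterate of [u^1] and [v^1] at a fixed total degree
    [C], in the variables [x_i^(1/k)]. *)
Definition prod_uv (b : int) : M :=
  Yg (fac0 u) (Yg (fac0 v) w ((C - b%:~R) / k%:R)) (b%:~R / k%:R).
Definition prod_vu (b : int) : M :=
  (-1) ^+ (p && q) *: Yg (fac0 v) (Yg (fac0 u) w (b%:~R / k%:R)) ((C - b%:~R) / k%:R).
Definition iterate_uv (j : nat) (m : int) : M :=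
  Yg (Y (iter j g (fac0 u)) (fac0 v) m%:~R) w (C / k%:R - m%:~R).

Let k0 : (k%:R : rat) != 0. Proof. by rewrite pnatr_eq0 -lt0n. Qed.
Let kp : (0 : rat) < k%:R. Proof. by rewrite ltr0n. Qed.
Let k0F : (k%:R : F) != 0. Proof. exact: k_neq0. Qed.
Let Yg0l w' e : Yg 0 w' e = 0. Proof. exact: (lin0 (mod_Y_linearl M_twisted w' e)). Qed.
Let Yg0r x e : Yg x 0 e = 0. Proof. exact: (lin0 (mod_Y_linearr M_twisted x e)). Qed.

Lemma prod_uv_above : exists B, zabove B prod_uv.
Proof.
have [N vN] := truncation_nat (mod_Y_truncation M_twisted (fac0 v) w).
exists (Num.bound (`|C| + k%:R * N%:R)) => b bB; rewrite /prod_uv vN ?Yg0r //.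
have bb : `|C| + k%:R * N%:R < (Num.bound (`|C| + k%:R * N%:R))%:R.
  by apply: archi_boundP; apply: addr_ge0 => //; apply: mulr_ge0.
rewrite ltr_pdivrMr // ltrBlDr; have := ler_norm C.
have : (Num.bound (`|C| + k%:R * N%:R))%:R <= b%:~R :> rat by rewrite -(ler_int rat) in bB.
move=> h1 h2; apply: (le_lt_trans h2); rewrite mulNr mulrC addrC ltrBrDr.
exact: (lt_le_trans bb).
Qed.

Lemma prod_vu_below : exists B, zbelow B prod_vu.
Proof.
have [N uN] := truncation_nat (mod_Y_truncation M_twisted (fac0 u) w).
exists (N * k)%N => b bB; rewrite /prod_vu uN ?Yg0r ?scaler0 //.
rewrite ltr_pdivrMr // mulNr -natrM.
by move: bB; rewrite -(ltr_int rat) rmorphN.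
Qed.

Lemma iterate_regular j m : (0 < j < k)%N -> m < 0 -> iterate_uv j m = 0.
Proof.
move=> jk m0; rewrite /iterate_uv (iter_g_fac k_gt0 g_cyclic jk pu).
rewrite (Y_fac_regular W_tensor (p := p) (q := q)) //; first lia.
by rewrite ltrz0.
Qed.

Lemma iterate_0 m : iterate_uv 0 m = Yg (fac0 (Y u v m%:~R)) w (C / k%:R - m%:~R).
Proof. by rewrite /iterate_uv (Y_fac0 k_gt0 W_tensor _ pu qv). Qed.

Variable N : nat.
Hypothesis uvN : forall m : int, m < - N%:Z -> Y u v m%:~R = 0.

Lemma iterate_below j : (j < k)%N -> zbelow N (iterate_uv j).
Proof.
move=> jk m mN; case: j jk => [|j] jk; last by apply: iterate_regular; lia.
by rewrite iterate_0 uvN // (lin0 (fac_linear W_tensor k_gt0)) Yg0l.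
Qed.

(** Averaging over the branches selects from the iterate the exponents of [x_1]
    congruent to [s / k] modulo 1. *)
Definition iterate_class (s : nat) (m : int) : M :=
  k%:R^-1 *: \sum_(j < k) eta ^+ (j * s) *: iterate_uv j m.

Lemma twisted_jacobi1 (s : nat) n e :
  jacobi1 (s%:R / k%:R) (subseq_mod k prod_uv s) (subseq_mod k prod_vu s)
    (iterate_class s) n e.
Proof.
pose b := s%:Z + k%:Z * e.
have bk : b%:~R / k%:R = s%:R / k%:R + e%:~R :> rat.
  by rewrite /b rmorphD rmorphM /= mulrDl mulrAC divff // mul1r.
have [A uvA] := prod_uv_above; have [B vuB] := prod_vu_below.
have := mod_Y_jacobi M_twisted w (fac_parity k_gt0 W_tensor pu) (fac_parity k_gt0 W_tensor qv)
  (- n%:~R - 1) (b%:~R / k%:R) (C / k%:R + n%:~R - b%:~R / k%:R).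
rewrite mul_delta_12 mul_delta_21 /jacobi1.
have -> : mul_hi n (subseq_mod k prod_uv s) e = \sum_(i \in [set: nat])
    ((-1) ^+ i * gbinom n%:~R i) *: Yg (fac0 u) (Yg (fac0 v) w
     (C / k%:R + n%:~R - b%:~R / k%:R - i%:R)) (b%:~R / k%:R - n%:~R + i%:R).
  apply: eq_fsbigr => i _; rewrite /subseq_mod /prod_uv; congr (_ *: Yg _ (Yg _ _ _) _).
    by rewrite mulrBl bk !(rmorphD, rmorphN, rmorphM) /=; field.
  by rewrite bk !(rmorphD, rmorphN, rmorphM) /=; field.
have -> : mul_lo n (subseq_mod k prod_vu s) e = (-1) ^+ (p && q) *: \sum_(i \in [set: nat])
    ((-1) ^ n * ((-1) ^+ i * gbinom n%:~R i)) *: Yg (fac0 v) (Yg (fac0 u) w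
     (b%:~R / k%:R - i%:R)) (C / k%:R + n%:~R - b%:~R / k%:R - n%:~R + i%:R).
  have vuE i : subseq_mod k prod_vu s (e - i%:Z) = (-1) ^+ (p && q) *:
      Yg (fac0 v) (Yg (fac0 u) w (b%:~R / k%:R - i%:R))
       (C / k%:R + n%:~R - b%:~R / k%:R - n%:~R + i%:R).
    rewrite /subseq_mod /prod_vu; congr (_ *: Yg _ (Yg _ _ _) _).
      by rewrite bk !(rmorphD, rmorphN, rmorphM) /=; field.
    by rewrite mulrBl bk !(rmorphD, rmorphN, rmorphM) /=; field.
  pose L := (B + s + k * absz e + 1)%N.
  have vu0 i : (L <= i)%N -> subseq_mod k prod_vu s (e - i%:Z) = 0.
    by move=> Li; apply: vuB; rewrite /L in Li; nia.
  rewrite (mul_loE _ vu0) (@fsum_nat _ L); last first.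
    move=> i /vu0; rewrite vuE => /(congr1 (fun x => (-1) ^+ (p && q) *: x)).
    rewrite scalerA -expr2 sqrr_sign scale1r scaler0 => ->; exact: scaler0.
  rewrite !scaler_sumr; apply: eq_bigr => i _; rewrite vuE !scalerA; congr (_ *: _); ring.
move=> ->.
have ek : eta ^+ k = 1 by apply: prim_expr_order; exact: (twist_root M_twisted).
have eb (j : nat) : eta ^ (j%:Z * b) = eta ^+ (j * s).
  have en : eta != 0 by apply: (eta_neq0 k_gt0 ek).
  rewrite /b mulrDr expfzDr // -PoszM -exprnP mulrCA -exprz_exp -exprnP ek exp1rz mulr1 //.
pose L := (N + absz n + 1)%N.
have I0 j : (j < k)%N -> forall i, (L <= i)%N -> iterate_uv j (- n - 1 - i%:Z) = 0.
  by move=> jk i Li; apply: (iterate_below jk); rewrite /L in Li; lia.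
have c0 i : (L <= i)%N -> iterate_class s (- n - 1 - i%:Z) = 0.
  by move=> Li; rewrite /iterate_class big1 ?scaler0 // => j _; rewrite I0 ?scaler0.
rewrite (mul_binE _ c0) /iterate_class.
transitivity (k%:R^-1 *: \sum_(j < k) \sum_(i < L)
    (eta ^+ (j * s) * gbinom (- (s%:R / k%:R + e%:~R) - 1) i) *: iterate_uv j (- n - 1 - i%:Z)).
  congr (_ *: _); apply: eq_bigr => j _; rewrite (mul_delta_10 _ k_gt0 ek) eb.
  have ie i : Yg (Y (iter j g (fac0 u)) (fac0 v) (- n%:~R - 1 - i%:R)) w
     (b%:~R / k%:R + (C / k%:R + n%:~R - b%:~R / k%:R) + i%:R + 1) = iterate_uv j (- n - 1 - i%:Z).
    rewrite /iterate_uv; congr (Yg (Y _ _ _) _ _); rewrite !(rmorphD, rmorphN) /=; ring.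
  have rE : - ratr (b%:~R / k%:R) - 1 = - (s%:R / k%:R + e%:~R) - 1 :> F.
    by rewrite bk rmorphD fmorph_div /= !ratr_nat ratr_int.
  rewrite (@fsum_nat _ L) => [|i Li]; last by rewrite ie I0 // scaler0.
  by apply: eq_bigr => i _; rewrite ie rE.
rewrite exchange_big scaler_sumr; apply: eq_bigr => i _.
rewrite !scaler_sumr; apply: eq_bigr => j _; rewrite !scalerA; congr (_ *: _); ring.
Qed.

Lemma XnB1 : 'X^k - 1 = (\sum_(j < k) 'X^j) * ('X - 1) :> {poly F}.
Proof.
rewrite -[1 in LHS](expr1n _ k) subrXX mulrC; congr (_ * _).
rewrite (reindex_inj rev_ord_inj); apply: eq_bigr => j _.
rewrite expr1n mulr1 /=; have -> // : (k.-1 - (k - j.+1))%N = j.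
by have := ltn_ord j; lia.
Qed.

(** The only singular contribution to the commutator comes from [j = 0], and it
    is polynomial in [b]: the fields are local in [x_1^(1/k) - x_2^(1/k)]. *)
Lemma commutator_poly b : prod_uv b = prod_vu b + \sum_(i < N)
  (k%:R^-1 * gbinom (- (b%:~R / k%:R) - 1) i) *: iterate_uv 0 (- 1 - i%:Z).
Proof.
pose e := (b %/ k%:Z)%Z; pose s := absz (b %% k%:Z)%Z.
have bE : b = s%:Z + k%:Z * e.
  by rewrite /s gez0_abs ?modz_ge0 ?pnatr_eq0 -?lt0n // addrC mulrC -divz_eq.
have z0 i : i != 0%N -> gbinom (0%:~R : F) i = 0.
  by case: i => // i _; rewrite -[0%:~R]/(0%:R) gbinom_small.
(* the coefficient of [x_0^-1] isolates the commutator *)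
have := twisted_jacobi1 s 0 e.
rewrite /jacobi1 /mul_hi /mul_lo (@fsum_one _ _ 0%N) => [|i /z0 ->]; last by rewrite mulr0 scale0r.
rewrite (@fsum_one _ _ 0%N) => [|i /z0 ->]; last by rewrite mulr0 scale0r.
have -> : e - 0 + 0%N%:Z = e by rewrite subr0; exact: addr0.
have -> : e - 0%N%:Z = e by exact: subr0.
rewrite gbinom0 expr0 expr0z !mulr1 !scale1r /subseq_mod -bE oppr0 sub0r.
have I0 j : (0 < j < k)%N -> forall i : nat, iterate_uv j (- 1 - i%:Z) = 0.
  by move=> jk i; apply: iterate_regular => //; lia.
have cE (i : nat) : iterate_class s (- 1 - i%:Z) = k%:R^-1 *: iterate_uv 0 (- 1 - i%:Z).
  rewrite /iterate_class (bigD1 (Ordinal k_gt0)) //= mul0n expr0 scale1r big1 ?addr0 // => j j0.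
  by rewrite I0 ?scaler0 // ltn_ord andbT lt0n; apply: contra j0 => /eqP j0; apply/eqP/val_inj.
rewrite (@mul_binE _ _ N) => [|i Ni]; last first.
  by rewrite cE (iterate_below k_gt0) ?scaler0 //; lia.
move/(canRL (subrK _)) => ->; rewrite addrC; congr (_ + _); apply: eq_bigr => i _.
rewrite cE scalerA mulrC; congr (_ * gbinom _ _ *: _).
rewrite bE rmorphD rmorphM /=; field; exact: k0F.
Qed.

(** By [commutator_poly], the commutator is a polynomial in [b] of degree less
    than [N], which [N] differences annihilate. *)
Lemma prod_local b : pmul (('X - 1) ^+ N) prod_uv b = pmul (('X - 1) ^+ N) prod_vu b.
Proof.
pose lin : {poly F} := - (k%:R^-1) *: 'X - 1.
pose P i : {poly F} := k%:R^-1 *: (binomp F i \Po lin).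
have PE i (c : int) : (P i).[c%:~R] = k%:R^-1 * gbinom (- (c%:~R / k%:R) - 1) i.
  rewrite hornerZ horner_comp binompE; congr (_ * gbinom _ _).
  by rewrite /lin !hornerE mulNr mulrC.
have Ps i : (size (P i) <= i.+1)%N.
  rewrite (leq_trans (size_scale_leq _ _)) // (leq_trans (size_comp_poly_leq _ _)) // ltnS.
  have sb : (size (binomp F i)).-1 = i.
    rewrite /binomp size_scale ?invr_eq0 ?pnatr_eq0 -?lt0n ?fact_gt0 //.
    by rewrite -(big_mkord xpredT (fun j => 'X - (j%:R : F)%:P)) size_prod_XsubC size_iota subn0.
  have s2 : ((size lin).-1 <= 1)%N.
    rewrite -subn1 leq_subLR (leq_trans (size_polyD _ _)) // geq_max size_polyN size_poly1 andbT.
    by rewrite (leq_trans (size_scale_leq _ _)) // size_polyX.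
  by rewrite sb -[X in (_ <= X)%N]muln1 leq_mul2l s2 orbT.
rewrite (eq_pmul _ commutator_poly) pmulfD pmulf_sum big1 ?addr0 // => i _.
rewrite -[RHS](@pmul_diff_poly _ _ N (P i) (iterate_uv 0 (- 1 - i%:Z)) b); last first.
  by rewrite (leq_trans (Ps i)).
by apply: eq_pmul => c; rewrite PE.
Qed.

Lemma expand1_class (s : nat) i :
  expand1 (s%:R / k%:R) (subseq_mod k (pmul (('X^k - 1) ^+ N) prod_uv) s) i =
  iterate_class s (i - N%:Z).
Proof.
have [A uvA] := prod_uv_above; have [B vuB] := prod_vu_below.
have sub (f : int -> M) x : subseq_mod k (pmul (('X^k - 1) ^+ N) f) s x =
    pmul (('X - 1) ^+ N) (subseq_mod k f s) x.
  rewrite -pmul_subseq_mod /subseq_mod rmorphXn /= comp_polyB comp_polyX.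
  by rewrite -polyC1 comp_polyC.
rewrite (eq_expand1 _ _ (sub _)).
apply (@jacobi1P _ _ N (maxn A (B + s)%N) (s%:R / k%:R) _ (subseq_mod k prod_vu s)).
- by move=> x xA; apply: uvA; nia.
- by move=> x xA; apply: vuB; nia.
- move=> m mN; rewrite /iterate_class big1 ?scaler0 // => j _.
  by rewrite (iterate_below (ltn_ord j)) ?scaler0.
- move=> x; rewrite -!sub /subseq_mod.
  rewrite XnB1.
  by rewrite exprMn !pmulM; apply: eq_pmul => c; apply: prod_local.
by move=> n e; apply: twisted_jacobi1.
Qed.

(** Summed over [s], the powers [eta^(j s)] cancel unless [j = 0]. *)
Lemma sum_iterate_class m : \sum_(s < k) iterate_class s m = iterate_uv 0 m.
Proof.
rewrite -scaler_sumr exchange_big /=.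
under eq_bigr => j _ do rewrite -scaler_suml (sum_root_powers (twist_root M_twisted)).
rewrite (bigD1 (Ordinal k_gt0)) //= big1 ?addr0 => [|j j0]; last first.
  by rewrite (_ : (j == 0%N :> nat) = false) ?scale0r //; apply/negbTE.
by rewrite scalerA mulVf // scale1r.
Qed.

Lemma prod_supp : exists K, zsupp K (pmul (('X^k - 1) ^+ N) prod_uv).
Proof.
have [A uvA] := prod_uv_above; have [B vuB] := prod_vu_below.
exists (maxn B.+1 (A + size ((('X^k - 1) ^+ N)%R : {poly F})))%N.
apply: zsuppP; last exact: zabove_pmul uvA.
move=> b bB; have -> : pmul (('X^k - 1) ^+ N) prod_uv b = pmul (('X^k - 1) ^+ N) prod_vu b.
  by rewrite XnB1 exprMn !pmulM; apply: eq_pmul => c; apply: prod_local.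
exact: (zbelow_pmul _ vuB bB).
Qed.

(** Setting [x_1 = x_2 + x_0] with [(x_1/x_2)^(1/k) = 1 + t] turns
    [(x_1 - x_2)^N] times the product into [x_0^N] times the iterate. *)
Lemma expand1_twisted (d : F) (i : nat) :
  expand1 d (pmul (('X^k - 1) ^+ N) prod_uv) i =
  \sum_(m < i.+1) (pmul (covW F k ^+ m) (binf d) i : F) *: iterate_uv 0 (m%:Z - N%:Z).
Proof.
have [K GK] := prod_supp; move: GK; set G := pmul _ _ => GK.
rewrite /expand1.
transitivity (zsum (fun b => \sum_(m < i.+1)
    (pmul (covW F k ^+ m) (binf d) i : F) *: (gbinom (b%:~R / k%:R) m *: G b))).
  apply: eq_zsum => b; have -> : b%:~R = k%:R * (b%:~R / k%:R) :> F.
    by rewrite mulrC divfK.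
  rewrite (gbinom_subst k_gt0 d _ (ltnSn i)) mulrAC divff // mul1r scaler_suml.
  by apply: eq_bigr => m _; rewrite scalerA mulrC.
rewrite (@zsum_sum _ _ _ K); last by move=> m; do 2!apply: zsuppZ.
apply: eq_bigr => m _; rewrite (@zsumZ _ _ K); last exact: zsuppZ.
congr (_ *: _); rewrite -sum_iterate_class.
rewrite (zsum_subseq_mod k_gt0 (K := K)); last exact: zsuppZ.
apply: eq_bigr => s _; rewrite -expand1_class; apply: eq_zsum => x.
rewrite /subseq_mod; congr (gbinom _ _ *: _).
by rewrite rmorphD rmorphM /=; field; exact: k0F.
Qed.

End TwistedComponents.

(** * The operator Delta_k *)

Section FiniteSupport.
Variables (F : numClosedFieldType) (T : choiceType) (M : lmodType F).
Implicit Types f g : T -> M.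

Definition fin_supp f : Prop := exists s : seq T, forall x, x \notin s -> f x = 0.

Lemma fsum_lin c f g : fin_supp f -> fin_supp g ->
  \sum_(x \in [set: T]) (c *: f x + g x) =
  c *: \sum_(x \in [set: T]) f x + \sum_(x \in [set: T]) g x.
Proof.
move=> [s fs] [s' gs]; have us : uniq (undup (s ++ s')) by apply: undup_uniq.
have fU x : x \notin undup (s ++ s') -> f x = 0 /\ g x = 0.
  by rewrite mem_undup mem_cat negb_or => /andP[/fs -> /gs ->].
rewrite !(fsum_seq us) => [|x /fU[]|x /fU[]|x /fU[-> ->]] //.
  by rewrite scaler_sumr big_split.
by rewrite scaler0 addr0.
Qed.

End FiniteSupport.

Section DeltaOperator.
Variables (F : numClosedFieldType) (V : vertex_operator_superalgebra F).
Variables (k : nat) (a : nat -> F).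
Hypothesis k_gt1 : (1 < k)%N.
Local Notation E := (@E F V a).
Local Notation kappa := (sqrtC k%:R : F).
Implicit Types (u v : V) (mu : int) (s : nat) (e : rat).
Let k_gt0 : (0 < k)%N := ltnW k_gt1.
Let Wsum := @weight_direct_sum F V.
Local Notation comp := (component (@weight_space F V)).

Lemma kappa_neq0 : kappa != 0.
Proof. by rewrite sqrtC_eq0 k_neq0. Qed.

Lemma fin_supp_comp u : fin_supp (comp u).
Proof. by have [s [_ c0 _]] := decomposition_seq (componentP Wsum u); exists s. Qed.

Lemma comp_sum u : exists s : seq int, u = \sum_(mu <- s) comp u mu.
Proof. by have [s [_ _ uE]] := decomposition_seq (componentP Wsum u); exists s. Qed.

Lemma scalar_2L0_linear : linear (@scalar_2L0 F V kappa).
Proof.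
move=> c u v; rewrite /scalar_2L0 -fsum_lin.
- by apply: eq_fsbigr => m _; rewrite (component_linear Wsum) scalerDr !scalerA mulrC.
- by have [s c0] := fin_supp_comp u; exists s => x /c0 ->; rewrite scaler0.
- by have [s c0] := fin_supp_comp v; exists s => x /c0 ->; rewrite scaler0.
Qed.

Lemma scalar_2L0_weight mu u : weight_space mu u -> scalar_2L0 kappa u = kappa ^ mu *: u.
Proof.
move=> wu; rewrite /scalar_2L0 (@fsum_one _ _ mu) => [|m /negbTE mmu].
  by rewrite (component_single Wsum _ wu) eqxx.
by rewrite (component_single Wsum _ wu) mmu scaler0.
Qed.

(** The exponents of [x] occurring in [Delta_k(x)^-1 u] for [u] of weight [mu/2]. *)
Definition ratio : rat := (k%:R - 1) / (2 * k%:R).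
Definition posD mu s : rat := ratio * mu%:~R - s%:R.

Let k0 : (k%:R : rat) != 0. Proof. by rewrite pnatr_eq0 -lt0n. Qed.

Lemma posDE mu s : posD mu s = ratio * (mu - s%:Z *+ 2)%:~R + posL k s.
Proof.
rewrite /posD /posL /ratio rmorphB rmorphMn /=.
have two0 : (2 : rat) != 0 by [].
by field; rewrite k0.
Qed.

Lemma posD_inj mu : injective (posD mu).
Proof. by move=> i j /addrI/oppr_inj/eqP; rewrite eqr_nat => /eqP. Qed.

Let expL u e := exp_L k a (fun d => (d == 0)%:R *: u) e.

Lemma expL_linear e : linear (expL^~ e).
Proof.
move=> c u v; rewrite /expL; have [[s ->]|ne] := pselect (exists s, e = posL k s).
  by rewrite !exp_L_E // E_linear.
have ne' s : e <> posL k s by move=> es; apply: ne; exists s.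
by rewrite !exp_L_0 // scaler0 addr0.
Qed.

Lemma Delta_inv_weight mu u s : weight_space mu u ->
  Delta_inv k a u (posD mu s) = kappa ^ (mu - s%:Z *+ 2) *: E s u.
Proof.
move=> wu; rewrite /Delta_inv /power_2L0 -/ratio.
rewrite (@fsum_one _ _ (mu - s%:Z *+ 2)) => [|m mE].
  rewrite posDE addrC addKr exp_L_E // (scalar_2L0_weight (weight_E a s wu)).
  rewrite (linZ (component_linear Wsum _)).
  by rewrite (component_single Wsum _ (weight_E a s wu)) eqxx.
set e := posD mu s - _.
have [[s' es']|ne] := pselect (exists s, e = posL k s); last first.
  rewrite exp_L_0 // => [|s' es']; last by apply: ne; exists s'.
  by rewrite (lin0 scalar_2L0_linear) (lin0 (component_linear Wsum _)).
rewrite es' exp_L_E // (scalar_2L0_weight (weight_E a s' wu)).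
rewrite (linZ (component_linear Wsum _)) (component_single Wsum _ (weight_E a s' wu)).
case: eqP => [m'|]; last by rewrite scaler0.
have : posD mu s = posD mu s'.
  by apply/eqP; rewrite -subr_eq0 (posDE mu s') -m' -es' /e; apply/eqP; ring.
by move/posD_inj => ss'; rewrite ss' m' eqxx in mE.
Qed.

Lemma Delta_inv_weight0 mu u e : weight_space mu u -> (forall s, e <> posD mu s) ->
  Delta_inv k a u e = 0.
Proof.
move=> wu ne; apply: fsbig1 => m _; rewrite -/ratio.
have [[s es]|ne'] := pselect (exists s, e - ratio * m%:~R = posL k s); last first.
  rewrite exp_L_0 // => [|s es]; last by apply: ne'; exists s.
  by rewrite (lin0 scalar_2L0_linear) (lin0 (component_linear Wsum _)).
rewrite es exp_L_E // (scalar_2L0_weight (weight_E a s wu)).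
rewrite (linZ (component_linear Wsum _)) (component_single Wsum _ (weight_E a s wu)).
case: eqP => [mE|]; last by rewrite scaler0.
by case: (ne s); rewrite posDE -mE -es; ring.
Qed.

Lemma E_comp s u mu : comp (E s u) mu = E s (comp u (mu + s%:Z *+ 2)).
Proof.
have [r [ur c0 uE]] := decomposition_seq (componentP Wsum u).
rewrite [in LHS]uE (lin_sum (E_linear a s)) (lin_sum (component_linear Wsum mu)).
have H m : comp (E s (comp u m)) mu = if m == mu + s%:Z *+ 2 then E s (comp u m) else 0.
  rewrite (component_single Wsum _ (weight_E a s (component_in Wsum u m))).
  by rewrite [mu == _]eq_sym subr_eq.
rewrite (eq_bigr _ (fun m _ => H m)) -big_mkcond.
have [mr|/c0 c00] := boolP (mu + s%:Z *+ 2 \in r).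
  by rewrite -big_filter filter_pred1_uniq // big_seq1.
rewrite c00 (lin0 (E_linear a s)) big1 // => m /eqP ->.
by rewrite c00 (lin0 (E_linear a s)).
Qed.

Lemma scalar_2L0_comp u mu : comp (scalar_2L0 kappa u) mu = kappa ^ mu *: comp u mu.
Proof.
have [r [ur c0 uE]] := decomposition_seq (componentP Wsum u).
rewrite [in LHS]uE (lin_sum scalar_2L0_linear) (lin_sum (component_linear Wsum mu)).
rewrite [in RHS]uE (lin_sum (component_linear Wsum mu)) scaler_sumr; apply: eq_bigr => m _.
have wm := component_in Wsum u m.
rewrite (scalar_2L0_weight wm) (linZ (component_linear Wsum _)) (component_single Wsum _ wm).
by case: eqP => [->|_]; rewrite ?scaler0.
Qed.

Lemma fin_supp_power u e : fin_supp (fun m : int =>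
  comp (scalar_2L0 kappa (expL u (e - ratio * m%:~R))) m).
Proof.
have [r c0] := fin_supp_comp u.
exists [seq mu - Num.floor (ratio * mu%:~R - e) *+ 2 | mu <- r] => m nm.
rewrite scalar_2L0_comp /expL.
have [[s es]|ne'] := pselect (exists s, e - ratio * m%:~R = posL k s); last first.
  rewrite exp_L_0 // => [|s es]; last by apply: ne'; exists s.
  by rewrite (lin0 (component_linear Wsum _)) scaler0.
rewrite es exp_L_E // E_comp c0 ?(lin0 (E_linear a s)) ?scaler0 //.
apply: contra nm => mr; apply/mapP; exists (m + s%:Z *+ 2) => //.
have -> : ratio * (m + s%:Z *+ 2)%:~R - e = s%:Z%:~R.
  have := posDE (m + s%:Z *+ 2) s; rewrite addrK -es /posD => /(canRL (subrK _)) ->.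
  by rewrite -pmulrn; ring.
by rewrite intrKfloor addrK.
Qed.

Lemma Delta_inv_linear e : linear (fun u => Delta_inv k a u e).
Proof.
move=> c u v; rewrite /Delta_inv /power_2L0 -/ratio.
rewrite -(fsum_lin _ (fin_supp_power u e) (fin_supp_power v e)).
apply: eq_fsbigr => m _; rewrite -!/(expL _ _) expL_linear scalar_2L0_linear.
exact: (component_linear Wsum).
Qed.

Lemma Delta_inv_supp u : fin_supp (Delta_inv k a u).
Proof.
have [r uE] := comp_sum u; rewrite uE.
have fw mu (x : V) : weight_space mu x -> fin_supp (Delta_inv k a x).
  move=> wx; have [S xS] := E_vanish a wx; exists [seq posD mu s | s <- iota 0 S] => e ne.
  have [[s es]|ne'] := pselect (exists s, e = posD mu s); last first.
    by apply: (Delta_inv_weight0 wx) => s es; apply: ne'; exists s.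
  rewrite es (Delta_inv_weight s wx) xS ?scaler0 // leqNgt; apply: contra ne => sS.
  by apply/mapP; exists s; rewrite // mem_iota.
elim: r {uE} => [|mu r IH].
  by exists [::] => e _; rewrite big_nil (lin0 (Delta_inv_linear e)).
rewrite big_cons; have [s1 h1] := fw mu _ (component_in Wsum u mu); have [s2 h2] := IH.
exists (s1 ++ s2) => e; rewrite mem_cat negb_or => /andP[/h1 e1 /h2 e2].
by rewrite (linD (Delta_inv_linear e)) e1 e2 addr0.
Qed.

End DeltaOperator.

(** * The parity map *)

Section ParityMap.
Variables (F : numClosedFieldType) (V : vertex_superalgebra F).
Implicit Types u v : V.

Lemma parity_map_linear : linear (@parity_map F V).
Proof.
have cl := component_linear (@parity_direct_sum F V).
by move=> c u v; rewrite /parity_map !cl scalerBr opprD addrACA.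
Qed.

Lemma parity_map_sign p u : parity p u -> parity_map u = (-1) ^+ p *: u.
Proof.
move=> pu; rewrite /parity_map !(component_single (@parity_direct_sum F V) _ pu).
by case: p pu => _; rewrite ?sub0r ?subr0 ?expr0 ?expr1 ?scaleN1r ?scale1r.
Qed.

Lemma parity_map_automorphism : automorphism_of_period (@parity_map F V) 2.
Proof.
have sub p : subspace (@parity F V p) by exact: (@parity_direct_sum F V).1.
split.
- exact: parity_map_linear.
- move=> u; have [u0 [u1 [p0 p1 ->]]] := parity_dec u.
  rewrite /= 2!(linD parity_map_linear) (parity_map_sign p0) (parity_map_sign p1).
  rewrite 2!(linZ parity_map_linear) (parity_map_sign p0) (parity_map_sign p1).
  by rewrite expr0 expr1 !scale1r scalerA mulrNN mulr1 scale1r.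
- by move=> p u pu; rewrite (parity_map_sign pu); apply: subspaceZ.
- by rewrite (parity_map_sign (vac_even V)) scale1r.
have hom p q u v e : parity p u -> parity q v ->
    parity_map (Y u v e) = Y (parity_map u) (parity_map v) e.
  move=> pu qv; rewrite (parity_map_sign (Y_parity e pu qv)) (parity_map_sign pu) (parity_map_sign qv).
  by rewrite (linZ (Y_linearl _ _)) (linZ (Y_linearr _ _)) scalerA signr_addb.
move=> u v e; have [u0 [u1 [p0 p1 ->]]] := parity_dec u.
have [v0 [v1 [q0 q1 ->]]] := parity_dec v.
have YD x x' y y' : Y (x + x') (y + y') e =
    Y x y e + Y x y' e + (Y x' y e + Y x' y' e).
  by rewrite (linD (Y_linearl _ _)) !(linD (Y_linearr _ _)).
rewrite (linD parity_map_linear u0) (linD parity_map_linear v0) 2!YD 3!(linD parity_map_linear).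
by rewrite (hom _ _ _ _ _ p0 q0) (hom _ _ _ _ _ p0 q1) (hom _ _ _ _ _ p1 q0) (hom _ _ _ _ _ p1 q1).
Qed.

End ParityMap.

(** * The parity-twisted module *)

Section ZsumRange.
Variables (F : numClosedFieldType) (M : lmodType F).

Lemma zsum_range (lo : int) n (f : int -> M) :
  (forall b, b < lo \/ lo + n%:Z <= b -> f b = 0) -> zsum f = \sum_(j < n) f (lo + j%:Z).
Proof.
move=> f0; rewrite /zsum (@fsum_seq _ _ [seq lo + j%:Z | j <- iota 0 n]).
- by rewrite big_map -{1}[n]subn0 big_mkord.
- by rewrite map_inj_uniq ?iota_uniq // => i j /addrI[].
move=> b nb; apply: f0; have [|lb] := ltP b lo; first by left.
right; rewrite leNgt; apply: contra nb => bn; apply/mapP.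
by exists (absz (b - lo)); rewrite ?mem_iota; lia.
Qed.

Lemma expand1_shift alpha (c : int) (f : int -> M) i :
  expand1 alpha (fun b => f (b + c)) i = expand1 (alpha - c%:~R) f i.
Proof.
case: i => i //=; rewrite -[RHS](zsum_shift c); apply: eq_zsum => b.
by rewrite rmorphD /=; congr (gbinom _ _ *: _); ring.
Qed.

End ZsumRange.

Section SigmaModule.
Variables (F : numClosedFieldType) (k : nat) (eta : F) (a : nat -> F).
Variables (V W : vertex_operator_superalgebra F) (tens : {ffun 'I_k -> V} -> W) (g : W -> W).
Variables (M : lmodType F) (parityM : bool -> set M) (Yg : W -> M -> series M).
Hypotheses (k_gt1 : (1 < k)%N) (k_even : ~~ odd k).
Hypothesis W_tensor : is_tensor_power_vosa tens.
Hypothesis g_cyclic : is_cyclic_permutation tens g.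
Hypothesis a_def : is_change_of_variable k a.
Hypothesis M_twisted : weak_twisted_module g k eta parityM Yg.

Local Notation Ys := (Y_sigma a tens Yg).
Local Notation fac0 := (at_factor tens 0).
Local Notation E := (@E F V a).
Local Notation kappa := (sqrtC k%:R : F).
Implicit Types (u v : V) (mu nu : int) (s : nat) (e : rat) (w : M).

Let k_gt0 : (0 < k)%N := ltnW k_gt1.
Let k0 : (k%:R : rat) != 0. Proof. by rewrite pnatr_eq0 -lt0n. Qed.
Let two0 : (2 : rat) != 0. Proof. by []. Qed.
Let Yg0l w e : Yg 0 w e = 0. Proof. exact: (lin0 (mod_Y_linearl M_twisted w e)). Qed.
Let Yg0r x e : Yg x 0 e = 0. Proof. exact: (lin0 (mod_Y_linearr M_twisted x e)). Qed.
Let fac0_linear : linear fac0. Proof. exact: (fac_linear W_tensor k_gt0). Qed.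
Let Ygf_linear w e : linear (fun u => Yg (fac0 u) w e).
Proof. by move=> c u v; rewrite fac0_linear (mod_Y_linearl M_twisted). Qed.

Lemma Y_sigma_supp u w e :
  fin_supp (fun d => Yg (fac0 (Delta_inv k a u d)) w (e / k%:R - d)).
Proof.
have [s sP] := Delta_inv_supp a k_gt1 u; exists s => d /sP ->.
exact: (lin0 (Ygf_linear _ _)).
Qed.

Lemma Y_sigma_linearl w e : linear (fun u => Ys u w e).
Proof.
move=> c u v; rewrite /Y_sigma /subst_pow -(fsum_lin _ (Y_sigma_supp _ _ _) (Y_sigma_supp _ _ _)).
by apply: eq_fsbigr => d _; rewrite (Delta_inv_linear a k_gt1) Ygf_linear.
Qed.

Lemma Y_sigma_linearr u e : linear (fun w => Ys u w e).
Proof.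
move=> c w w'; rewrite /Y_sigma /subst_pow -(fsum_lin _ (Y_sigma_supp _ _ _) (Y_sigma_supp _ _ _)).
by apply: eq_fsbigr => d _; rewrite (mod_Y_linearr M_twisted).
Qed.

Lemma Y_sigma_weight mu u w e S : weight_space mu u -> (forall s, (S <= s)%N -> E s u = 0) ->
  Ys u w e = \sum_(s < S) kappa ^ (mu - s%:Z *+ 2) *: Yg (fac0 (E s u)) w (e / k%:R - posD k mu s).
Proof.
move=> wu uS; rewrite /Y_sigma /subst_pow (@fsum_inj _ _ _ (posD k mu)).
- rewrite (@fsum_nat _ S) => [|s Ss]; last first.
    by rewrite (Delta_inv_weight a k_gt1 _ wu) uS // scaler0 (lin0 (Ygf_linear _ _)).
  apply: eq_bigr => s _.
  by rewrite (Delta_inv_weight a k_gt1 _ wu) (linZ (Ygf_linear _ _)).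
- exact: posD_inj.
move=> d nz; apply: contrapT => H; move/eqP: nz; apply.
rewrite (Delta_inv_weight0 a k_gt1 wu) ?(lin0 (Ygf_linear _ _)) // => s ds.
by apply: H; exists s.
Qed.

(** The exponents of [Y_sigma(u, x)] lie in [leading mu + Z]. *)
Definition leading mu : rat := (k%:R - 1) * mu%:~R / 2.

Lemma leading_posD mu s : posD k mu s = leading mu / k%:R - s%:R.
Proof. by rewrite /posD /ratio /leading; field; rewrite k0. Qed.

Lemma Y_sigma_weight_support mu u w e : weight_space mu u ->
  e - leading mu \isn't a Num.int -> Ys u w e = 0.
Proof.
move=> wu ne; have [S uS] := E_vanish a wu; rewrite (Y_sigma_weight _ _ wu uS).
rewrite big1 // => s _; rewrite (mod_Y_support M_twisted) ?scaler0 //.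
apply: contra ne; rewrite leading_posD.
have -> : k%:R * (e / k%:R - (leading mu / k%:R - s%:R)) = e - leading mu + (k * s)%N%:R.
  by rewrite natrM; field.
by rewrite rpredDr ?rpred_nat.
Qed.

(** This is where [k] has to be even. *)
Lemma leading_half mu : exists n : int, leading mu = n%:~R + mu%:~R / 2.
Proof.
have [h kE] : exists h, k = h.*2 by exists k./2; rewrite even_halfK.
exists (h%:Z * mu - mu).
by rewrite /leading kE -mul2n natrM rmorphB rmorphM /=; field.
Qed.

(** Properties of [Y_sigma(u, x)] that are additive in [u] need only be checked
    on weight vectors. *)
Lemma weight_ind (P : V -> Prop) : P 0 -> (forall u v, P u -> P v -> P (u + v)) ->
  (forall mu u, weight_space mu u -> P u) -> forall u, P u.
Proof.
move=> P0 PD Pw u; have [s ->] := comp_sum u.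
elim/big_ind: _ => // mu _; apply: Pw.
exact: (component_in (@weight_direct_sum F V)).
Qed.

Lemma parity_weight_ind p (P : V -> Prop) : P 0 -> (forall u v, P u -> P v -> P (u + v)) ->
  (forall mu u, odd (absz mu) = p -> weight_space mu u -> P u) -> forall u, parity p u -> P u.
Proof.
move=> P0 PD Pw u /parity_weight_sum[s [c [cw cp ->]]].
elim/big_ind: _ => // mu _; have [e|ne] := eqVneq (odd (absz mu)) p; first exact: (Pw mu).
by rewrite cp //; apply/eqP.
Qed.

Lemma Y_sigma_support u w : in_root_series 2 (Ys u w).
Proof.
move=> e; elim/weight_ind: u => [|u v hu hv|mu u wu] ne.
- exact: (lin0 (Y_sigma_linearl _ _)).
- by rewrite (linD (Y_sigma_linearl _ _)) hu // hv // addr0.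
apply: (Y_sigma_weight_support _ wu); apply: contra ne => ie.
have [n hn] := leading_half mu.
have -> : 2%:R * e = 2%:R * (e - leading mu) + 2%:R * n%:~R + mu%:~R by rewrite hn; field.
by rewrite !rpredD ?rpredM // ?rpred_nat ?rpred_int.
Qed.

Lemma Y_sigma_parity p q u w e : parity p u -> parityM q w -> parityM (p (+) q) (Ys u w e).
Proof.
move=> + qw; have sub := (mod_parity_direct_sum M_twisted).1 (p (+) q).
elim/parity_weight_ind: u / => [|u v hu hv|mu u mup wu].
- by rewrite (lin0 (Y_sigma_linearl _ _)); case: sub.
- by rewrite (linD (Y_sigma_linearl _ _)); apply: subspaceD.
have [S uS] := E_vanish a wu; rewrite (Y_sigma_weight _ _ wu uS).
apply: subspace_sum => // s; apply: subspaceZ => //; apply: (mod_Y_parity M_twisted) => //.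
apply: (fac_parity k_gt0 W_tensor); rewrite -mup.
have -> : odd (absz mu) = odd (absz (mu - s%:Z *+ 2)) by rewrite mulr2n; lia.
exact/weight_parity/weight_E.
Qed.

Lemma bound_fin (n : nat) (Q : nat -> nat -> Prop) :
  (forall i B B', (B <= B')%N -> Q i B -> Q i B') ->
  (forall i, exists B, Q i B) -> exists B, forall i, (i < n)%N -> Q i B.
Proof.
move=> mono QB; elim: n => [|n [B IH]]; first by exists 0%N.
have [B' QB'] := QB n; exists (maxn B B') => i; rewrite ltnS leq_eqVlt => /orP[/eqP ->|lt].
  exact: (mono _ _ _ (leq_maxr _ _)).
exact: (mono _ _ _ (leq_maxl _ _) (IH _ lt)).
Qed.

Definition truncated (f : rat -> M) (N : nat) : Prop := forall e, e < - N%:R -> f e = 0.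

Lemma truncated_widen f N N' : (N <= N')%N -> truncated f N -> truncated f N'.
Proof.
move=> NN' fN e eN; apply: fN; apply: (lt_le_trans eN).
by rewrite lerN2 ler_nat.
Qed.

Lemma Y_sigma_truncation u w : exists N, truncated (Ys u w) N.
Proof.
elim/weight_ind: u => [|u v [N uN] [N' vN']|mu u wu].
- by exists 0%N => e _; exact: (lin0 (Y_sigma_linearl _ _)).
- exists (maxn N N') => e eN; rewrite (linD (Y_sigma_linearl _ _)).
  by rewrite (truncated_widen (leq_maxl _ _) uN eN) (truncated_widen (leq_maxr _ _) vN' eN) addr0.
have [S uS] := E_vanish a wu.
have [B hB] := @bound_fin S (fun s => truncated (Yg (fac0 (E s u)) w))
  (fun s N N' => @truncated_widen _ N N')
  (fun s => truncation_nat (mod_Y_truncation M_twisted (fac0 (E s u)) w)).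
pose D := Num.bound (`|leading mu| + k%:R * (B + S)%N%:R).
exists D => e eD; rewrite (Y_sigma_weight _ _ wu uS) big1 // => s _.
rewrite hB ?scaler0 // leading_posD.
have -> : e / k%:R - (leading mu / k%:R - s%:R) = (e - leading mu) / k%:R + s%:R by field.
rewrite -ltrBrDr ltr_pdivrMr ?ltr0n //.
have bD : `|leading mu| + k%:R * (B + S)%N%:R < D%:R by apply: archi_boundP; apply: addr_ge0 => //; apply: mulr_ge0.
have sS : (s%:R : rat) <= S%:R by rewrite ler_nat ltnW.
have l1 : - leading mu <= `|leading mu| by rewrite -normrN ler_norm.
have kS : k%:R * s%:R <= k%:R * S%:R :> rat by rewrite ler_wpM2l.
rewrite natrD mulrDr in bD.
have e1 : e - leading mu < - D%:R + `|leading mu| by apply: ltr_leD.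
apply: (lt_le_trans e1); rewrite mulrBl mulNr ![_ * k%:R]mulrC.
rewrite -subr_ge0; have -> : - (k%:R * B%:R) - k%:R * s%:R - (- D%:R + `|leading mu|) =
   (D%:R - (`|leading mu| + (k%:R * B%:R + k%:R * S%:R))) + (k%:R * S%:R - k%:R * s%:R) :> rat by ring.
by rewrite addr_ge0 ?subr_ge0 // ltW.
Qed.

Lemma Y_sigma_vac w e : Ys (vac V) w e = (e == 0)%:R *: w.
Proof.
have w0 : weight_space 0 (vac V).
  by apply: eigen_weight; rewrite Lop_vac mul0r scale0r.
have vS s : (1 <= s)%N -> E s (vac V) = 0 by case: s => // s _; rewrite E_vac.
rewrite (Y_sigma_weight _ _ w0 vS) big_ord1 E_0.
have -> : 0 - 0%N%:Z *+ 2 = 0 :> int by [].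
rewrite expr0z scale1r.
rewrite (fac_vac W_tensor) (mod_Y_vac M_twisted).
have -> : posD k 0 0 = 0 by rewrite /posD (_ : 0%:~R = 0) // mulr0 subr0.
rewrite subr0.
by rewrite mulf_eq0 invr_eq0 (negbTE k0) orbF.
Qed.

Lemma pmul_linear_map (U U' : lmodType F) (h : U -> U') (p : {poly F}) (f : int -> U) i :
  linear h -> pmul p (fun j => h (f j)) i = h (pmul p f i).
Proof. by move=> hl; rewrite (lin_sum hl); apply: eq_bigr => j _; rewrite (linZ hl). Qed.

Lemma pmul_cov_small m d (r : int) : r < m%:Z -> pmul (cov F k ^+ m) (binf d) r = 0.
Proof.
move=> rm; rewrite covE exprMn pmulM pmul_Xn.
by apply: (zbelow_pmul _ (binf_below d)); rewrite subr_lt0.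
Qed.

Section OnWeightVectors.
Variables (mu nu : int) (u v : V) (w : M) (c : rat).
Hypotheses (wu : weight_space mu u) (wv : weight_space nu v).

Let p := odd (absz mu).
Let q := odd (absz nu).

(** The two products and the iterate at a fixed total degree [c]. *)
Definition sigma_uv (b : int) : M :=
  Ys u (Ys v w (c - leading mu - b%:~R)) (leading mu + b%:~R).
Definition sigma_vu (b : int) : M :=
  (-1) ^+ (p && q) *: Ys v (Ys u w (leading mu + b%:~R)) (c - leading mu - b%:~R).
Definition sigma_iterate (j : int) : M := Ys (Y u v j%:~R) w (c - j%:~R).

Let C r l : rat := c - leading mu - leading nu + (k * r)%N%:R + (k * l)%N%:R.
Let coef r l : F := kappa ^ (mu - r%:Z *+ 2) * kappa ^ (nu - l%:Z *+ 2).
Let UV r l := prod_uv tens Yg (E r u) (E l v) w (C r l).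
Let VU r l := prod_vu tens Yg p q (E r u) (E l v) w (C r l).
Let IT r l := iterate_uv tens g Yg (E r u) (E l v) w (C r l) 0.

Let pE r : parity p (E r u).
Proof.
have -> : p = odd (absz (mu - r%:Z *+ 2)) by rewrite /p mulr2n; lia.
exact/weight_parity/weight_E.
Qed.

Let qE l : parity q (E l v).
Proof.
have -> : q = odd (absz (nu - l%:Z *+ 2)) by rewrite /q mulr2n; lia.
exact/weight_parity/weight_E.
Qed.

Variables (S : nat) (N0 : int).
Hypotheses (uS : forall s, (S <= s)%N -> E s u = 0) (vS : forall s, (S <= s)%N -> E s v = 0).
Hypothesis N0P : forall m (x : V), m < N0 -> weight_space m x -> x = 0.

(* below [- N], the weight [mu + nu + 2 m] lies under the bound [N0] *)
Let N := (absz mu + absz nu + absz N0 + 1)%N.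

Let Ybound r l (m : int) : m - r%:Z - l%:Z < - N%:Z -> Y (E r u) (E l v) m%:~R = 0.
Proof.
move=> mN; apply: (N0P _ (weight_Y m (weight_E a r wu) (weight_E a l wv))).
by move: mN; rewrite /N !mulr2n; lia.
Qed.

Let Ybound' r l (m : int) : m < - N%:Z -> Y (E r u) (E l v) m%:~R = 0.
Proof. by move=> mN; apply: Ybound; lia. Qed.

Lemma sigma_uvE b : sigma_uv b =
  \sum_(r < S) \sum_(l < S) coef r l *: UV r l (b + (k * r)%N%:Z).
Proof.
rewrite /sigma_uv (Y_sigma_weight _ _ wu uS); apply: eq_bigr => r _.
rewrite (Y_sigma_weight _ _ wv vS) (lin_sum (mod_Y_linearr M_twisted _ _)) scaler_sumr.
apply: eq_bigr => l _; rewrite (linZ (mod_Y_linearr M_twisted _ _)) scalerA.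
congr (_ *: Yg _ (Yg _ _ _) _); rewrite leading_posD /C !(rmorphD, natrM) /= ?natrM; by field.
Qed.

Lemma sigma_vuE b : sigma_vu b =
  \sum_(r < S) \sum_(l < S) coef r l *: VU r l (b + (k * r)%N%:Z).
Proof.
rewrite /sigma_vu (Y_sigma_weight _ _ wv vS) scaler_sumr exchange_big; apply: eq_bigr => l _.
rewrite (Y_sigma_weight _ _ wu uS) (lin_sum (mod_Y_linearr M_twisted _ _)) !scaler_sumr.
apply: eq_bigr => r _; rewrite (linZ (mod_Y_linearr M_twisted _ _)) !scalerA.
congr (_ *: Yg _ (Yg _ _ _) _).
- by rewrite /coef; ring.
- by rewrite leading_posD /C !(rmorphD, natrM) /= ?natrM; field.
by rewrite leading_posD /C !(rmorphD, natrM) /= ?natrM; field.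
Qed.

(** Locality is inherited because the poles of all the products
    [Y(E_r u, z) E_l v] are bounded by the same [N]. *)
Lemma sigma_local b :
  pmul (('X - 1) ^+ N) sigma_uv b = pmul (('X - 1) ^+ N) sigma_vu b.
Proof.
rewrite (eq_pmul _ sigma_uvE) (eq_pmul _ sigma_vuE) !pmulf_sum; apply: eq_bigr => r _.
rewrite !pmulf_sum; apply: eq_bigr => l _; rewrite 2!pmulfZ; congr (_ *: _).
rewrite (pmul_shift _ (UV r l)) (pmul_shift _ (VU r l)).
exact: (prod_local k_gt0 W_tensor g_cyclic M_twisted w (C r l) (pE r) (qE l) (@Ybound' r l)).
Qed.

Lemma sigma_uv_above : exists B, zabove B sigma_uv.
Proof.
have [B vB] := Y_sigma_truncation v w.
pose D := Num.bound (`|c - leading mu| + B%:R).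
exists D => b bD; rewrite /sigma_uv vB ?(lin0 (Y_sigma_linearr _ _)) //.
have h : `|c - leading mu| + B%:R < D%:R by apply: archi_boundP; apply: addr_ge0.
have h2 : D%:R <= b%:~R :> rat by rewrite -[D%:R]/(D%:Z%:~R) ler_int.
rewrite ltrBlDr [- _ + b%:~R]addrC ltrBrDr; apply: le_lt_trans (lt_le_trans h h2).
by rewrite lerD2r ler_norm.
Qed.

Lemma sigma_vu_below : exists B, zbelow B sigma_vu.
Proof.
have [B uB] := Y_sigma_truncation u w.
pose D := Num.bound (`|leading mu| + B%:R).
exists D => b bD; rewrite /sigma_vu uB ?(lin0 (Y_sigma_linearr _ _)) ?scaler0 //.
have h : `|leading mu| + B%:R < D%:R by apply: archi_boundP; apply: addr_ge0.
have h2 : b%:~R < - D%:R :> rat by rewrite -[D%:R]/(D%:Z%:~R) -rmorphN ltr_int.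
rewrite -ltrBrDl; apply: (lt_trans h2); rewrite -opprD ltrN2 addrC.
by apply: le_lt_trans h; rewrite lerD2r ler_norm.
Qed.

Let IT_below r l m : m < - N%:Z -> IT r l m = 0.
Proof.
move=> mN; rewrite /IT (iterate_0 g Yg k_gt0 W_tensor _ _ (pE r) (qE l)).
by rewrite Ybound' // (lin0 (Ygf_linear _ _)).
Qed.

Let pm r (m : nat) (i : nat) : F := pmul (covW F k ^+ m) (binf (dexp F k mu r)) i.

(** Replacing [x_1] and [x_2] by their [k]-th powers turns the expansion of
    [expand1_twisted] in the [k]-th root of [rho] into one in [rho] itself; the
    shift by [leading mu] and by [k r] adds up to the exponent [dexp]. *)
Lemma expand1_sigma (i : nat) :
  expand1 (ratr (leading mu)) (pmul (('X^k - 1) ^+ N) sigma_uv) i =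
  \sum_(r < S) \sum_(l < S) coef r l *: \sum_(m < i.+1) pm r m i *: IT r l (m%:Z - N%:Z).
Proof.
pose G (r l : nat) b := pmul (('X^k - 1) ^+ N) (UV r l) (b + (k * r)%N%:Z).
have GE b : pmul (('X^k - 1) ^+ N) sigma_uv b = \sum_(r < S) \sum_(l < S) coef r l *: G r l b.
  rewrite (eq_pmul _ sigma_uvE) pmulf_sum; apply: eq_bigr => r _.
  by rewrite pmulf_sum; apply: eq_bigr => l _; rewrite pmulfZ (pmul_shift _ (UV r l)).
have Gsupp (r l : nat) : exists K, zsupp K (G r l).
  have [K GK] := prod_supp k_gt0 W_tensor g_cyclic M_twisted w (C r l) (pE r) (qE l) (@Ybound' r l).
  by exists (K + k * r)%N => b bK; apply: GK; lia.
have [K GK] : exists K, forall r, (r < S)%N -> forall l, (l < S)%N -> zsupp K (G r l).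
  apply: (@bound_fin S (fun r K => forall l, (l < S)%N -> zsupp K (G r l))) => [r B B' BB h l lS|r].
    exact: zsupp_widen (h l lS).
  by apply: (@bound_fin S (fun l K => zsupp K (G r l))) => // l B B'; apply: zsupp_widen.
have GK' (r l : 'I_S) : zsupp K (fun b => coef r l *: G r l b).
  by move=> b bK; rewrite GK ?scaler0.
rewrite (eq_expand1 _ _ GE) (@expand1_sum _ _ _ _ K) => [|r b bK]; last first.
  by rewrite big1 // => l _; exact: GK'.
apply: eq_bigr => r _; rewrite (@expand1_sum _ _ _ _ K) => [|l]; last exact: GK'.
apply: eq_bigr => l _; rewrite (@expand1Z _ _ _ K); last exact: GK.
congr (_ *: _); rewrite /G (expand1_shift _ _ (pmul (('X^k - 1) ^+ N) (UV r l))).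
rewrite (expand1_twisted k_gt0 W_tensor g_cyclic M_twisted w (C r l) (pE r) (qE l) (@Ybound' r l)).
apply: eq_bigr => m _; congr (pmul _ (binf _) _ *: _).
rewrite /dexp /leading !rmorphM /= rmorphB /= !fmorphV /= !ratr_nat ratr_int -!pmulrn; ring.
Qed.

(** The series [Y_g(x^1, z) w] read at the exponents that occur in the iterate. *)
Let Phi (t : int) (x : V) : M := Yg (fac0 x) w ((c - leading mu - leading nu) / k%:R - t%:~R).

Let Phi_linear t : linear (Phi t).
Proof. exact: Ygf_linear. Qed.

(** The iterate, its terms arranged by the exponent [t - N] that indexes [Phi]
    instead of by the index [s] of [E]. *)
Let sigma_iterateE (i : nat) (j : int) : j <= i%:Z -> sigma_iterate j =
  \sum_(t < N + i.+1) kappa ^ (mu + nu + (t%:Z - N%:Z) *+ 2) *: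
     Phi (t%:Z - N%:Z) (Ez a (j - (t%:Z - N%:Z)) (Y u v j%:~R)).
Proof.
move=> ji; have wY := weight_Y j wu wv.
pose f (t : int) := kappa ^ (mu + nu + t *+ 2) *: Phi t (Ez a (j - t) (Y u v j%:~R)).
have f_hi t : j < t -> f t = 0.
  move=> jt; rewrite /f; case jtE: (j - t) => [s|s]; first lia.
  by rewrite /= (lin0 (Phi_linear t)) scaler0.
have E0 s : j - s%:Z < - N%:Z -> E s (Y u v j%:~R) = 0.
  move=> sN; apply: (N0P _ (weight_E a s wY)).
  by move: sN; rewrite /N !mulr2n; lia.
have f_lo t : t < - N%:Z -> f t = 0.
  move=> tN; rewrite /f; case jtE: (j - t) => [s|s] /=; last by rewrite (lin0 (Phi_linear t)) scaler0.
  by rewrite E0 ?(lin0 (Phi_linear t)) ?scaler0 //; lia.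
pose S' := (absz j + N + 1)%N.
rewrite /sigma_iterate (Y_sigma_weight _ _ wY (S := S')) => [|s sS]; last by apply: E0; rewrite /S' in sS; lia.
transitivity (\sum_(s < S') f (j - s%:Z)).
  apply: eq_bigr => s _; rewrite /f subKr /=.
  congr (_ ^ _ *: Yg _ _ _); first by rewrite !mulr2n; lia.
  rewrite leading_posD /leading !(rmorphD, rmorphN, rmorphMn) /= mulr2n; by field.
rewrite (reindex_inj rev_ord_inj) /=.
transitivity (zsum f).
  rewrite (@zsum_range _ _ (j - S'%:Z + 1) S') => [|b].
    by apply: eq_bigr => s _; congr f; have := ltn_ord s; lia.
  by case=> h; [apply: f_lo; rewrite /S' in h; lia|apply: f_hi; lia].
rewrite (@zsum_range _ _ (- N%:Z) (N + i.+1)) => [|b].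
  by apply: eq_bigr => t _; rewrite [- _ + _]addrC.
by case=> h; [apply: f_lo|apply: f_hi; lia].
Qed.

Let pmul_covW (U : lmodType F) m (f : int -> U) b :
  pmul (covW F k ^+ m) f b = k%:R ^+ m *: pmul (cov F k ^+ m) f b.
Proof. by rewrite (covWE _ k_gt0) exprZn -mul_polyC pmulM pmulC. Qed.

(** The same expression arises from conjugating the iterate by [E_Y_cov]. *)
Lemma pmul_covW_iterate (i : nat) : pmul (covW F k ^+ N) sigma_iterate i =
  \sum_(r < S) \sum_(l < S) coef r l *: \sum_(m < i.+1) pm r m i *: IT r l (m%:Z - N%:Z).
Proof.
pose pc (r : nat) m : F := pmul (cov F k ^+ m) (binf (dexp F k mu r)) i.
pose G (r l : nat) (m : int) : M := (kappa ^ (mu + nu + (m - r%:Z - l%:Z) *+ 2) * k%:R ^+ N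
  * pc r (absz (N%:Z + m))) *: IT r l m.
have G_hi (r l : nat) m : i%:Z < N%:Z + m -> G r l m = 0.
  by move=> im; rewrite /G /pc pmul_cov_small ?mulr0 ?scale0r //; lia.
have G_lo (r l : nat) m : m < - N%:Z -> G r l m = 0.
  by move=> mN; rewrite /G IT_below // scaler0.
have G_lo' (r l : nat) m : m - r%:Z - l%:Z < - N%:Z -> G r l m = 0.
  move=> mN; rewrite /G /IT (iterate_0 g Yg k_gt0 W_tensor _ _ (pE r) (qE l)).
  by rewrite Ybound // (lin0 (Ygf_linear _ _)) scaler0.
transitivity (\sum_(t < N + i.+1) \sum_(r < S) \sum_(l < S) G r l (t%:Z - N%:Z + r%:Z + l%:Z)).
  pose f (j : int) := \sum_(t < N + i.+1) kappa ^ (mu + nu + (t%:Z - N%:Z) *+ 2) *: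
     Phi (t%:Z - N%:Z) (Ez a (j - (t%:Z - N%:Z)) (Y u v j%:~R)).
  transitivity (pmul (covW F k ^+ N) f i).
    apply: eq_bigr => j _; congr (_ *: _); apply: sigma_iterateE; lia.
  rewrite pmulf_sum; apply: eq_bigr => t _; set tau := t%:Z - N%:Z.
  rewrite pmulfZ (pmul_linear_map _ (fun j => Ez a (j - tau) (Y u v j%:~R)) _ (Phi_linear tau)).
  rewrite pmul_covW (E_Y_cov k_gt0 (cov_exps_ad_field k_gt0 a_def) tau wu uS vS (@Ybound')).
  rewrite (linZ (Phi_linear tau)) scalerA (lin_sum (Phi_linear tau)) scaler_sumr.
  apply: eq_bigr => r _; rewrite (lin_sum (Phi_linear tau)) scaler_sumr.
  apply: eq_bigr => l _; rewrite (linZ (Phi_linear tau)) scalerA /G.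
  have -> : tau + r%:Z + l%:Z - r%:Z - l%:Z = tau by ring.
  congr (_ *: _); rewrite /IT (iterate_0 g Yg k_gt0 W_tensor _ _ (pE r) (qE l)) /Phi.
  congr (Yg _ _ _); rewrite /C !(rmorphD, natrM) /= ?natrM; by field.
rewrite exchange_big; apply: eq_bigr => r _; rewrite exchange_big; apply: eq_bigr => l _.
transitivity (zsum (G r l)).
  rewrite -(zsum_shift (r%:Z + l%:Z)) (@zsum_range _ _ (- N%:Z) (N + i.+1)) => [|b].
    by apply: eq_bigr => t _; congr G; ring.
  by case=> h; [apply: G_lo'; lia|apply: G_hi; lia].
rewrite (@zsum_range _ _ (- N%:Z) i.+1) => [|b]; last first.
  by case=> h; [apply: G_lo|apply: G_hi; lia].
rewrite scaler_sumr; apply: eq_bigr => m _; rewrite /G addNKr [- _ + _]addrC /= !scalerA.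
congr (_ *: _); rewrite /pm pmul_covW mulrA /coef; congr (_ * _).
have kappa0 := @kappa_neq0 F k k_gt1.
have kE (n : nat) : k%:R ^+ n = kappa ^ (n%:Z *+ 2).
  by rewrite -[n%:Z *+ 2]mulr_natl -exprz_exp -[kappa ^ _]/(kappa ^+ 2) sqrtCK.
by rewrite !kE -!expfzDr //; congr (_ ^ _); ring.
Qed.

Let sigma_iterate_below : zbelow N sigma_iterate.
Proof.
move=> j jN; rewrite /sigma_iterate -(E_0 a u) -(E_0 a v) Ybound' //.
exact: (lin0 (Y_sigma_linearl _ _)).
Qed.

(** By [jacobi1P], it remains to find the expansion at [rho = 1 + t] of
    [(rho - 1)^N] times the product.  The two previous lemmas give it after
    multiplication by [((rho^k - 1)/(rho - 1))^N], whose value at [rho = 1] is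
    [k^N]: this factor can be cancelled. *)
Lemma sigma_jacobi1 (n e : int) :
  jacobi1 (ratr (leading mu)) sigma_uv sigma_vu sigma_iterate n e.
Proof.
have [B1 uvB] := sigma_uv_above; have [B2 vuB] := sigma_vu_below.
move: n e; apply/(@jacobi1P _ _ N (maxn B1 B2) _ sigma_uv sigma_vu sigma_iterate) => [b bB|b bB|||i].
- by apply: uvB; lia.
- by apply: vuB; lia.
- exact: sigma_iterate_below.
- exact: sigma_local.
pose q1 : {poly F} := \sum_(j < k) 'X^j.
pose p1 : {poly F} := (q1 ^+ N) \Po (1 + 'X).
pose G := pmul (('X - 1) ^+ N) sigma_uv.
pose J (j : int) : M := sigma_iterate (j - N%:Z).
have GK : zsupp (maxn B2.+1 (B1 + size (('X - 1) ^+ N : {poly F}))) G.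
  apply: zsuppP; last exact: zabove_pmul uvB.
  by move=> b bB; rewrite /G sigma_local; apply: (zbelow_pmul _ vuB).
have p10 : p1`_0 != 0.
  rewrite -horner_coef0 horner_comp !hornerE horner_sum expf_neq0 //.
  rewrite (eq_bigr (fun=> 1)) => [|j _]; last by rewrite hornerXn ?hornerE expr1n.
  by rewrite sumr_const card_ord k_neq0.
have covWq : covW F k ^+ N = p1 * 'X^N.
  have -> : covW F k = ('X^k - 1) \Po (1 + 'X).
    by rewrite comp_polyB comp_Xn_poly -polyC1 comp_polyC polyC1.
  rewrite (XnB1 _ k_gt0) rmorphM exprMn /p1 rmorphXn /=; congr (_ * _ ^+ _).
  by rewrite comp_polyB comp_polyX -polyC1 comp_polyC polyC1 addrC addKr.
have J0 : zbelow 0 J by move=> j j0; apply: sigma_iterate_below; lia.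
have E0 : zbelow 0 (expand1 (ratr (leading mu)) G) by case.
apply: (pmul_inj p10 E0 J0) => {}i.
rewrite -(expand1_pmul _ (q1 ^+ N) _ GK) -/J.
have [i0|] := ltP i 0.
  by rewrite (zbelow_pmul p1 J0) //; case: i i0.
case: i => // i _.
transitivity (expand1 (ratr (leading mu)) (pmul (('X^k - 1) ^+ N) sigma_uv) i).
  by apply: eq_expand1 => b; rewrite /G (XnB1 _ k_gt0) exprMn pmulM.
rewrite expand1_sigma -pmul_covW_iterate covWq pmulM.
by apply: eq_pmul => b; rewrite pmul_Xn.
Qed.

End OnWeightVectors.

Lemma fsum_linear (T : choiceType) (U : lmodType F) (c : T -> F) (f : T -> U -> M) :
  (forall i, linear (f i)) -> (forall x, fin_supp (f^~ x)) ->
  linear (fun x => \sum_(i \in [set: T]) c i *: f i x).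
Proof.
move=> fl fs b x y; have supp z : fin_supp (fun i => c i *: f i z).
  by have [s sP] := fs z; exists s => i /sP ->; rewrite scaler0.
rewrite -(fsum_lin _ (supp x) (supp y)); apply: eq_fsbigr => i _.
by rewrite fl scalerDr !scalerA mulrC.
Qed.

(** Only finitely many [i] keep [e - i] above a lower bound. *)
Lemma truncated_supp (U : lmodType F) (f : rat -> U) N (e : rat) (h : nat -> U -> M) :
  (forall d, d < - N%:R -> f d = 0) -> (forall i, h i 0 = 0) ->
  fin_supp (fun i : nat => h i (f (e - i%:R))).
Proof.
move=> fN h0; pose B := Num.bound (`|e| + N%:R); exists (iota 0 B) => i.
rewrite mem_iota add0n /= -leqNgt => Bi; rewrite fN ?h0 //.
have b : `|e| + N%:R < B%:R by apply: archi_boundP; apply: addr_ge0.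
have Bi' : B%:R <= i%:R :> rat by rewrite ler_nat.
rewrite ltrBlDr [- _ + _]addrC ltrBrDr; apply: le_lt_trans (lt_le_trans b Bi').
by rewrite lerD2r ler_norm.
Qed.

Section Jacobi.
Variables (w : M) (n : int) (e1 e2 : rat).

(** The three sums of the Jacobi identity, for the exponents [-n-1], [e1], [e2]. *)
Definition sum_uv u v : M := \sum_(i \in [set: nat])
  ((-1) ^+ i * gbinom n%:~R i) *: Ys u (Ys v w (e2 - i%:R)) (e1 - n%:~R + i%:R).
Definition sum_vu u v : M := \sum_(i \in [set: nat])
  ((-1) ^ n * ((-1) ^+ i * gbinom n%:~R i)) *: Ys v (Ys u w (e1 - i%:R)) (e2 - n%:~R + i%:R).
Definition sum_iterate u v : M := \sum_(i \in [set: nat])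
  gbinom (- ratr e1 - 1) i *: Ys (Y u v (- n%:~R - 1 - i%:R)) w (e1 + e2 + i%:R + 1).

Let uv_supp u v : fin_supp (fun i : nat => Ys u (Ys v w (e2 - i%:R)) (e1 - n%:~R + i%:R)).
Proof.
have [N vN] := Y_sigma_truncation v w.
apply: (truncated_supp e2 (h := fun i x => Ys u x (e1 - n%:~R + i%:R)) vN) => i.
exact: (lin0 (Y_sigma_linearr _ _)).
Qed.

Let vu_supp u v : fin_supp (fun i : nat => Ys v (Ys u w (e1 - i%:R)) (e2 - n%:~R + i%:R)).
Proof.
have [N uN] := Y_sigma_truncation u w.
apply: (truncated_supp e1 (h := fun i x => Ys v x (e2 - n%:~R + i%:R)) uN) => i.
exact: (lin0 (Y_sigma_linearr _ _)).
Qed.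

Let it_supp u v : fin_supp (fun i : nat => Ys (Y u v (- n%:~R - 1 - i%:R)) w (e1 + e2 + i%:R + 1)).
Proof.
have [N uN] := truncation_nat (Y_truncation u v).
apply: (truncated_supp (- n%:~R - 1) (h := fun i x => Ys x w (e1 + e2 + i%:R + 1)) uN) => i.
exact: (lin0 (Y_sigma_linearl _ _)).
Qed.

Lemma sum_uv_linearl v : linear (fun u => sum_uv u v).
Proof. by apply: fsum_linear => [i|u]; [apply: Y_sigma_linearl|apply: uv_supp]. Qed.

Lemma sum_uv_linearr u : linear (sum_uv u).
Proof.
apply: fsum_linear => [i c v v'|v]; last exact: uv_supp.
by rewrite Y_sigma_linearl Y_sigma_linearr.
Qed.

Lemma sum_vu_linearl v : linear (fun u => sum_vu u v).
Proof.
pose f (i : nat) u := Ys v (Ys u w (e1 - i%:R)) (e2 - n%:~R + i%:R).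
apply: (fsum_linear _ (f := f)) => [i c u u'|u]; last exact: vu_supp.
by rewrite /f Y_sigma_linearl Y_sigma_linearr.
Qed.

Lemma sum_vu_linearr u : linear (sum_vu u).
Proof.
pose f (i : nat) v := Ys v (Ys u w (e1 - i%:R)) (e2 - n%:~R + i%:R).
by apply: (fsum_linear _ (f := f)) => [i|v]; [apply: Y_sigma_linearl|apply: vu_supp].
Qed.

Lemma sum_iterate_linearl v : linear (fun u => sum_iterate u v).
Proof.
apply: fsum_linear => [i c u u'|u]; last exact: it_supp.
by rewrite Y_linearl Y_sigma_linearl.
Qed.

Lemma sum_iterate_linearr u : linear (sum_iterate u).
Proof.
apply: fsum_linear => [i c v v'|v]; last exact: it_supp.
by rewrite Y_linearr Y_sigma_linearl.
Qed.

Lemma sigma_components_weight (mu nu : int) u v : weight_space mu u -> weight_space nu v ->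
  e1 - leading mu \is a Num.int ->
  sum_uv u v - (-1) ^+ (odd (absz mu) && odd (absz nu)) *: sum_vu u v = sum_iterate u v.
Proof.
move=> wu wv /intrP[x xE].
have e1E : e1 = leading mu + x%:~R by rewrite -xE addrC subrK.
have [S1 uS] := E_vanish a wu; have [S2 vS] := E_vanish a wv.
have [N0 N0P] := weight_lower_bound V.
pose S := maxn S1 S2.
have uS' s : (S <= s)%N -> E s u = 0 by move=> sS; apply: uS; lia.
have vS' s : (S <= s)%N -> E s v = 0 by move=> sS; apply: vS; lia.
have := sigma_jacobi1 w (e1 + e2 - n%:~R) wu wv uS' vS' N0P n x.
rewrite /jacobi1 /mul_hi /mul_lo /mul_bin.
have -> : \sum_(i \in [set: nat]) ((-1) ^+ i * gbinom n%:~R i) *: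
    sigma_uv mu u v w (e1 + e2 - n%:~R) (x - n + i%:Z) = sum_uv u v.
  apply: eq_fsbigr => i _; rewrite /sigma_uv e1E.
  by congr (_ *: Ys _ (Ys _ _ _) _); rewrite !(rmorphD, rmorphN) /=; ring.
have -> : (-1) ^ n *: \sum_(i \in [set: nat]) ((-1) ^+ i * gbinom n%:~R i) *:
    sigma_vu mu nu u v w (e1 + e2 - n%:~R) (x - i%:Z) =
    (-1) ^+ (odd (absz mu) && odd (absz nu)) *: sum_vu u v.
  have vuE i : sigma_vu mu nu u v w (e1 + e2 - n%:~R) (x - i%:Z) =
      (-1) ^+ (odd (absz mu) && odd (absz nu)) *:
      Ys v (Ys u w (e1 - i%:R)) (e2 - n%:~R + i%:R).
    rewrite /sigma_vu e1E.
    by congr (_ *: Ys _ (Ys _ _ _) _); rewrite !(rmorphD, rmorphN) /=; ring.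
  have [s sP] := vu_supp u v; have us := undup_uniq s.
  rewrite /sum_vu !(fsum_seq us) => [|i|i]; last 2 first.
  - by rewrite mem_undup => /sP ->; rewrite scaler0.
  - by rewrite mem_undup vuE => /sP ->; rewrite !scaler0.
  rewrite !scaler_sumr; apply: eq_bigr => i _; rewrite vuE !scalerA; congr (_ *: _); ring.
move=> ->; apply: eq_fsbigr => i _; rewrite /sigma_iterate; congr (gbinom _ _ *: Ys (Y _ _ _) _ _).
- by rewrite e1E rmorphD /= ratr_int.
- by rewrite !(rmorphD, rmorphN) /=; ring.
by rewrite !(rmorphD, rmorphN) /=; ring.
Qed.

(** The factor on the right is the average over the two branches [j], to which
    [parity_map] and the exponent [b / 2] contribute the sign [(-1)^(j (p + b))].
    Where it vanishes, [leading_half] excludes the exponent from [Y_sigma(u, x_1)]. *)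
Lemma sigma_components p q (b : int) u v : parity p u -> parity q v -> e1 = b%:~R / 2 ->
  sum_uv u v - (-1) ^+ (p && q) *: sum_vu u v = (odd (absz b) == p)%:R *: sum_iterate u v.
Proof.
move=> pu + eb.
elim/parity_weight_ind: v / => [|v v' hv hv'|nu v nuq wv].
- rewrite (lin0 (sum_uv_linearr u)) (lin0 (sum_vu_linearr u)) (lin0 (sum_iterate_linearr u)).
  by rewrite !scaler0 subr0.
- rewrite (linD (sum_uv_linearr u)) (linD (sum_vu_linearr u)) (linD (sum_iterate_linearr u)).
  by rewrite !scalerDr opprD addrACA hv hv'.
elim/parity_weight_ind: u / pu => [|u u' hu hu'|mu u mup wu].
- rewrite (lin0 (sum_uv_linearl v)) (lin0 (sum_vu_linearl v)) (lin0 (sum_iterate_linearl v)).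
  by rewrite !scaler0 subr0.
- rewrite (linD (sum_uv_linearl v)) (linD (sum_vu_linearl v)) (linD (sum_iterate_linearl v)).
  by rewrite !scalerDr opprD addrACA hu hu'.
have [m lE] := leading_half mu.
have e1int : (e1 - leading mu \is a Num.int) = (odd (absz b) == p).
  have -> : e1 - leading mu = (b - mu)%:~R / 2 - m%:~R.
    by rewrite eb lE rmorphB /=; ring.
  rewrite rpredBr ?rpred_int // -mup; apply/idP/eqP => [/intrP[x xE]|h].
    have xE' : b - mu = x *+ 2.
      by apply: intrat_inj; rewrite rmorphMn /= -xE -mulr_natr divfK.
    by move: xE'; rewrite mulr2n; lia.
  have [x xE] : exists x, b - mu = x *+ 2.
    by exists ((b - mu) %/ 2)%Z; rewrite mulr2n; lia.
  by rewrite xE rmorphMn /= -mulr_natr mulfK // rpred_int.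
have [bp|nbp] := boolP (odd (absz b) == p).
  by rewrite scale1r -mup -nuq sigma_components_weight // e1int.
have Y0 d w' : d \is a Num.int -> Ys u w' (e1 + d) = 0.
  move=> dint; apply: (Y_sigma_weight_support _ wu); rewrite addrAC rpredDr //.
  by rewrite e1int.
rewrite scale0r /sum_uv /sum_vu fsbig1 => [|i _]; last first.
  by rewrite -addrA Y0 ?scaler0 // rpredD ?rpredN ?rpred_int ?rpred_nat.
rewrite fsbig1 ?scaler0 ?subr0 // => i _.
by rewrite Y0 ?rpredN ?rpred_nat // (lin0 (Y_sigma_linearr _ _)) scaler0.
Qed.

End Jacobi.

Lemma sigma_twisted_jacobi :
  twisted_jacobi (@parity F V) (@Y F V) Ys (@parity_map F V) 2 (-1).
Proof.
move=> p q u v w pu qv e0 e1 e2.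
have m1 : (-1 : F) ^+ 2 = 1 by rewrite sqrrN expr1n.
have [[b e1E]|ne1] := pselect (exists b : int, e1 = b%:~R / 2%:R); last first.
  have e1n b : e1 <> b%:~R / 2%:R by move=> h; apply: ne1; exists b.
  rewrite big1 ?scaler0 => [|j _]; last exact: (mul_delta_10_nonint _ _ _ _ _ _ e1n).
  have [[n ->]|ne0] := pselect (exists n : int, e0 = - n%:~R - 1); last first.
    have e0n n : e0 <> - n%:~R - 1 by move=> h; apply: ne0; exists n.
    by rewrite (mul_delta_12_nonint _ _ _ e0n) (mul_delta_21_nonint _ _ _ e0n) scaler0 subr0.
  have Y0 d w' : d \is a Num.int -> Ys u w' (e1 + d) = 0.
    move=> /intrP[d' ->]; apply: Y_sigma_support; apply/negP => /intrP[x xE].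
    by apply: (e1n (x - d' *+ 2)); rewrite rmorphB rmorphMn /= -xE; field.
  rewrite mul_delta_12 mul_delta_21 fsbig1 => [|i _]; last first.
    by rewrite -addrA Y0 ?scaler0 // rpredD ?rpredN ?rpred_int ?rpred_nat.
  rewrite fsbig1 ?scaler0 ?subr0 // => i _.
  by rewrite Y0 ?rpredN ?rpred_nat // (lin0 (Y_sigma_linearr _ _)) scaler0.
under eq_bigr => j _ do rewrite e1E (mul_delta_10 _ _ m1) // -e1E.
have [[n ->]|ne0] := pselect (exists n : int, e0 = - n%:~R - 1); last first.
  have e0n n : e0 <> - n%:~R - 1 by move=> h; apply: ne0; exists n.
  rewrite (mul_delta_12_nonint _ _ _ e0n) (mul_delta_21_nonint _ _ _ e0n) scaler0 subr0.
  rewrite big1 ?scaler0 // => j _; apply: fsbig1 => i _.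
  rewrite Y_integral ?(lin0 (Y_sigma_linearl _ _)) ?scaler0 //.
  rewrite mul1r; apply/negP => /intrP[x xE]; apply: (e0n (- x - i%:Z - 1)).
  by rewrite !(rmorphD, rmorphN) /= -xE -pmulrn; ring.
rewrite mul_delta_12 mul_delta_21.
have := sigma_components w n e2 pu qv e1E; rewrite /sum_uv /sum_vu => ->.
have it j : iter j (@parity_map F V) u = (-1) ^+ (j * p) *: u.
  elim: j => [|j IH]; first by rewrite scale1r.
  rewrite iterS IH (linZ (@parity_map_linear F V)) (parity_map_sign pu) scalerA.
  by rewrite mulSn exprD mulrC.
have bE (j : nat) : (-1 : F) ^ (j%:Z * b) = (-1) ^+ (j * odd (absz b)).
  have -> : (-1) ^+ (j * odd (absz b)) = ((-1 : F) ^ b) ^+ j.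
    rewrite mulnC exprM signr_odd; congr (_ ^+ _).
    by case: b {e1E} => // b; rewrite NegzE -exprz_inv invrN1.
  by rewrite mulrC -exprz_exp.
transitivity (2%:R^-1 *: \sum_(j < 2)
    ((-1) ^+ (j * odd (absz b)) * (-1) ^+ (j * p)) *: sum_iterate w n e1 e2 u v); last first.
  congr (_ *: _); apply: eq_bigr => j _.
  rewrite -(linZ (sum_iterate_linearl w n e1 e2 v)); apply: eq_fsbigr => i _.
  rewrite it bE !(linZ (Y_linearl v _)) !(linZ (Y_sigma_linearl w _)) !scalerA.
  congr (_ *: _); ring.
rewrite -scaler_suml scalerA; congr (_ *: _).
rewrite !big_ord_recl big_ord0 addr0 /= !mul0n !mul1n -signr_addb expr0 mulr1.
have two : (2%:R : F) != 0 by rewrite pnatr_eq0.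
by case: (odd _) {it pu} p => -[]; rewrite /= ?expr0 ?expr1 -?natrD ?mulVf ?subrr ?mulr0.
Qed.

Theorem sigma_module : weak_parity_twisted_module parityM Ys.
Proof.
split.
- exact: parity_map_automorphism.
- rewrite /primitive_root_of_unity; apply/andP; split=> //; apply/forallP => i.
  case: i => -[|[]] //= i; rewrite unity_rootE /= ?expr1 ?sqrrN ?expr1n ?eqxx //.
  by rewrite eqNr oner_eq0.
- exact: (mod_parity_direct_sum M_twisted).
- by move=> w e; exact: Y_sigma_linearl.
- by move=> u e; exact: Y_sigma_linearr.
- exact: Y_sigma_support.
- exact: Y_sigma_parity.
- move=> u w; have [N uN] := Y_sigma_truncation u w.
  exists N%:R => n Nn; apply: uN.
  by apply: (@lt_trans _ _ (- n)); rewrite ?ltrN2 // ltrBlDr ltrDl.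
- exact: Y_sigma_vac.
exact: sigma_twisted_jacobi.
Qed.

End SigmaModule.

Theorem theorem6p3 (R : realType) (V : vertex_operator_superalgebra R[i])
    (k : nat) (k_gt0 : (0 < k)%N) (k_even : ~~ odd k)
    (W : vertex_operator_superalgebra R[i]) (tens : {ffun 'I_k -> V} -> W)
    (W_tensor : is_tensor_power_vosa tens)
    (g : W -> W) (g_cyclic : is_cyclic_permutation tens g)
    (eta : R[i])
    (a : nat -> R[i]) (a_def : is_change_of_variable k a)
    (M : lmodType R[i]) (parityM : bool -> set M) (Yg : W -> M -> series M)
    (M_twisted : weak_twisted_module g k eta parityM Yg) :
  weak_parity_twisted_module parityM (Y_sigma a tens Yg).
Proof.
have k_gt1 : (1 < k)%N by rewrite ltn_neqAle k_gt0 andbT; apply: contraNneq k_even => <-.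
exact: (sigma_module k_gt1 k_even W_tensor g_cyclic a_def M_twisted).
Qed.
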